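(* Let $\lambda$ and $\mu$ be two partitions with $|\lambda|=|\mu|$. Suppose that there exists an odd integer $o\neq 1$ that appears at least twice in $\lambda$ and that there exists an even integer $e\geq 2o$ in $\mu$. Let $z_{\lambda,\mu}(g,h,m)$ be the associated proper zigzag numbers (defined in the context). Then the uniform logarithmic asymptotics for $z_{\lambda,\mu}(g,h,m)$ is bounded below by $\frac{h}{3}\ln h+2g\ln m+4m\ln m$ as $m,h,g\to\infty$, that is, $$\liminf_{g,m,h\to\infty}\frac{\ln z_{\lambda,\mu}(g,h,m)}{\frac{h}{3}\ln h+2g\ln m+4m\ln m}\geq 1.$$
   Context: **Conventions.** Partitions are unordered; $l(\lambda)$ is the number of entries and $|\lambda|$ the sum of the entries of $\lambda$; $(1^n)$ is the partition with $n$ entries equal to $1$; $(\lambda,\nu)$ is the partition whose entries are those of $\lambda$ together with those of $\nu$. The liminf over $g,m,h\to\infty$ is joint: $\liminf f\ge 1$ means that for every $\varepsilon>0$ there is $N$ with $f(g,h,m)\ge 1-\varepsilon$ whenever $g,h,m\ge N$. **The numbers $z_{\lambda,\mu}(g,h,m)$.** For a partition $\lambda$, $\lambda_e$ denotes the partition consisting of the even integers that appear an odd number of times in $\lambda$, each taken once. With $o$ as in the claim, let $c\ge 0$ be given by $2c=\big||\lambda_e|+2o-|\mu_e|\big|$, let $\lambda'$ be $\lambda$ with the entries of $\lambda_e$ and two entries $o$ removed, and let $\mu'$ be $\mu$ with the entries of $\mu_e$ removed. Put $$z_{\lambda,\mu}(g,h,m)=Z_g\big((\lambda,1^{2c+h+2m-1}),(\mu,1^{2c+h+2m-1});s(h),t(m)\big),$$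 $$s(h)=\tfrac{l(\lambda')+l(\mu')}{2}+c+h,\qquad t(m)=l(\lambda_e)+l(\mu_e)+2g-2+4m+2c,$$ where $Z_g(\lambda,\mu;s,t)$ is the proper zigzag number defined below. **Tropical covers.** A tropical curve $C$ is a connected metric graph all of whose vertices have valence $1$ (leaves) or $3$ (inner vertices); edges incident to leaves are called ends and have infinite length, all other edges are inner edges and have finite length. The genus of $C$ is its first Betti number. An isomorphism of tropical curves is an isometric homeomorphism of the curves with leaves removed. Put $T\mathbb{P}^1=\mathbb{R}\cup\{\pm\infty\}$. Let $g\ge0$, let $\lambda,\mu$ be partitions with $|\lambda|=|\mu|\geq 1$ and let $s,t\ge0$ satisfy $2s+t=l(\lambda)+l(\mu)+2g-2$; it is assumed throughout that $2s+t>0$ and that $\{\lambda,\mu\}\not\subset\{(2k),(k,k)\}$ for all $k$. An $(s,t)$-distribution $\underline z=\underline x\sqcup\underline y$ consists of a set $\underline x$ of $s$ pairs $x_i=(x'_{2i-1},x'_{2i})$ of real numbers with $x'_1<\dots<x'_{2s}$ and a set $\underline y$ of $t$ further real numbers, distinct from the $x'_j$ and not contained in any $[x'_{2i-1},x'_{2i}]$. A tropical cover of type $(g,\lambda,\mu,\underline z)$ is a continuous map $\varphi:C\to T\mathbb{P}^1$ from a tropical curve of genus $g$ such that: the images of the inner vertices are exactly the $2s+t$ numbers $x'_j$ and $y\in\underline y$ (so $\varphi$ is a bijection from inner vertices to these numbers); leaves are mapped to $\{\pm\infty\}$; $\varphi$ is piecewise integer affine linear with slope $\omega(e)\in\mathbb{N}_{>0}$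 (the weight) on each edge $e$; at each inner vertex, orienting edges in the direction in which $\varphi$ increases, the sum of the weights of incoming edges equals that of outgoing edges; the entries of $\lambda$ (resp. $\mu$) are the weights of the ends going to $-\infty$ (resp. $+\infty$). Edges are always oriented in this way and are called odd/even according to their weights. Covers $\varphi_1,\varphi_2$ are isomorphic if there is an isomorphism $\Phi:C_1\to C_2$ of tropical curves with $\varphi_2\circ\Phi=\varphi_1$. **Resolving covers.** A symmetric cycle (resp. symmetric fork) is a pair of inner edges of equal weight with the same two endpoints (resp. a pair of ends of equal weight adjacent to the same inner vertex). A tropical cover is resolving if for each $i=1,\dots,s$ the inner vertices $v,v'$ with $\varphi(v)=x'_{2i-1}$, $\varphi(v')=x'_{2i}$ are adjacent and one of the following holds (weights otherwise arbitrary subject to balancing): (A) $v$ has two incoming edges of equal weight $k$ and one outgoing edge (of weight $2k$) ending at $v'$, and $v'$ has one further incoming edge and one outgoing edge; (A') $v$ has one incoming and two outgoing edges, one of which has weight $2k$ and ends at $v'$, where it splits into two outgoing edges of equal weight $k$; in (A) and (A') the two weight-$k$ edges must form a symmetric fork or a symmetric cycle; (B) $v$ has one incoming and two outgoing edges, exactly one of the outgoing edges ends at $v'$, and $v'$ has one further incoming edge and one outgoing edge; (C) $v$ and $v'$ are joined by two edges, not both odd. The edge joining $v$ and $v'$ (both edges in case (C)) is called contractible; there are no other contractible edges. A symmetric cycle or fork is non-contractible if it contains no contractible edge. $\mathrm{Sym}_2(\varphi)$ is the set of non-contractible symmetric cycles and forks that are not adjacent to a contractible edge. **Generalized zigzag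 covers.** A resolving tropical cover $\varphi:C\to T\mathbb{P}^1$ is a generalized zigzag cover if there is a non-empty connected subgraph $S\subset C\setminus\mathrm{Sym}_2(\varphi)$ (i.e. $S$ contains no edge of a cycle or fork in $\mathrm{Sym}_2(\varphi)$) such that: (1) all contractible edges lie in $S$ and $S$ contains at least one inner vertex; (2) $S$ contains no even edges except even contractible ones; (3) every connected component of $C\setminus S$ is a tail of one of the following forms, attached to $S$ at one point, with $o$ odd and $e$ even: a symmetric fork of two ends of weight $o$ followed by a chain of $n\ge0$ symmetric cycles with edges of weight $o$, consecutive pieces and finally $S$ being connected by edges of weight $2o$; one end of weight $2o$ followed by a chain of $n\ge0$ symmetric cycles with edges of weight $o$, consecutive pieces and finally $S$ being connected by edges of weight $2o$; a symmetric fork of two ends of weight $e$ connected to $S$ by an edge of weight $2e$; a single end of weight $2e$ attached to $S$. **Proper zigzag numbers.** Given $w_1<\dots<w_{2s+t}$ in $\mathbb{R}$, the trivial $(s,t)$-distribution is $\underline x=\{(w_1,w_2),\dots,(w_{2s-1},w_{2s})\}$, $\underline y=\{w_{2s+1},\dots,w_{2s+t}\}$. A generalized zigzag cover $\varphi:C\to T\mathbb{P}^1$ of type $(g,\lambda,\mu,\underline x\sqcup\underline y)$ for the trivial distribution is properly mixed if: (1) there is an odd inner edge $E_c\subset S$ such that $C\setminus E_c^\circ$ has two connected components, the inner vertices of one being mapped onto $\{w_1,\dots,w_{2s}\}$ and those of the other onto $\{w_{2s+1},\dots,w_{2s+t}\}$; (2) if $E_c$ is oriented from $v_1$ to $v_2$,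 there is a vertex $v_1'$ with $\varphi(v_1')=w_1$, $\varphi(v_1)=w_2$; (3) $(v_1',v_1)$ is of form (B): $v_1'$ has one odd incoming edge, one odd outgoing edge, and an even outgoing (contractible) edge ending at $v_1$; $v_1$ has a further odd incoming edge and an odd outgoing edge; moreover the two odd incoming edges (at $v_1'$ and at $v_1$) are ends of $C$ of the same weight; (4) $\varphi(v_2)=w_{2s+t}$ and $v_2$ has two odd incoming edges. $Z_g(\lambda,\mu;s,t)$ is the number of isomorphism classes of properly mixed generalized zigzag covers of type $(g,\lambda,\mu,\underline x\sqcup\underline y)$. *)

(* Defs.v *)
From mathcomp Require Export all_boot all_order all_algebra.
From mathcomp Require Export finmap.
From mathcomp Require Export all_classical all_reals.
From mathcomp Require Export ereal exp.
Set Implicit Arguments.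
Unset Strict Implicit.
Unset Printing Implicit Defensive.
Import Order.TTheory GRing.Theory Num.Theory.
Local Open Scope ring_scope.

(* Partitions are sequences of positive integers; everything below depends on
   them only up to permutation. *)
Definition is_partition (la : seq nat) : bool := 0%N \notin la.

(* -------------------------------------------------------------------------- *)
(* Metric graphs and tropical curves                                          *)

(* A finite metric graph. The vertex and edge sets are ordinals, which every
   finite graph is isomorphic to; this keeps the collection of all graphs a
   type on which isomorphism classes can be counted. The orientation given by
   src and tgt is a bookkeeping device; for a cover it is required to be the
   direction in which the map increases. *)
Record metric_graph (R : realType) := MetricGraph {
  nv : nat;
  ne : nat;
  src : 'I_ne -> 'I_nv;
  tgt : 'I_ne -> 'I_nv;
  len : 'I_ne -> \bar R }.

Definition inE_ (R : realType) (G : metric_graph R) (v : 'I_(nv G)) :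
  {set 'I_(ne G)} := [set e | tgt e == v]%SET.

Definition outE_ (R : realType) (G : metric_graph R) (v : 'I_(nv G)) :
  {set 'I_(ne G)} := [set e | src e == v]%SET.

(* A loop contributes 2 to the valence. *)
Definition valence (R : realType) (G : metric_graph R) (v : 'I_(nv G)) : nat :=
  (#|inE_ v| + #|outE_ v|)%N.

Definition leaf (R : realType) (G : metric_graph R) (v : 'I_(nv G)) : bool :=
  valence v == 1%N.

Definition inner_vertex (R : realType) (G : metric_graph R) (v : 'I_(nv G)) :
  bool := valence v == 3%N.

Definition is_end (R : realType) (G : metric_graph R) (e : 'I_(ne G)) : bool :=
  leaf (src e) || leaf (tgt e).

Definition joins (R : realType) (G : metric_graph R) (e : 'I_(ne G))
    (u v : 'I_(nv G)) : bool :=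
  ((src e == u) && (tgt e == v)) || ((src e == v) && (tgt e == u)).

Definition incident (R : realType) (G : metric_graph R) (e : 'I_(ne G))
    (v : 'I_(nv G)) : bool := (src e == v) || (tgt e == v).

Definition connected_graph (R : realType) (G : metric_graph R) : Prop :=
  (0 < nv G)%N /\
  forall u v : 'I_(nv G), connect (fun x y => [exists e, joins e x y]) u v.

(* First Betti number of a connected graph. *)
Definition genus (R : realType) (G : metric_graph R) : nat :=
  ((ne G).+1 - nv G)%N.

Definition tropical_curve (R : realType) (G : metric_graph R) : Prop :=
  [/\ connected_graph G,
      forall v : 'I_(nv G), leaf v || inner_vertex v,
      forall e : 'I_(ne G), is_end e -> len e = +oo%E &
      forall e : 'I_(ne G), ~~ is_end e -> (0 < len e < +oo)%E].

(* -------------------------------------------------------------------------- *)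
(* Tropical covers                                                            *)

(* A map to the tropical projective line that is affine on edges is recorded
   by its values phi on the vertices and its slopes wt on the edges. *)
Record graph_map (R : realType) := GraphMap {
  curve :> metric_graph R;
  phi : 'I_(nv curve) -> \bar R;
  wt : 'I_(ne curve) -> nat }.

(* x is the list of pairs (x'_(2i-1), x'_(2i)), and y lists the remaining
   points. *)
Definition is_distribution (R : realType) (s t : nat)
    (x : seq (R * R)) (y : seq R) : Prop :=
  [/\ size x = s, size y = t,
      sorted <%R (flatten [seq [:: p.1; p.2] | p <- x]),
      uniq y &
      forall b p, b \in y -> p \in x -> ~~ (p.1 <= b <= p.2)].

Definition dist_points (R : realType) (x : seq (R * R)) (y : seq R) : seq R :=
  flatten [seq [:: p.1; p.2] | p <- x] ++ y.

Record tropical_cover (R : realType) (g : nat) (la mu : seq nat) (s t : nat)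
    (x : seq (R * R)) (y : seq R) (C : graph_map R) : Prop := TropicalCover {
  cover_dist : is_distribution s t x y;
  cover_curve : tropical_curve C;
  cover_genus : genus C = g;
  cover_inner : perm_eq [seq phi v | v <- enum 'I_(nv C) & inner_vertex v]
                        [seq r%:E | r <- dist_points x y];
  cover_leaf : forall v : 'I_(nv C), leaf v -> phi v = -oo%E \/ phi v = +oo%E;
  cover_wt : forall e : 'I_(ne C), (0 < wt e)%N;
  cover_incr : forall e : 'I_(ne C), (phi (src e) < phi (tgt e))%E;
  cover_slope : forall e : 'I_(ne C), ~~ is_end e ->
    phi (tgt e) = (phi (src e) + (wt e)%:R%:E * len e)%E;
  cover_balance : forall v : 'I_(nv C), inner_vertex v ->
    (\sum_(e in inE_ v) wt e = \sum_(e in outE_ v) wt e)%N;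
  cover_la : perm_eq [seq wt e | e <- enum 'I_(ne C) & phi (src e) == -oo%E] la;
  cover_mu : perm_eq [seq wt e | e <- enum 'I_(ne C) & phi (tgt e) == +oo%E] mu
}.

(* The isomorphism commutes with the maps to the tropical line; on edges this
   means that it preserves slopes. *)
Definition cover_iso (R : realType) (C1 C2 : graph_map R) : Prop :=
  exists (fv : 'I_(nv C1) -> 'I_(nv C2)) (fe : 'I_(ne C1) -> 'I_(ne C2)),
    [/\ bijective fv, bijective fe,
        forall e, src (fe e) = fv (src e) /\ tgt (fe e) = fv (tgt e),
        forall e, len (fe e) = len e &
        (forall v, phi (fv v) = phi v) /\ (forall e, wt (fe e) = wt e)].

(* -------------------------------------------------------------------------- *)
(* Resolving covers                                                           *)

Definition sym_cycle (R : realType) (C : graph_map R) (e1 e2 : 'I_(ne C)) :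
  bool :=
  [&& e1 != e2, ~~ is_end e1, ~~ is_end e2, wt e1 == wt e2
    & joins e2 (src e1) (tgt e1)].

Definition sym_fork (R : realType) (C : graph_map R) (e1 e2 : 'I_(ne C)) :
  bool :=
  [&& e1 != e2, is_end e1, is_end e2, wt e1 == wt e2
    & [exists v, [&& inner_vertex v, incident e1 v & incident e2 v]]].

Definition sym_pair (R : realType) (C : graph_map R) (e1 e2 : 'I_(ne C)) :
  bool := sym_cycle e1 e2 || sym_fork e1 e2.

Definition form_A (R : realType) (C : graph_map R) (v v' : 'I_(nv C)) : Prop :=
  exists e1 e2 f : 'I_(ne C),
    [/\ inE_ v = [set e1; e2]%SET /\ sym_pair e1 e2,
        outE_ v = [set f]%SET /\ tgt f = v',
        #|inE_ v'| = 2%N & #|outE_ v'| = 1%N].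

Definition form_A' (R : realType) (C : graph_map R) (v v' : 'I_(nv C)) : Prop :=
  exists e1 e2 f : 'I_(ne C),
    [/\ #|inE_ v| = 1%N, #|outE_ v| = 2%N,
        src f = v /\ inE_ v' = [set f]%SET &
        outE_ v' = [set e1; e2]%SET /\ sym_pair e1 e2].

Definition form_B (R : realType) (C : graph_map R) (v v' : 'I_(nv C)) : Prop :=
  [/\ #|inE_ v| = 1%N, #|outE_ v| = 2%N, #|outE_ v :&: inE_ v'| = 1%N,
      #|inE_ v'| = 2%N & #|outE_ v'| = 1%N].

Definition form_C (R : realType) (C : graph_map R) (v v' : 'I_(nv C)) : Prop :=
  #|outE_ v :&: inE_ v'| = 2%N /\
  exists2 e, e \in outE_ v :&: inE_ v' & ~~ odd (wt e).

(* In each of the four forms v and v' are adjacent. *)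
Definition resolving (R : realType) (x : seq (R * R)) (C : graph_map R) : Prop :=
  forall p, p \in x ->
  forall v v' : 'I_(nv C), phi v = p.1%:E -> phi v' = p.2%:E ->
    [\/ form_A v v', form_A' v v', form_B v v' | form_C v v'].

Definition contractible (R : realType) (x : seq (R * R)) (C : graph_map R)
    (e : 'I_(ne C)) : bool :=
  has (fun p => (phi (src e) == p.1%:E) && (phi (tgt e) == p.2%:E)) x.

Definition edges_touch (R : realType) (C : graph_map R) (e1 e2 : 'I_(ne C)) :
  bool := [exists v, incident e1 v && incident e2 v].

Definition in_Sym2 (R : realType) (x : seq (R * R)) (C : graph_map R)
    (e1 e2 : 'I_(ne C)) : bool :=
  [&& sym_pair e1 e2, ~~ contractible x e1, ~~ contractible x e2
    & [forall c, contractible x c ==>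
                 ~~ edges_touch c e1 && ~~ edges_touch c e2]].

(* -------------------------------------------------------------------------- *)
(* Generalized zigzag covers                                                  *)

(* Subsets of C that are unions of cells: vertices (inl) and open edges (inr). *)
Definition cell (R : realType) (C : metric_graph R) : finType :=
  ('I_(nv C) + 'I_(ne C))%type.

Definition cell_adj (R : realType) (C : metric_graph R) (c d : cell C) : bool :=
  match c, d with
  | inl v, inr e => incident e v
  | inr e, inl v => incident e v
  | _, _ => false
  end.

Definition is_subgraph (R : realType) (C : metric_graph R)
    (S : {set cell C}) : Prop :=
  forall e : 'I_(ne C), inr e \in S ->
    (inl (src e) \in S) /\ (inl (tgt e) \in S).

Definition connect_in (R : realType) (C : metric_graph R) (X : {set cell C}) :
  rel (cell C) :=
  connect (fun c d => [&& c \in X, d \in X & cell_adj c d]).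

Definition component (R : realType) (C : metric_graph R) (X : {set cell C})
    (c : cell C) : {set cell C} := [set d | connect_in X c d]%SET.

(* end_tail, fork_tail and odd_tail state that F is the set of cells of a tail
   attached to the rest of the curve at the vertex u, where u is not in F. *)
Definition end_tail (R : realType) (C : graph_map R) (k : nat) (u : 'I_(nv C))
    (F : {set cell C}) : Prop :=
  exists (a : 'I_(ne C)) (l : 'I_(nv C)),
    [/\ leaf l, joins a u l, wt a = k.*2 & F = [set inr a; inl l]%SET].

Definition fork_tail (R : realType) (C : graph_map R) (k : nat) (u : 'I_(nv C))
    (F : {set cell C}) : Prop :=
  exists (a a1 a2 : 'I_(ne C)) (v l1 l2 : 'I_(nv C)),
    [/\ joins a u v /\ wt a = k.*2,
        sym_fork a1 a2 /\ wt a1 = k,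
        joins a1 v l1 /\ leaf l1,
        joins a2 v l2 /\ leaf l2 &
        F = [set inr a; inl v; inr a1; inl l1; inr a2; inl l2]%SET].

Inductive odd_tail (R : realType) (C : graph_map R) (k : nat) :
    'I_(nv C) -> {set cell C} -> Prop :=
| odd_tail_end u F : end_tail k u F -> odd_tail k u F
| odd_tail_fork u F : fork_tail k u F -> odd_tail k u F
| odd_tail_cycle u v v' a a1 a2 F :
    joins a u v -> wt a = k.*2 ->
    sym_cycle a1 a2 -> wt a1 = k -> joins a1 v v' ->
    odd_tail k v' F ->
    odd_tail k u ([set inr a; inl v; inr a1; inr a2; inl v']%SET :|: F).

Definition is_tail (R : realType) (C : graph_map R) (u : 'I_(nv C))
    (F : {set cell C}) : Prop :=
  exists k : nat,
    if odd k then odd_tail k u F else end_tail k u F \/ fork_tail k u F.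

Record zigzag_subgraph (R : realType) (x : seq (R * R)) (C : graph_map R)
    (S : {set cell C}) : Prop := ZigzagSubgraph {
  zz_subgraph : is_subgraph S;
  zz_connected : forall c d, c \in S -> d \in S -> connect_in S c d;
  zz_Sym2 : forall e1 e2 : 'I_(ne C), in_Sym2 x e1 e2 -> inr e1 \notin S;
  zz_contractible : forall e : 'I_(ne C), contractible x e -> inr e \in S;
  zz_inner : exists2 v : 'I_(nv C), inner_vertex v & inl v \in S;
  zz_even : forall e : 'I_(ne C), inr e \in S -> ~~ odd (wt e) ->
    contractible x e;
  zz_tails : forall c, c \notin S ->
    exists2 u : 'I_(nv C), inl u \in S & is_tail u (component (~: S) c) }.

(* C is a generalized zigzag cover, as witnessed by the subgraph S. *)
Definition generalized_zigzag (R : realType) (x : seq (R * R))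
    (C : graph_map R) (S : {set cell C}) : Prop :=
  resolving x C /\ zigzag_subgraph x S.

(* -------------------------------------------------------------------------- *)
(* Proper zigzag numbers                                                      *)

(* The increasing reals w_1, w_2, ... are w 0, w 1, ... *)
Definition trivial_x (R : realType) (s : nat) (w : nat -> R) : seq (R * R) :=
  [seq (w i.*2, w i.*2.+1) | i <- iota 0 s].

Definition trivial_y (R : realType) (s t : nat) (w : nat -> R) : seq R :=
  [seq w i | i <- iota s.*2 t].

(* Vertices u and v are connected in C minus the open edge a. *)
Definition connect_minus (R : realType) (C : metric_graph R) (a : 'I_(ne C)) :
  rel 'I_(nv C) :=
  connect (fun u v => [exists e, (e != a) && joins e u v]).

(* src Ec and tgt Ec are the vertices v_1 and v_2; form_B and the cardinality
   it fixes make the listed edges at v1' and at src Ec distinct. *)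
Definition properly_mixed_at (R : realType) (s t : nat) (w : nat -> R)
    (C : graph_map R) (S : {set cell C}) (Ec : 'I_(ne C)) : Prop :=
  [/\ [/\ inr Ec \in S, ~~ is_end Ec & odd (wt Ec)],
      exists a b : 'I_(nv C),
        [/\ ~~ connect_minus Ec a b,
            forall v, connect_minus Ec a v || connect_minus Ec b v,
            [seq phi v | v <- enum 'I_(nv C)
                       & inner_vertex v && connect_minus Ec a v]
              =i [seq (w i)%:E | i <- iota 0 s.*2] &
            [seq phi v | v <- enum 'I_(nv C)
                       & inner_vertex v && connect_minus Ec b v]
              =i [seq (w i)%:E | i <- iota s.*2 t]],
      exists (v1' : 'I_(nv C)) (i1' o1' k i1 : 'I_(ne C)),
        [/\ phi v1' = (w 0%N)%:E /\ phi (src Ec) = (w 1%N)%:E,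
            form_B v1' (src Ec) /\ (src k = v1' /\ tgt k = src Ec),
            [/\ inE_ v1' = [set i1']%SET, outE_ v1' = [set o1'; k]%SET,
                inE_ (src Ec) = [set k; i1]%SET &
                outE_ (src Ec) = [set Ec]%SET],
            [/\ odd (wt i1'), odd (wt o1'), ~~ odd (wt k) & odd (wt i1)] &
            [/\ is_end i1', is_end i1 & wt i1' = wt i1]] &
      phi (tgt Ec) = (w (s.*2 + t).-1)%:E /\
      #|[set e in inE_ (tgt Ec) | odd (wt e)]%SET| = 2%N].

Definition properly_mixed (R : realType) (s t : nat) (w : nat -> R)
    (C : graph_map R) : Prop :=
  exists (S : {set cell C}) (Ec : 'I_(ne C)),
    generalized_zigzag (trivial_x s w) S /\ properly_mixed_at s t w S Ec.

Local Open Scope classical_set_scope.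

Definition proper_zigzag_covers (R : realType) (w : nat -> R) (g : nat)
    (la mu : seq nat) (s t : nat) : set (graph_map R) :=
  [set C | tropical_cover g la mu s t (trivial_x s w) (trivial_y s t w) C /\
           properly_mixed s t w C].

(* Number of isomorphism classes; fset_set would send an infinite set to the
   empty one. *)
Definition proper_zigzag_number (R : realType) (w : nat -> R) (g : nat)
    (la mu : seq nat) (s t : nat) : nat :=
  #|` fset_set [set [set D | cover_iso C D] | C in
                 proper_zigzag_covers w g la mu s t] |%fset.

Local Close Scope classical_set_scope.

(* -------------------------------------------------------------------------- *)
(* The numbers z_(la,mu)(g,h,m)                                               *)

Definition even_part (la : seq nat) : seq nat :=
  [seq k <- undup la | ~~ odd k && odd (count_mem k la)].

Definition remove_entries (nu la : seq nat) : seq nat :=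
  foldr (fun k l => rem k l) la nu.

(* |sum la_e + 2 o - sum mu_e| is even. *)
Definition c_num (la mu : seq nat) (o : nat) : nat :=
  (`|(sumn (even_part la) + o.*2)%:Z - (sumn (even_part mu))%:Z|%N)./2.

(* size la' + size mu' is even when sumn la = sumn mu. *)
Definition s_num (la mu : seq nat) (o h : nat) : nat :=
  let la' := remove_entries (even_part la ++ [:: o; o]) la in
  let mu' := remove_entries (even_part mu) mu in
  ((size la' + size mu')./2 + c_num la mu o + h)%N.

Definition t_num (la mu : seq nat) (o g m : nat) : nat :=
  (size (even_part la) + size (even_part mu) + 2 * g + 4 * m
   + 2 * c_num la mu o - 2)%N.

(* For g, m > 0 the natural-number subtractions are not truncated. *)
Definition z_num (R : realType) (w : nat -> R) (la mu : seq nat)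
    (o g h m : nat) : nat :=
  let ones := nseq (2 * c_num la mu o + h + 2 * m - 1) 1%N in
  proper_zigzag_number w g (la ++ ones) (mu ++ ones)
    (s_num la mu o h) (t_num la mu o g m).

(* Main.v *)
(** Every cover in the family below is a tree of inner vertices, apart from
    symmetric cycles, rooted at [v_1']. The part over the pairs is a chain of pairs
    of trunk vertices carrying an odd weight; [nbr] of them are of form (B) with
    weights 1, 1 and sprout a branch that begins with two incoming ends of weight 1
    merging. These [nbr ~ h/3] merging pairs are mutually incomparable, so they may
    be ordered freely, which gives the factor [nbr!]. The part over the single points
    is a string of odd flow alternating, in its last [2 n0 ~ 2m] vertices, between
    flow [1] and [-1], so that it zigzags between two layers of [n0] points; every
    downward tail carries [g / n0] symmetric cycles and a fork, which gives
    [2 (g / n0) + 1] further layers of size [n0], and the upward forks give one more. Permuting the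
    points inside each layer yields [n0! ^ (2 (g / n0) + 4)], up to the remainder of
    the division.

    Different permutations give non-isomorphic covers: an isomorphism induces an
    automorphism of the rooted tree that preserves layers, and distinct children of a
    vertex lie in distinct layers. Stirling's lower bound
    [k ln k - k <= ln k!] then turns the count into the stated asymptotics. *)
Require Import Defs.
From mathcomp Require Import sequences.
From mathcomp Require Import zify ring lra.
Set Implicit Arguments.
Unset Strict Implicit.
Unset Printing Implicit Defensive.
Import Order.TTheory GRing.Theory Num.Theory.
Local Open Scope ring_scope.

(** * Counting covers up to isomorphism *)

(** Only entries 1 may be appended, equally many to both partitions, and this dictates the gadgets.
    A merging pair turns weight 1 into 3, and 3 has to be split again into three ends of weight 1.
    So one freely movable merging pair costs three pairs: the trunk pair that releases the branch,
    the merging pair and a splitting pair. This is the origin of [h/3]. The vertex [v_1'] passes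
    weight 1 to the trunk and the even weight [o - 1], positive as [o <> 1], to [v_1], so [E_c]
    carries [2 o - 1]. Since [v_2] is topmost with two odd incoming edges, its third edge is an end
    of even weight at least [2 o]. This is where [e] enters, and it makes the flow behind [v_2]
    negative. The other entries of the two partitions are absorbed by boundedly many vertices. Forks
    of weight 1 placed around them keep all weights positive and restore weight 1 on the trunk and
    flow -1 on the string. Their numbers do not depend on [g], [h], [m], so they cost only an
    additive constant in [nbr] and [n0]. As [g] may be smaller than [n0], the remainder [r] of [g]
    modulo [n0] cannot be neglected: it contributes two further layers of size [r], whose factor
    [r! ^ 2] saves [2 r ln m]. *)

Lemma mem_leq_sumn (s : seq nat) x : x \in s -> (x <= sumn s)%N.
Proof.
elim: s => //= y s IH; rewrite inE => /orP[/eqP ->|/IH]; lia.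
Qed.

(** * A priori bounds for a cover of fixed type *)

Section Bounds.
Variables (R : realType) (g : nat) (la mu : seq nat) (s t : nat).
Variables (x : seq (R * R)) (y : seq R) (C : graph_map R).
Hypothesis cC : tropical_cover g la mu s t x y C.

Lemma inner_or_leaf (v : 'I_(nv C)) : leaf v || inner_vertex v.
Proof. by have [_ + _ _] := cover_curve cC; apply. Qed.

(** By induction on the number of vertices below the source. An edge leaving an inner vertex weighs
    at most the sum of the edges entering it. There are at most three of these, and each starts
    strictly lower. An edge starting at a leaf is an end listed in [la]. *)
Lemma cover_wt_le (e : 'I_(ne C)) :
  (wt e <= sumn la * 3 ^ #|[set v : 'I_(nv C) | (phi v < phi (src e))%E]|)%N.
Proof.
have [r] := ubnP #|[set v : 'I_(nv C) | (phi v < phi (src e))%E]|.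
elim: r e => // r IH e; rewrite ltnS => le_r.
have /orP[lf|inn] := inner_or_leaf (src e).
  have phie : phi (src e) = -oo%E.
    have [//|ph] := cover_leaf cC lf.
    by have := cover_incr cC e; rewrite ph ltNge leey.
  apply: (@leq_trans (sumn la)); last by rewrite leq_pmulr ?expn_gt0.
  apply: mem_leq_sumn; rewrite -(perm_mem (cover_la cC)).
  by apply/mapP; exists e => //; rewrite mem_filter phie eqxx mem_enum.
have le_in : (wt e <= \sum_(f in inE_ (src e)) wt f)%N.
  rewrite (cover_balance cC inn) (bigD1 e) /= ?leq_addr //.
  by rewrite inE.
apply: (leq_trans le_in).
have lt_in f : f \in inE_ (src e) ->
    (#|[set v : 'I_(nv C) | (phi v < phi (src f))%E]| < #|[set v : 'I_(nv C) | (phi v < phi (src e))%E]|)%N.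
  rewrite inE => /eqP tf; apply/proper_card/fintype.properP.
  have lt_f : (phi (src f) < phi (src e))%E by rewrite -tf (cover_incr cC).
  split; first by apply/fintype.subsetP => v; rewrite !inE => /lt_trans; apply.
  by exists (src f); rewrite inE // ltxx.
case E: #|[set v : 'I_(nv C) | (phi v < phi (src e))%E]| => [|k].
  rewrite big1 // => f /lt_in; by rewrite E.
apply: (@leq_trans (\sum_(f in inE_ (src e)) sumn la * 3 ^ k)%N).
  apply: leq_sum => f fin; have := lt_in f fin; rewrite E ltnS => le_k.
  apply: (leq_trans (IH f _)); last by rewrite leq_mul2l leq_exp2l // le_k orbT.
  by apply: leq_trans le_r; rewrite E ltnS.
rewrite sum_nat_const expnS (mulnCA _ 3%N) leq_mul2r; apply/orP; right.
by move: inn; rewrite /inner_vertex /valence => /eqP <-; rewrite leq_addr.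
Qed.

Lemma cover_card_inner : #|[pred v : 'I_(nv C) | inner_vertex v]| = size (dist_points x y).
Proof.
have /perm_size := cover_inner cC; rewrite !size_map => <-.
by rewrite cardE enumT.
Qed.

Lemma cover_card_leaf :
  (#|[pred v : 'I_(nv C) | leaf v]| <= size la + size mu)%N.
Proof.
have /perm_size := cover_la cC; have /perm_size := cover_mu cC.
rewrite !size_map => <- <-.
have ex (v : 'I_(nv C)) : leaf v ->
    {e | (src e == v) && (phi v == -oo%E) || (tgt e == v) && (phi v == +oo%E)}.
  move=> lf; apply: sigW; have := lf; rewrite /leaf /valence => /eqP val1.
  have /finset.set0Pn[e] : inE_ v :|: outE_ v != finset.set0.
    rewrite -card_gt0 cardsU; have := subset_leq_card (subsetIl (inE_ v) (outE_ v)).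
    have := subset_leq_card (subsetIr (inE_ v) (outE_ v)); lia.
  have [ph|ph] := cover_leaf cC lf.
    rewrite !inE => /orP[/eqP te|se]; last by exists e; rewrite se ph eqxx.
    by have := cover_incr cC e; rewrite te ph ltNge leNye.
  rewrite !inE => /orP[se|/eqP te]; first by exists e; rewrite se ph eqxx orbT.
  by have := cover_incr cC e; rewrite te ph ltNge leey.
(* Each leaf is charged to its edge. The Boolean records the side, since one edge may join a leaf
   over [-oo] to a leaf over [+oo] and is then charged by both. *)
pose h (v : 'I_(nv C)) : option ('I_(ne C) * bool) :=
  if pselect (leaf v : Prop) is left lf then Some (sval (ex v lf), phi v == -oo%E) else None.
pose A1 := [set e : 'I_(ne C) | phi (src e) == -oo%E].
pose A2 := [set e : 'I_(ne C) | phi (tgt e) == +oo%E].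
have -> : size [seq e <- enum 'I_(ne C) | phi (src e) == -oo%E] = #|A1|.
  by rewrite cardE /(enum A1) -enumT; congr size; apply: eq_filter => e; rewrite !inE.
have -> : size [seq e <- enum 'I_(ne C) | phi (tgt e) == +oo%E] = #|A2|.
  by rewrite cardE /(enum A2) -enumT; congr size; apply: eq_filter => e; rewrite !inE.
have inj_h : {in [pred v | leaf v] &, injective h}.
  move=> v v'; rewrite !inE /h => lv lv'.
  case: pselect => // p; case: pselect => // p' [].
  case: (ex v p) (ex v' p') => e /= He [e' /= He'] ee eb; subst e'.
  move: He He'; rewrite eb; case E: (phi v' == -oo%E) eb => eb.
    by rewrite (eqP E) (eqP eb) !andbT !andbF !orbF => /eqP <- /eqP.
  by rewrite !andbF /= => /andP[/eqP <- _] /andP[/eqP <-].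
rewrite -(card_in_imset inj_h).
pose B := [set Some (e, true) | e in A1] :|: [set Some (e, false) | e in A2].
apply: (@leq_trans #|B|); last first.
  apply: leq_trans (leq_card_setU _ _) _.
  by rewrite leq_add // leq_imset_card.
apply: subset_leq_card; apply/fintype.subsetP => _ /imsetP[v lf ->].
rewrite /h; case: pselect => [p|]; last by move/negP; rewrite inE in lf; rewrite lf.
case: (ex v p) => e /= /orP[] /andP[/eqP ev /eqP ph]; rewrite /B inE.
  by rewrite ph eqxx; apply/orP; left; apply/imsetP; exists e; rewrite // inE ev ph.
by rewrite ph /=; apply/orP; right; apply/imsetP; exists e; rewrite // inE ev ph.
Qed.

Lemma cover_nv_le : (nv C <= size (dist_points x y) + (size la + size mu))%N.
Proof.
rewrite -cover_card_inner addnC.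
apply: leq_trans (leq_add cover_card_leaf (leqnn _)).
rewrite -[X in (X <= _)%N](card_ord (nv C)) -cardUI.
apply: leq_trans (leq_addr _ _); apply: subset_leq_card.
by apply/fintype.subsetP => v _; rewrite !inE inner_or_leaf.
Qed.

Lemma cover_ne_le : (ne C <= 3 * nv C)%N.
Proof.
rewrite -[X in (X <= _)%N](card_ord (ne C)).
rewrite -sum1_card (partition_big (@tgt _ C) xpredT) //=.
apply: (@leq_trans (\sum_(v < nv C) 3)%N); last by rewrite sum_nat_const card_ord mulnC.
apply: leq_sum => v _; rewrite sum1_card.
have -> : #|[pred i | tgt i == v]| = #|inE_ v| by rewrite cardsE.
by have /orP[] := inner_or_leaf v; rewrite /leaf /inner_vertex /valence => /eqP; lia.
Qed.

Lemma cover_phi_mem (v : 'I_(nv C)) :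
  phi v \in [:: -oo%E, +oo%E & [seq r%:E | r <- dist_points x y]].
Proof.
have /orP[/(cover_leaf cC)[->|->]|inn] := inner_or_leaf v; rewrite !inE ?eqxx ?orbT //.
rewrite -(perm_mem (cover_inner cC)); apply/orP; right; apply/orP; right.
by apply/mapP; exists v; rewrite // mem_filter inn mem_enum.
Qed.

Lemma cover_phi_inner (v : 'I_(nv C)) : inner_vertex v -> exists r, phi v = r%:E.
Proof.
move=> inn; have : phi v \in [seq r%:E | r <- dist_points x y].
  by rewrite -(perm_mem (cover_inner cC)); apply/mapP; exists v; rewrite // mem_filter inn mem_enum.
by move=> /mapP[r _ ->]; exists r.
Qed.

Lemma cover_lenE (e : 'I_(ne C)) :
  len e = if is_end e then +oo%E
          else ((fine (phi (tgt e)) - fine (phi (src e))) / (wt e)%:R)%:E.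
Proof.
case: ifP => [ie|/negbT nie]; first by have [_ _ + _] := cover_curve cC; apply.
have [_ _ _ /(_ _ nie)] := cover_curve cC.
have := cover_slope cC nie.
have /andP[/negbTE n1 /negbTE n2] : ~~ leaf (src e) && ~~ leaf (tgt e) by rewrite -negb_or.
have := inner_or_leaf (src e); have := inner_or_leaf (tgt e).
rewrite n1 n2 /= => /cover_phi_inner[b ->] /cover_phi_inner[a ->].
case: (len e) => [l||]; [|by move=> _ /andP[_]; rewrite ltxx|by move=> _ /andP[]].
rewrite -EFinM -EFinD /= => -[->] _; congr (_%:E).
have : (wt e)%:R != 0 :> R by rewrite pnatr_eq0 -lt0n (cover_wt cC).
by move=> ?; field.
Qed.

End Bounds.

(** * Finiteness of the set of covers of fixed type *)

Section Finite.
Variables (R : realType) (g : nat) (la mu : seq nat) (s t : nat).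
Variables (x : seq (R * R)) (y : seq R).

Let vals : seq (\bar R) := [:: -oo%E, +oo%E & [seq r%:E | r <- dist_points x y]].

(* The length of an edge is determined by the remaining data. *)
Definition decode_cover (k : nat) (a b : nat)
    (f : {ffun 'I_b -> 'I_a} * {ffun 'I_b -> 'I_a}
         * {ffun 'I_a -> 'I_(size vals)} * {ffun 'I_b -> 'I_k}) : graph_map R :=
  let: (fs, ft, fp, fw) := f in
  let ph v := nth -oo%E vals (fp v) in
  let G := MetricGraph fs ft (fun=> 0%E : \bar R) in
  @GraphMap R (MetricGraph fs ft (fun e =>
      if @is_end R G e then +oo%E
      else ((fine (ph (ft e)) - fine (ph (fs e))) / (val (fw e))%:R)%:E))
    ph (fun e => val (fw e)).

Local Open Scope classical_set_scope.

(** The class count goes through [fset_set], so any lower bound needs finiteness first. Vertices and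
    edges are bounded in number, weights are bounded, vertex images lie in a fixed list and lengths
    are determined by these, so every cover is decoded from one of finitely many finite types. *)
Lemma finite_tropical_covers :
  finite_set [set C | tropical_cover g la mu s t x y C].
Proof.
pose A := (size (dist_points x y) + (size la + size mu))%N.
pose k := (sumn la * 3 ^ A).+1.
apply: (@sub_finite_set _ _ (\bigcup_(a in `I_(A.+1)) \bigcup_(b in `I_((3 * A).+1))
   (range (@decode_cover k a b)))); last first.
  apply: bigcup_finite; first exact: finite_II.
  move=> a _; apply: bigcup_finite; first exact: finite_II.
  by move=> b _; apply: finite_image; apply: finite_finset.
move=> C /= cC.
have leA := cover_nv_le cC; have leB := cover_ne_le cC.
exists (nv C); first by rewrite /= ltnS.
exists (ne C); first by rewrite /= ltnS (leq_trans leB) // leq_mul2l leA orbT.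
have lek (e : 'I_(ne C)) : (wt e < k)%N.
  rewrite ltnS (leq_trans (cover_wt_le cC e)) // leq_mul2l leq_exp2l // (leq_trans _ leA) ?orbT //.
  by rewrite -[X in (_ <= X)%N](card_ord (nv C)) max_card.
have lep (v : 'I_(nv C)) : (index (phi v) vals < size vals)%N.
  by rewrite index_mem (cover_phi_mem cC).
exists (finfun (@src _ C), finfun (@tgt _ C), [ffun v => Ordinal (lep v)],
        [ffun e => Ordinal (lek e)]) => //=.
have lenE := cover_lenE cC; have phiE := cover_phi_mem cC.
clear cC leA leB; case: C lek lep lenE phiE => [[n m sr tg le] ph w] /= lek lep lenE phiE.
have es : (finfun sr : {ffun 'I_m -> 'I_n}) = sr :> ('I_m -> 'I_n) by apply: funext => i; rewrite ffunE.
have et : (finfun tg : {ffun 'I_m -> 'I_n}) = tg :> ('I_m -> 'I_n) by apply: funext => i; rewrite ffunE.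
have ep : (fun v => nth -oo%E vals ([ffun v => Ordinal (lep v)] v)) = ph.
  by apply: funext => v; rewrite ffunE /= nth_index // phiE.
have ew : (fun e => val ([ffun e => Ordinal (lek e)] e)) = w by apply: funext => v; rewrite ffunE.
rewrite /decode_cover es et.
have el : (fun e => if @is_end R (MetricGraph sr tg (fun=> 0%E)) e then +oo%E
    else ((fine (nth -oo%E vals ([ffun v => Ordinal (lep v)] (tg e)))
         - fine (nth -oo%E vals ([ffun v => Ordinal (lep v)] (sr e))))
         / (val ([ffun e => Ordinal (lek e)] e))%:R)%:E) = le.
  apply: funext => e; rewrite lenE !ffunE /= !nth_index ?phiE //.
by rewrite ew el ep.
Qed.

End Finite.

Section CountIso.
Variable R : realType.
Local Open Scope classical_set_scope.

Lemma cover_iso_refl (C : graph_map R) : cover_iso C C.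
Proof. by exists id, id; split=> //; exists id. Qed.

(** The classes of the [C x] are pairwise distinct members of a finite set. Reflexivity of
    [cover_iso] is enough to separate them: if two classes are equal, the first contains the
    representative of the second. *)
Lemma leq_proper_zigzag_number (w : nat -> R) g la mu s t (T : finType)
    (C : T -> graph_map R) :
  (forall x, proper_zigzag_covers w g la mu s t (C x)) ->
  (forall x x', cover_iso (C x) (C x') -> x = x') ->
  (#|T| <= proper_zigzag_number w g la mu s t)%N.
Proof.
move=> inC isoC; rewrite /proper_zigzag_number.
set A := [set _ | _ in _].
have finA : finite_set A.
  apply: finite_image; apply: sub_finite_set (finite_tropical_covers g la mu s t
    (trivial_x s w) (trivial_y s t w)) => D; by case.
pose cl x : set (graph_map R) := [set D | cover_iso (C x) D].
have inj_cl : injective cl.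
  move=> x x' e; apply/esym/isoC.
  have : cl x (C x) by exact: cover_iso_refl.
  by rewrite e.
rewrite cardE -(size_map cl); apply: uniq_leq_size.
  by rewrite map_inj_uniq // enum_uniq.
move=> _ /mapP[x _ ->]; rewrite in_fset_set // inE.
by exists (C x); first exact: inC.
Qed.
End CountIso.

(** * Covers from rooted binary trees *)

(* A tree of inner vertices. The slot [(u, b)] is an edge at [u], leading to a child
   or, if [child u b = None], to an end; it leaves [u] in the increasing direction iff
   [up u b]. A symmetric cycle is encoded by a vertex [u] with [dbl u], to which both
   slots of its parent lead; such a [u] has the single slot [(u, false)]. The root has an
   incoming end of weight [rootw] and a junk parent; [lev] makes [par] well-founded. *)
Record ztree := ZTree {
  node : finType;
  root : node;
  rootw : nat;
  child : node -> bool -> option node;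
  up : node -> bool -> bool;
  swt : node -> bool -> nat;
  par : node -> node * bool;
  dbl : node -> bool;
  lev : node -> nat }.

Arguments root {z}.
Arguments child {z}.
Arguments up {z}.
Arguments swt {z}.
Arguments par {z}.
Arguments dbl {z}.
Arguments lev {z}.

Section RawTree.
Variable T : ztree.
Notation U := (node T).
Notation redge_t := (option (U * bool)).
Implicit Types (u : U) (r : redge_t).

Implicit Types (v : U).

(* The edges are the slots [Some (u, b)] that are valid and the end [None] at the root. *)
Definition rvalid (r : redge_t) : bool :=
  if r is Some (u, b) then ~~ (dbl u && b) else true.
Definition rend (r : redge_t) : bool :=
  if r is Some (u, b) then child u b == None else true.
Definition rwt (r : redge_t) : nat :=
  if r is Some (u, b) then swt u b else rootw T.
(** A leaf is named after the edge that ends in it, so [inr r] is meaningful only for ends [r];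
    [inr None] is the leaf of the incoming end at the root. *)
Definition far (u : U) (b : bool) : U + redge_t :=
  if child u b is Some v then inl v else inr (Some (u, b)).
Definition rsrc (r : redge_t) : U + redge_t :=
  if r is Some (u, b) then if up u b then inl u else far u b else inr None.
Definition rtgt (r : redge_t) : U + redge_t :=
  if r is Some (u, b) then if up u b then far u b else inl u else inl root.
Definition rup (r : redge_t) : bool := if r is Some (u, b) then up u b else false.

Definition slots (u : U) : seq bool := if dbl u then [:: false] else [:: false; true].
(** The edges towards the root that enter [u] ([d = true]) or leave it ([d = false]). Explicit lists
    stand for the sets [inE_] and [outE_], so that valence, balancing and the local forms become
    computations. *)
Definition parents (d : bool) (u : U) : seq redge_t :=
  if dbl u then [seq Some ((par u).1, b) | b <- [:: false; true] & up (par u).1 b == d]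
  else if u == root then (if d then [:: None] else [::])
  else if up (par u).1 (par u).2 == d then [:: Some (par u)] else [::].
Definition rin (u : U) : seq redge_t :=
  parents true u ++ [seq Some (u, b) | b <- slots u & ~~ up u b].
Definition rout (u : U) : seq redge_t :=
  parents false u ++ [seq Some (u, b) | b <- slots u & up u b].

(** For a doubled child the slot stored in [par] is arbitrary, so [ok_child] only asks that both
    slots of the parent lead to it. The parent itself is then not doubled, because a doubled vertex
    has a single slot. *)
Record ztree_ok : Prop := ZTreeOk {
  ok_child : forall (u : U) b (v : U), rvalid (Some (u, b)) -> child u b = Some v ->
    [/\ v != root, (par v).1 = u &
        if dbl v then ~~ dbl u /\ child u (~~ b) = Some v else (par v).2 = b];
  ok_par : forall v : U, v != root ->
    rvalid (Some (par v)) /\ child (par v).1 (par v).2 = Some v;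
  ok_root : ~~ dbl (@root T);
  ok_lev : forall v : U, v != root -> (lev (par v).1 < lev v)%N;
  ok_wt : forall r, rvalid r -> (0 < rwt r)%N;
  ok_bal : forall u : U, (\sum_(r <- rin u) rwt r = \sum_(r <- rout u) rwt r)%N }.

Hypothesis ok : ztree_ok.

Lemma child_neq u b v : rvalid (Some (u, b)) -> child u b = Some v -> u != v.
Proof.
move=> va ch; have [nr <- _] := ok_child ok va ch.
by apply/eqP => e; have := ok_lev ok nr; rewrite e ltnn.
Qed.

Lemma dbl_root u : dbl u -> u != root.
Proof. by move=> d; apply: contraTneq d => ->; exact: ok_root. Qed.

Lemma dbl_par u b : dbl u -> rvalid (Some ((par u).1, b)) /\ child (par u).1 b = Some u.
Proof.
move=> d; have [va ch] := ok_par ok (dbl_root d); rewrite (surjective_pairing (par u)) in va.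
have [_ _] := ok_child ok va ch; rewrite d => -[nd ch'].
rewrite /= (negbTE nd) /=; split=> //.
by case: (par u) b ch ch' => p [] [].
Qed.

Lemma mem_slots u b : (b \in slots u) = rvalid (Some (u, b)).
Proof. by rewrite /slots /=; case: dbl b => -[]. Qed.

(** Any slot leading to an ordinary vertex is the one stored in [par], by [ok_child]; for a doubled
    vertex both slots of the parent qualify. *)
Lemma mem_parents d u r :
  (r \in parents d u) =
  (rvalid r && (if r is Some (v, b) then (child v b == Some u) && (up v b == d)
                else (u == root) && d)).
Proof.
rewrite /parents; case: ifP => du.
  have nr := dbl_root du.
  case: r => [[v b]|]; last by rewrite (negbTE nr) /=; apply/mapP => -[].
  apply/mapP/idP => [[b']|].
    rewrite mem_filter => /andP[ud _] [-> ->].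
    by have [-> ->] := dbl_par b' du; rewrite eqxx ud.
  case/and3P=> va /eqP ch ud; exists b; last by have [_ <-] := ok_child ok va ch.
  by have [_ -> _] := ok_child ok va ch; rewrite mem_filter ud; case: b {va ch ud}.
case: eqP => [->|/eqP nr].
  case: r => [[v b]|]; last by case: d; rewrite ?inE.
  apply/idP/idP; first by case: d.
  by case/and3P=> va /eqP ch; have [] := ok_child ok va ch; rewrite eqxx.
have [va ch] := ok_par ok nr.
have h v b : rvalid (Some (v, b)) -> child v b = Some u -> par u = (v, b).
  by move=> va' ch'; have [_ <-] := ok_child ok va' ch'; rewrite du => <-; case: (par u).
case: r => [[v b]|]; last by rewrite ?andbF; case: ifP.
apply/idP/idP => [|/and3P[va' /eqP ch' /eqP ud]].
  case: ifP => // ud; rewrite inE => /eqP[e].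
  by move: va ch ud; rewrite -e /= => -> -> ->; rewrite eqxx.
by rewrite (h v b va' ch') /= ud eqxx inE.
Qed.

Lemma mem_rin u r : rvalid r -> (rtgt r == inl u) = (r \in rin u).
Proof.
move=> va; rewrite mem_cat mem_parents va.
have -> : (r \in [seq Some (u, b) | b <- slots u & ~~ up u b]) =
   (if r is Some (v, b) then (v == u) && ~~ up v b else false).
  case: r va => [[v b]|] va; last by apply/mapP => -[].
  apply/mapP/andP => [[b']|[/eqP e nu]].
    by rewrite mem_filter => /andP[nu _] [-> ->]; rewrite eqxx.
  by subst v; exists b; rewrite // mem_filter nu mem_slots.
case: r va => [[v b]|] va /=; last by rewrite andbT orbF (inj_eq (@inl_inj _ _)) eq_sym.
case: ifP => _; rewrite ?andbF ?andbT ?orbF //=.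
by rewrite /far; case: (child v b).
Qed.

Lemma mem_rout u r : rvalid r -> (rsrc r == inl u) = (r \in rout u).
Proof.
move=> va; rewrite mem_cat mem_parents va.
have -> : (r \in [seq Some (u, b) | b <- slots u & up u b]) =
   (if r is Some (v, b) then (v == u) && up v b else false).
  case: r va => [[v b]|] va; last by apply/mapP => -[].
  apply/mapP/andP => [[b']|[/eqP e nu]].
    by rewrite mem_filter => /andP[nu _] [-> ->]; rewrite eqxx.
  by subst v; exists b; rewrite // mem_filter nu mem_slots.
case: r va => [[v b]|] va /=; last by rewrite andbF.
case: ifP => _; rewrite ?andbF ?andbT ?orbF //=.
by rewrite /far; case: (child v b).
Qed.

Lemma rin_valid u r : r \in rin u -> rvalid r.
Proof.
rewrite mem_cat mem_parents => /orP[/andP[]//|/mapP[b]].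
by rewrite mem_filter mem_slots => /andP[_ va] ->.
Qed.

Lemma rout_valid u r : r \in rout u -> rvalid r.
Proof.
rewrite mem_cat mem_parents => /orP[/andP[]//|/mapP[b]].
by rewrite mem_filter mem_slots => /andP[_ va] ->.
Qed.

Lemma parents_uniq d u : uniq (parents d u).
Proof.
rewrite /parents; case: ifP => _; last by case: ifP => _; case: ifP.
by rewrite map_inj_uniq ?filter_uniq // => a b [].
Qed.

Lemma slots_uniq u (P : pred bool) :
  uniq [seq Some (u, b) | b <- slots u & P b].
Proof.
rewrite map_inj_uniq ?filter_uniq // => [|a b []//].
by rewrite /slots; case: ifP.
Qed.

Lemma parents_slots d u (P : pred bool) :
  ~~ has (mem (parents d u)) [seq Some (u, b) | b <- slots u & P b].
Proof.
apply/hasPn => _ /mapP[b _ ->] /=; apply/negP; rewrite mem_parents => /and3P[va /eqP ch _].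
by have := child_neq va ch; rewrite eqxx.
Qed.

Lemma rin_uniq u : uniq (rin u).
Proof. by rewrite cat_uniq parents_uniq parents_slots slots_uniq. Qed.

Lemma rout_uniq u : uniq (rout u).
Proof. by rewrite cat_uniq parents_uniq parents_slots slots_uniq. Qed.

(** Trivalence: a doubled vertex has two edges to its parent and one slot, the root has the end
    [None] and two slots, and any other vertex has one edge to its parent and two slots. *)
Lemma size_rin_rout u : (size (rin u) + size (rout u) = 3)%N.
Proof.
rewrite /rin /rout !size_cat !size_map addnACA /parents /slots.
case: ifP => du; rewrite ?size_map !size_filter.
  by rewrite /=; case: (up u false); case: (up _ false); case: (up _ true).
case: ifP => _; first by rewrite /=; case: (up u false); case: (up _ true).
by rewrite /=; case: (up u false); case: (up u true); case: (up _ _).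
Qed.

End RawTree.

(** * The metric graph and the map attached to a tree with positions *)

Section TreeGraph.
Variables (R : realType) (T : ztree).
Notation U := (node T).
Notation redge_t := (option (U * bool)).
Implicit Types (u : U) (r : redge_t).
Variables (pos : U -> nat) (w : nat -> R).

Definition tvset : {set U + redge_t} :=
  [set x | if x is inr r then rvalid r && rend r else true]%SET.
Definition teset : {set redge_t} := [set r | rvalid r]%SET.

Lemma root_tvset : inl root \in tvset. Proof. by rewrite inE. Qed.
Lemma none_teset : None \in teset. Proof. by rewrite inE. Qed.

(** Graphs must have ordinals as vertices and edges, so everything is transported along enumeration
    ranks. Outside [tvset] and [teset] these ranks are junk, whence the validity side conditions
    below. *)
Definition vr (x : U + redge_t) : 'I_#|tvset| := enum_rank_in root_tvset x.
Definition er (r : redge_t) : 'I_#|teset| := enum_rank_in none_teset r.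

Definition tphi (x : U + redge_t) : \bar R :=
  match x with
  | inl u => (w (pos u))%:E
  | inr r => if rup r then +oo%E else -oo%E
  end.

Definition tree_graph : metric_graph R :=
  MetricGraph (fun e => vr (rsrc (enum_val e))) (fun e => vr (rtgt (enum_val e)))
    (fun e : 'I_#|teset| => let r := enum_val e in
      if rend r then +oo%E
      else ((fine (tphi (rtgt r)) - fine (tphi (rsrc r))) / (rwt r)%:R)%:E).

Definition tree_cover : graph_map R :=
  @GraphMap R tree_graph (fun v => tphi (enum_val v)) (fun e => rwt (enum_val e)).

Local Notation C := tree_cover.
Implicit Types (e : 'I_(ne C)) (v : 'I_(nv C)).

Hypothesis ok : ztree_ok T.

Lemma vrK x : x \in tvset -> enum_val (vr x) = x.
Proof. exact: enum_rankK_in. Qed.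

Lemma erK r : rvalid r -> enum_val (er r) = r.
Proof. by move=> va; apply: enum_rankK_in; rewrite inE. Qed.

Lemma vr_val v : vr (enum_val v) = v.
Proof. exact: enum_valK_in. Qed.

Lemma er_val e : er (enum_val e) = e.
Proof. exact: enum_valK_in. Qed.

Lemma vr_inl_eq u u' : (vr (inl u) == vr (inl u')) = (u == u').
Proof.
apply/eqP/eqP => [e|-> //]; apply: (@inl_inj _ redge_t).
by rewrite -(vrK (_ : inl u \in tvset)) ?inE // e vrK ?inE.
Qed.

Lemma vr_eq x y : x \in tvset -> y \in tvset -> (vr x == vr y) = (x == y).
Proof.
by move=> hx hy; apply/eqP/eqP => [e|-> //]; rewrite -(vrK hx) e vrK.
Qed.

Lemma er_eq r r' : rvalid r -> rvalid r' -> (er r == er r') = (r == r').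
Proof.
by move=> hx hy; apply/eqP/eqP => [e|-> //]; rewrite -(erK hx) e erK.
Qed.

Variant vertex_spec : 'I_(nv C) -> Type :=
| VertexNode u : vertex_spec (vr (inl u))
| VertexLeaf r of rvalid r & rend r : vertex_spec (vr (inr r)).

Lemma vertexP v : vertex_spec v.
Proof.
rewrite -(vr_val v); have := enum_valP v.
by case: (enum_val v) => [u _|r]; [left | rewrite inE => /andP[]; right].
Qed.

Variant edge_spec : 'I_(ne C) -> Type :=
| EdgeSpec r of rvalid r : edge_spec (er r).

Lemma edgeP e : edge_spec e.
Proof. by rewrite -(er_val e); constructor; have := enum_valP e; rewrite inE. Qed.

Lemma far_tvset u b : rvalid (Some (u, b)) -> far u b \in tvset.
Proof.
move=> va; rewrite inE /far; case E: (child u b) => [//|].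
by rewrite va /= E.
Qed.

Lemma rsrc_tvset r : rvalid r -> rsrc r \in tvset.
Proof.
case: r => [[u b]|] va /=; last by rewrite inE.
by case: ifP => _; [rewrite inE | apply: far_tvset].
Qed.

Lemma rtgt_tvset r : rvalid r -> rtgt r \in tvset.
Proof.
case: r => [[u b]|] va /=; last by rewrite inE.
by case: ifP => _; [apply: far_tvset | rewrite inE].
Qed.

Lemma src_er r : rvalid r -> @src _ C (er r) = vr (rsrc r).
Proof. by move=> va; rewrite /= erK. Qed.

Lemma tgt_er r : rvalid r -> @tgt _ C (er r) = vr (rtgt r).
Proof. by move=> va; rewrite /= erK. Qed.

Lemma wt_er r : rvalid r -> @wt _ C (er r) = rwt r.
Proof. by move=> va; rewrite /= erK. Qed.

Lemma phi_vr x : x \in tvset -> @phi _ C (vr x) = tphi x.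
Proof. by move=> va; rewrite /= vrK. Qed.

Lemma phi_node u : @phi _ C (vr (inl u)) = (w (pos u))%:E.
Proof. by rewrite phi_vr // inE. Qed.

Lemma mem_inE r u : rvalid r -> (er r \in @inE_ _ C (vr (inl u))) = (r \in rin u).
Proof.
move=> va; rewrite -(mem_rin ok) // inE tgt_er // vr_eq ?rtgt_tvset //.
by rewrite inE.
Qed.

Lemma mem_outE r u : rvalid r -> (er r \in @outE_ _ C (vr (inl u))) = (r \in rout u).
Proof.
move=> va; rewrite -(mem_rout ok) // inE src_er // vr_eq ?rsrc_tvset //.
by rewrite inE.
Qed.

Lemma inE_node u : @inE_ _ C (vr (inl u)) = [set x in [seq er r | r <- rin u]]%SET.
Proof.
apply/setP => e; case: (edgeP e) => r va; rewrite mem_inE // inE; apply/idP/mapP => [h|[r' h /eqP]].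
  by exists r.
by rewrite er_eq ?(rin_valid ok h) // => /eqP ->.
Qed.

Lemma outE_node u : @outE_ _ C (vr (inl u)) = [set x in [seq er r | r <- rout u]]%SET.
Proof.
apply/setP => e; case: (edgeP e) => r va; rewrite mem_outE // inE; apply/idP/mapP => [h|[r' h /eqP]].
  by exists r.
by rewrite er_eq ?(rout_valid ok h) // => /eqP ->.
Qed.

Lemma uniq_er (s : seq redge_t) : all (@rvalid T) s -> uniq s -> uniq [seq er r | r <- s].
Proof.
move=> /allP va us; rewrite map_inj_in_uniq // => r r' /va h /va h' /eqP.
by rewrite er_eq // => /eqP.
Qed.

Lemma rin_all u : all (@rvalid T) (rin u). Proof. by apply/allP => r; apply: rin_valid. Qed.
Lemma rout_all u : all (@rvalid T) (rout u). Proof. by apply/allP => r; apply: rout_valid. Qed.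

Lemma card_inE u : #|@inE_ _ C (vr (inl u))| = size (rin u).
Proof.
rewrite inE_node cardsE (card_uniqP _) ?size_map //.
by rewrite uniq_er ?rin_all ?rin_uniq.
Qed.

Lemma card_outE u : #|@outE_ _ C (vr (inl u))| = size (rout u).
Proof.
rewrite outE_node cardsE (card_uniqP _) ?size_map //.
by rewrite uniq_er ?rout_all ?rout_uniq.
Qed.

Lemma sum_er (s : seq redge_t) : all (@rvalid T) s -> uniq s ->
  (\sum_(e in [set x in [seq er r | r <- s]]%SET) @wt _ C e = \sum_(r <- s) rwt r)%N.
Proof.
move=> va us; rewrite (eq_bigl (mem [seq er r | r <- s])); last by move=> e; rewrite inE.
rewrite -big_uniq ?uniq_er // big_map big_seq [RHS]big_seq.
by apply: eq_bigr => r /(allP va) /wt_er.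
Qed.

Lemma balance_node u :
  (\sum_(e in @inE_ _ C (vr (inl u))) @wt _ C e =
   \sum_(e in @outE_ _ C (vr (inl u))) @wt _ C e)%N.
Proof.
by rewrite inE_node outE_node !sum_er ?rin_all ?rout_all ?rin_uniq ?rout_uniq ?(ok_bal ok).
Qed.

Lemma node_inner u : @inner_vertex _ C (vr (inl u)).
Proof. by rewrite /inner_vertex /valence card_inE card_outE size_rin_rout. Qed.

Lemma src_leaf r r' : rvalid r -> rvalid r' -> rend r' ->
  (@src _ C (er r) == vr (inr r')) = (r == r') && ~~ rup r'.
Proof.
move=> va va' en; rewrite src_er // vr_eq ?rsrc_tvset ?inE ?va' //.
case: r va => [[u b]|] va /=; last first.
  by rewrite (inj_eq (@inr_inj _ _)); case: r' va' en => [[]|] //.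
case: ifP => ub.
  apply/eqP/andP => [//|[/eqP <-]]; by rewrite /= ub.
rewrite /far; case E: (child u b) => [v|].
  by apply/eqP/andP => [//|[/eqP e _]]; move: en; rewrite -e /= E.
rewrite (inj_eq (@inr_inj _ _)); apply/eqP/andP => [<-|[/eqP //]].
by rewrite eqxx /= ub.
Qed.

Lemma tgt_leaf r r' : rvalid r -> rvalid r' -> rend r' ->
  (@tgt _ C (er r) == vr (inr r')) = (r == r') && rup r'.
Proof.
move=> va va' en; rewrite tgt_er // vr_eq ?rtgt_tvset ?inE ?va' //.
case: r va => [[u b]|] va /=; last first.
  by apply/eqP/andP => [//|[/eqP <-]].
case: ifP => ub; last first.
  apply/eqP/andP => [//|[/eqP <-]]; by rewrite /= ub.
rewrite /far; case E: (child u b) => [v|].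
  by apply/eqP/andP => [//|[/eqP e _]]; move: en; rewrite -e /= E.
rewrite (inj_eq (@inr_inj _ _)); apply/eqP/andP => [<-|[/eqP //]].
by rewrite eqxx /= ub.
Qed.

Lemma leaf_leaf r : rvalid r -> rend r -> @leaf _ C (vr (inr r)).
Proof.
move=> va en; rewrite /leaf /valence.
have -> : @inE_ _ C (vr (inr r)) = if rup r then [set er r]%SET else finset.set0.
  apply/setP => e; case: (edgeP e) => r' va'; rewrite inE tgt_leaf //.
  by case: (rup r); rewrite ?andbT ?andbF !inE // er_eq.
have -> : @outE_ _ C (vr (inr r)) = if rup r then finset.set0 else [set er r]%SET.
  apply/setP => e; case: (edgeP e) => r' va'; rewrite inE src_leaf //.
  by case: (rup r); rewrite ?andbT ?andbF !inE // er_eq.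
by case: (rup r); rewrite cards1 cards0.
Qed.

Lemma node_leafF u : @leaf _ C (vr (inl u)) = false.
Proof. by have := node_inner u; rewrite /inner_vertex /leaf => /eqP ->. Qed.

Lemma leaf_innerF r : rvalid r -> rend r -> @inner_vertex _ C (vr (inr r)) = false.
Proof. by move=> va en; have := leaf_leaf va en; rewrite /inner_vertex /leaf => /eqP ->. Qed.

Lemma is_end_er r : rvalid r -> @is_end _ C (er r) = rend r.
Proof.
move=> va; rewrite /is_end src_er // tgt_er //.
case: r va => [[u b]|] va /=; last by rewrite leaf_leaf.
by case: ifP => _; rewrite node_leafF ?orbF /far; case E: (child u b) => [v|];
  rewrite ?node_leafF // leaf_leaf //= E.
Qed.

End TreeGraph.

Section TrivialDistribution.
Variables (R : realType) (w : nat -> R).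
Hypothesis wmono : forall i j, (i < j)%N -> w i < w j.

Lemma w_inj : injective w.
Proof.
by move=> i j e; case: (ltngtP i j) => // /wmono; rewrite e ltxx.
Qed.

Lemma w_lt i j : (w i < w j) = (i < j)%N.
Proof.
by case: (ltngtP i j) => [/wmono//|/wmono/lt_gtF//|->]; rewrite ltxx.
Qed.

Lemma w_le i j : (w i <= w j) = (i <= j)%N.
Proof. by rewrite leNgt w_lt -leqNgt. Qed.

Lemma flatten_trivial_x s :
  flatten [seq [:: p.1; p.2] | p <- trivial_x s w] = [seq w i | i <- iota 0 s.*2].
Proof.
have H a : flatten [seq [:: w i.*2; w i.*2.+1] | i <- iota a s] =
    [seq w i | i <- iota a.*2 s.*2].
  by elim: s a => // s IH a; rewrite doubleS /= IH doubleS.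
by rewrite /trivial_x -map_comp -(H 0%N).
Qed.

Lemma dist_points_trivial s t :
  dist_points (trivial_x s w) (trivial_y s t w) = [seq w i | i <- iota 0 (s.*2 + t)].
Proof. by rewrite /dist_points flatten_trivial_x iotaD map_cat. Qed.

Lemma trivial_distribution s t :
  is_distribution s t (trivial_x s w) (trivial_y s t w).
Proof.
split; rewrite ?flatten_trivial_x.
- by rewrite size_map size_iota.
- by rewrite size_map size_iota.
- by rewrite (@homo_sorted _ _ w ltn) ?iota_ltn_sorted // => i j; apply: wmono.
- by rewrite map_inj_uniq ?iota_uniq //; apply: w_inj.
move=> _ _ /mapP[i + ->] /mapP[j + ->] /=; rewrite !mem_iota !w_le => hi hj.
lia.
Qed.

End TrivialDistribution.

(** * Trees with admissible positions are tropical covers *)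

Section TreeCover.
Variables (R : realType) (T : ztree).
Notation U := (node T).
Notation redge_t := (option (U * bool)).
Implicit Types (u v : U) (r : redge_t).
Variables (pos : U -> nat) (w : nat -> R).
Variables (g : nat) (la mu : seq nat) (s t : nat).

Record pos_ok : Prop := PosOk {
  pos_inj : injective pos;
  pos_lt : forall u, (pos u < s.*2 + t)%N;
  pos_card : #|U| = (s.*2 + t)%N;
  pos_mono : forall u b v, rvalid (Some (u, b)) -> child u b = Some v ->
    if up u b then (pos u < pos v)%N else (pos v < pos u)%N }.

Definition end_weights (d : bool) : seq nat :=
  [seq rwt r | r <- enum {: redge_t} & [&& rvalid r, rend r & rup r == d]].

Hypothesis wmono : forall i j, (i < j)%N -> w i < w j.
Hypothesis ok : ztree_ok T.
Hypothesis pok : pos_ok.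
Hypothesis la_ok : perm_eq (end_weights false) la.
Hypothesis mu_ok : perm_eq (end_weights true) mu.
Hypothesis genus_ok : (s.*2 + t + 2 = size la + size mu + 2 * g)%N.

Local Notation C := (tree_cover pos w).

Lemma pos_surj i : (i < s.*2 + t)%N -> exists u, pos u = i.
Proof.
move=> lt_i; pose f u : 'I_(s.*2 + t) := Ordinal (pos_lt pok u).
have inj_f : injective f by move=> u v /(congr1 val) /= /(pos_inj pok).
have := inj_card_onto inj_f; rewrite card_ord (pos_card pok) leqnn => /(_ isT).
by move=> /(_ (Ordinal lt_i)) /codomP[u] /(congr1 val) /= ->; exists u.
Qed.

Lemma phi_src_end r : rvalid r ->
  (@phi _ C (@src _ C (er r)) == -oo%E) = rend r && ~~ rup r.
Proof.
move=> va; rewrite src_er // phi_vr ?rsrc_tvset //.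
case: r va => [[u b]|] //= va; case: ifP => ub //=; first by rewrite andbF.
by rewrite /far; case: (child u b) => //=; rewrite ub.
Qed.

Lemma phi_tgt_end r : rvalid r ->
  (@phi _ C (@tgt _ C (er r)) == +oo%E) = rend r && rup r.
Proof.
move=> va; rewrite tgt_er // phi_vr ?rtgt_tvset //.
case: r va => [[u b]|] //= va; case: ifP => ub //=; last by rewrite andbF.
by rewrite /far; case: (child u b) => //=; rewrite ub.
Qed.

Lemma end_weights_perm (P : pred 'I_(ne C)) d :
  (forall r, rvalid r -> P (er r) = rend r && (rup r == d)) ->
  perm_eq [seq @wt _ C e | e <- enum 'I_(ne C) & P e] (end_weights d).
Proof.
move=> PE; rewrite /end_weights.
set s0 := [seq r <- enum {: redge_t} | [&& rvalid r, rend r & rup r == d]].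
have vs0 : all (@rvalid T) s0 by apply/allP => r; rewrite mem_filter => /andP[/and3P[]].
have -> : [seq rwt r | r <- s0] = [seq @wt _ C e | e <- [seq er r | r <- s0]].
  by rewrite -map_comp; apply/eq_in_map => r /(allP vs0) /= /erK ->.
apply: perm_map; apply: uniq_perm; first by rewrite filter_uniq ?enum_uniq.
  by rewrite uniq_er // filter_uniq ?enum_uniq.
move=> e; case: (edgeP e) => r va; rewrite mem_filter mem_enum andbT PE //.
apply/idP/mapP => [h|[r' r's /eqP]].
  by exists r; rewrite // mem_filter va h mem_enum.
have va' := allP vs0 _ r's; rewrite er_eq // => /eqP ->.
by move: r's; rewrite mem_filter => /andP[/andP[]].
Qed.

Lemma size_end_weights :
  (size (end_weights false) + size (end_weights true) =
   \sum_(r : redge_t | rvalid r && rend r) 1)%N.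
Proof.
rewrite !size_map !size_filter -!sum1_count !big_enum_cond /=.
rewrite addnC [RHS](bigID (@rup T)) /=; congr addn; apply: eq_bigl => r;
  by rewrite ?eqb_id ?eqbF_neg -andbA.
Qed.

(** With [n] inner vertices and [l] ends, counting half-edges gives [2 E = 3 n + l] and [V = n + l].
    Hence [2 (E + 1 - V) = n - l + 2], which is [2 g] by [genus_ok]. *)
Lemma tree_genus : genus C = g.
Proof.
have E2 : (#|teset T| * 2 = \sum_(v < nv C) valence v)%N.
  rewrite big_split /= muln2 -addnn; congr addn.
    transitivity (\sum_(e < ne C) 1)%N; first by rewrite sum1_card card_ord.
    rewrite (partition_big (@tgt _ C) xpredT) //=.
    by apply: eq_bigr => v _; rewrite -[RHS]sum1_card; apply: eq_bigl => e; rewrite [RHS]inE.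
  transitivity (\sum_(e < ne C) 1)%N; first by rewrite sum1_card card_ord.
  rewrite (partition_big (@src _ C) xpredT) //=.
  by apply: eq_bigr => v _; rewrite -[RHS]sum1_card; apply: eq_bigl => e; rewrite [RHS]inE.
have valE : (\sum_(v < nv C) @valence _ C v =
    \sum_(x in tvset T) if x is inl _ then 3 else 1)%N.
  transitivity (\sum_(v < #|tvset T|) if enum_val v is inl _ then 3 else 1)%N; last first.
    by rewrite -(big_enum_val (fun x : U + redge_t => if x is inl _ then 3 else 1))%N.
  apply: eq_bigr => v _.
  case: (vertexP v) => [u|r va en]; rewrite vrK ?inE ?va //.
    by have := node_inner pos w ok u => /eqP.
  by have := leaf_leaf pos w va en => /eqP.
have sumE (F : U + redge_t -> nat) : (\sum_(x in tvset T) F x =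
    \sum_u F (inl u) + \sum_(r | rvalid r && rend r) F (inr r))%N.
  rewrite big_sumType /=; congr addn; apply: eq_bigl => u; by rewrite inE.
have nvE : #|tvset T| = (\sum_(x in tvset T) 1)%N by rewrite sum1_card.
rewrite valE sumE -size_end_weights in E2; rewrite sumE -size_end_weights in nvE.
rewrite /genus -[nv C]/(#|tvset T|) -[ne C]/(#|teset T|).
move: E2 nvE; rewrite (perm_size la_ok) (perm_size mu_ok) !sum_nat_const (pos_card pok).
move: genus_ok; move: #|teset T| #|tvset T| => a b /=; lia.
Qed.

Lemma tree_connected : connected_graph C.
Proof.
split; first by rewrite /=; apply/card_gt0P; exists (inl root); rewrite inE.
set rel_C := fun _ _ => _.
have sym : symmetric rel_C.
  by move=> x y; apply: eq_existsb => e; rewrite /joins orbC.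
have csym := sym_connect_sym sym.
have edge r : rvalid r -> connect rel_C (vr (rsrc r)) (vr (rtgt r)).
  move=> va; apply/connect1/existsP; exists (er r).
  by rewrite /joins src_er // tgt_er // !eqxx.
have node_c u : connect rel_C (vr (inl root)) (vr (inl u)).
  have [k] := ubnP (lev u); elim: k u => // k IH u le_k.
  have [->|nr] := eqVneq u root; first exact: connect0.
  have [va ch] := ok_par ok nr.
  apply: (@connect_trans _ _ (vr (inl (par u).1))).
    by apply: IH; apply: leq_trans (ok_lev ok nr) _.
  have := edge _ va; case: (par u) va ch => p b /= va ch.
  by rewrite /far ch; case: ifP => _ //; rewrite csym.
have root_c (v : 'I_(nv C)) : connect rel_C (vr (inl root)) v.
  case: (vertexP v) => [u //|r va en].
  have := edge r va; case: r va en => [[u b]|] va en /=; last by rewrite csym.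
  move: en => /= /eqP ch; rewrite /far ch; case: ifP => _ h.
    exact: connect_trans (node_c u) h.
  by apply: connect_trans (node_c u) _; rewrite csym.
by move=> u v; apply: connect_trans (root_c v); rewrite csym.
Qed.

Lemma tree_wt_gt0 e : (0 < @wt _ C e)%N.
Proof. by case: (edgeP e) => r va; rewrite wt_er // (ok_wt ok). Qed.

Lemma tree_phi_incr e : (@phi _ C (src e) < @phi _ C (tgt e))%E.
Proof.
case: (edgeP e) => r va; rewrite src_er // tgt_er // !phi_vr ?rsrc_tvset ?rtgt_tvset //.
case: r va => [[u b]|] va /=; last by rewrite ltNyr.
have := @pos_mono pok u b; rewrite /far; case E: (child u b) => [v|] //= => [/(_ v va erefl)|_].
  by case: ifP => _; rewrite lte_fin => /wmono.
by case: ifP => ub /=; rewrite ub ?ltry ?ltNyr.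
Qed.

Lemma tree_len e : @len _ C e =
  if is_end e then +oo%E
  else ((fine (@phi _ C (tgt e)) - fine (@phi _ C (src e))) / (@wt _ C e)%:R)%:E.
Proof.
case: (edgeP e) => r va; rewrite is_end_er // src_er // tgt_er // !phi_vr ?rsrc_tvset ?rtgt_tvset // wt_er //.
by rewrite /= erK.
Qed.

Lemma tree_phi_fin e : ~~ is_end e ->
  exists a b, [/\ @phi _ C (src e) = a%:E, @phi _ C (tgt e) = b%:E & a < b].
Proof.
have := tree_phi_incr e.
case: (edgeP e) => r va; rewrite is_end_er // src_er // tgt_er // !phi_vr ?rsrc_tvset ?rtgt_tvset //.
case: r va => [[u b]|] va //=; rewrite /far; case: (child u b) => // v.
by case: ifP => _ /=; rewrite lte_fin => ? _; do 2 eexists; split.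
Qed.

Lemma tree_tropical_cover :
  tropical_cover g la mu s t (trivial_x s w) (trivial_y s t w) C.
Proof.
split.
- exact: trivial_distribution.
- split; first exact: tree_connected.
  + move=> v; case: (vertexP v) => [u|r va en]; first by rewrite node_inner ?orbT.
    by rewrite leaf_leaf.
  + by move=> e en; rewrite tree_len en.
  + move=> e en; rewrite tree_len (negbTE en) ltry andbT lte_fin.
    have [a [b [-> -> ab]]] := tree_phi_fin en; rewrite divr_gt0 ?subr_gt0 //=.
    by rewrite ltr0n; apply: tree_wt_gt0.
- exact: tree_genus.
- rewrite dist_points_trivial // -map_comp; apply: uniq_perm.
  + rewrite map_inj_in_uniq ?filter_uniq -?enumT ?enum_uniq // => v v'.
    rewrite !mem_filter => /andP[+ _] /andP[+ _].
    case: (vertexP v) => [u _|r va en]; last by rewrite leaf_innerF.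
    case: (vertexP v') => [u' _|r va en]; last by rewrite leaf_innerF.
    by rewrite !phi_node => -[/(w_inj wmono)/(pos_inj pok) ->].
  + by rewrite map_inj_uniq ?iota_uniq // => i j [/(w_inj wmono)].
  move=> z; apply/mapP/mapP => -[v]; rewrite ?mem_filter ?mem_iota.
    case: (vertexP v) => [u _ ->|r va en]; last by rewrite leaf_innerF.
    by exists (pos u); rewrite ?phi_node ?mem_iota ?add0n ?(pos_lt pok).
  rewrite add0n => /andP[_ /pos_surj[u <-]] ->.
  by exists (vr (inl u)); rewrite ?phi_node // mem_filter node_inner // mem_enum.
- move=> v; case: (vertexP v) => [u|r va en]; first by rewrite node_leafF.
  by rewrite phi_vr ?inE ?va //=; case: ifP => _; [right|left].
- exact: tree_wt_gt0.
- exact: tree_phi_incr.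
- move=> e ne; rewrite tree_len (negbTE ne).
  have [a [b [-> -> ab]]] := tree_phi_fin ne; rewrite -EFinM -EFinD /=; congr (_%:E).
  have : (@wt _ C e)%:R != 0 :> R.
    by rewrite pnatr_eq0 -lt0n; apply: tree_wt_gt0.
  by move=> ?; field.
- move=> v; case: (vertexP v) => [u _|r va en]; last by rewrite leaf_innerF.
  exact: balance_node.
- apply: perm_trans la_ok; apply: end_weights_perm => r va.
  by rewrite phi_src_end // eqbF_neg.
- apply: perm_trans mu_ok; apply: end_weights_perm => r va.
  by rewrite phi_tgt_end // eqb_id.
Qed.

End TreeCover.

(** * Zigzag structure of tree covers *)

Section TreeZigzag.
Variables (R : realType) (T : ztree).
Notation U := (node T).
Notation redge_t := (option (U * bool)).
Implicit Types (u v : U) (r : redge_t).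
(* [sV] selects the inner vertices of the zigzag subgraph. *)
Variables (pos : U -> nat) (w : nat -> R) (s t : nat) (sV : U -> bool).

(** An end belongs to the zigzag subgraph only if it is odd, since an even end attached to the
    subgraph has to be a tail. The end at the root is kept because its weight is odd. *)
Definition sE r : bool :=
  if r is Some (u, b) then
    sV u && (if child u b is Some v then sV v else odd (swt u b))
  else true.

Definition rcontr r : bool :=
  if r is Some (u, b) then
    if child u b is Some v then
      let lo := if up u b then u else v in
      let hi := if up u b then v else u in
      [&& ~~ odd (pos lo), pos hi == (pos lo).+1 & (pos lo < s.*2)%N]
    else false
  else false.

(** Parity is imposed on cycles only: a single end of weight [2 k], or a fork behind an edge of
    weight [2 k], is an admissible tail for every [k], whereas chains of cycles must have odd
    weight. *)
Inductive tail_shape (k : nat) : U -> bool -> Prop :=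
| TailEnd u b : child u b = None -> swt u b = k.*2 -> tail_shape k u b
| TailFork u b v : child u b = Some v -> swt u b = k.*2 -> ~~ dbl v ->
    (forall b', child v b' = None /\ swt v b' = k) -> tail_shape k u b
| TailCycle u b v v' : odd k -> child u b = Some v -> swt u b = k.*2 -> ~~ dbl v ->
    (forall b', child v b' = Some v' /\ swt v b' = k) -> dbl v' ->
    tail_shape k v' false -> tail_shape k u b.

(** The trees built here use the forms (A) and (A') with a fork of ends, and form (B). *)
Inductive pair_form u v : Prop :=
| PairA f : rin u = [:: Some (u, false); Some (u, true)] ->
    (forall b, child u b = None) -> swt u false = swt u true ->
    rout u = [:: f] -> rtgt f = inl v -> size (rin v) = 2%N -> pair_form u v
| PairA' f : size (rin u) = 1%N -> rsrc f = inl u -> rin v = [:: f] ->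
    rout v = [:: Some (v, false); Some (v, true)] ->
    (forall b, child v b = None) -> swt v false = swt v true -> pair_form u v
| PairB f : size (rin u) = 1%N -> f \in rout u -> f \in rin v ->
    (forall f', f' \in rout u -> f' \in rin v -> f' = f) ->
    size (rin v) = 2%N -> pair_form u v.

(** The zigzag and properly mixed conditions, read off at the slots of the tree. The root plays
    [v_1'], and by [zo_part] the slot [(v1, false)], which becomes [E_c], is the only one joining a
    low vertex to a high one. *)
Record zigzag_ok (v1 v2 : U) : Prop := ZigzagOk {
  zo_root : sV root;
  zo_par : forall v, sV v -> v != root -> sV (par v).1;
  zo_dbl : forall v, sV v -> ~~ dbl v;
  zo_even : forall u b v, rvalid (Some (u, b)) -> child u b = Some v ->
    sV v -> ~~ odd (swt u b) -> rcontr (Some (u, b));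
  zo_low : forall u, (pos u < s.*2)%N -> sV u;
  zo_pair : forall u v i, (i < s)%N -> pos u = i.*2 -> pos v = i.*2.+1 -> pair_form u v;
  zo_fork : forall u, sV u -> (s.*2 <= pos u)%N -> child u false = None ->
    child u true = None -> swt u false <> swt u true;
  zo_tail : forall u b v, rvalid (Some (u, b)) -> sV u -> child u b = Some v -> ~~ sV v ->
    exists k, tail_shape k u b;
  zo_rootw : odd (rootw T);
  zo_posroot : pos root = 0%N;
  zo_v1 : child root false = Some v1;
  zo_posv1 : pos v1 = 1%N;
  zo_rin_root : rin (root : U) = [:: None];
  zo_rout_root : rout (root : U) = [:: Some (root, false); Some (root, true)];
  zo_rin_v1 : rin v1 = [:: Some (root : U, false); Some (v1, true)];
  zo_rout_v1 : rout v1 = [:: Some (v1, false)];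
  zo_v1_end : child v1 true = None;
  zo_v1_wt : swt v1 true = rootw T;
  zo_odd : [/\ odd (swt (root : U) true), ~~ odd (swt (root : U) false) & odd (swt v1 false)];
  zo_v2 : child v1 false = Some v2;
  zo_sv2 : sV v2;
  zo_posv2 : pos v2 = (s.*2 + t).-1;
  zo_highv2 : (s.*2 <= pos v2)%N;
  zo_rin_v2 : rin v2 = [:: Some (v1, false); Some (v2, false)];
  zo_v2_odd : odd (swt v2 false);
  zo_part : forall u b v, rvalid (Some (u, b)) -> child u b = Some v ->
    (u, b) <> (v1, false) -> (pos u < s.*2)%N = (pos v < s.*2)%N }.

Variables (v1 v2 : U).
Hypothesis wmono : forall i j, (i < j)%N -> w i < w j.
Hypothesis ok : ztree_ok T.
Hypothesis pok : @pos_ok T pos s t.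
Hypothesis s_gt0 : (0 < s)%N.
Hypothesis zo : zigzag_ok v1 v2.

Local Notation C := (tree_cover pos w).
Local Notation x := (trivial_x s w).
Local Notation V u := (vr (T := T) (inl u)).
Local Notation L r := (vr (T := T) (inr r)).

Definition zz_set : {set cell C} :=
  [set c : cell C | match c with
    | inl v => match enum_val v with inl u => sV u | inr r => sE r end
    | inr e => sE (enum_val e)
    end]%SET.

Lemma zz_node u : (inl (V u) \in zz_set) = sV u.
Proof. by rewrite inE vrK ?inE. Qed.

Lemma zz_leaf r : rvalid r -> rend r -> (inl (L r) \in zz_set) = sE r.
Proof. by move=> va en; rewrite inE vrK ?inE ?va. Qed.

Lemma zz_edge r : rvalid r -> (inr (er r) \in zz_set) = sE r.
Proof. by move=> va; rewrite inE erK. Qed.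

Lemma sE_child u b v : rvalid (Some (u, b)) -> child u b = Some v -> sE (Some (u, b)) = sV v.
Proof.
move=> va ch /=; rewrite ch; case sv: (sV v); rewrite ?andbF // andbT.
by have [nr <- _] := ok_child ok va ch; apply: (zo_par zo).
Qed.

Lemma incident_node r u : rvalid r -> @incident _ C (er r) (V u) =
  if r is Some (v, b) then (v == u) || (child v b == Some u) else u == root.
Proof.
move=> va; rewrite /incident src_er // tgt_er // !vr_eq ?rsrc_tvset ?rtgt_tvset ?inE //.
case: r va => [[v b]|] va /=; last by rewrite (inj_eq (@inl_inj _ _)) eq_sym.
by rewrite /far; case: (child v b) => [z|]; case: ifP => _; rewrite ?(inj_eq (@inl_inj _ _)) ?orbF //= orbC.
Qed.

Lemma incident_leaf r r' : rvalid r -> rvalid r' -> rend r' ->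
  @incident _ C (er r) (L r') = (r == r').
Proof.
move=> va va' en; have := src_leaf pos w va va' en; have := tgt_leaf pos w va va' en.
by rewrite /incident => -> ->; case: (r == r'); case: (rup r').
Qed.

Lemma joins_slot u b : rvalid (Some (u, b)) ->
  @joins _ C (er (Some (u, b))) (V u) (vr (far u b)).
Proof.
by move=> va; rewrite /joins src_er // tgt_er //=; case: ifP => _; rewrite !eqxx ?orbT.
Qed.

Lemma joins_incident (e : 'I_(ne C)) a b : joins e a b -> incident e a /\ incident e b.
Proof.
by rewrite /joins /incident => /orP[] /andP[-> ->]; rewrite ?orbT.
Qed.

Lemma contractible_er r : rvalid r -> @contractible _ x C (er r) = rcontr r.
Proof.
move=> va; rewrite /contractible src_er // tgt_er // !phi_vr ?rsrc_tvset ?rtgt_tvset //.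
have H a b : has (fun p => (((w a)%:E == p.1%:E) && ((w b)%:E == p.2%:E))%E) x =
    [&& ~~ odd a, b == a.+1 & (a < s.*2)%N].
  apply/hasP/and3P => [[_ /mapP[i + ->]]|[ea /eqP -> lt_a]].
    rewrite mem_iota /= => lt_i /andP[/eqP[/(w_inj wmono) ->] /eqP[/(w_inj wmono) ->]].
    by rewrite odd_double eqxx; split=> //; lia.
  exists (w a, w a.+1); last by rewrite !eqxx.
  apply/mapP; exists a./2; first by rewrite mem_iota; lia.
  by rewrite -[in LHS](odd_double_half a) (negbTE ea) add0n.
case: r va => [[u b]|] va /=; last first.
  by apply/hasP => -[p _] //=.
rewrite /far; case: (child u b) => [v|].
  by case: ifP => _ /=; rewrite H.
by apply/hasP => -[p _]; case: ifP => ub /=; rewrite ub => /andP[/eqP ? /eqP ?].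
Qed.

Lemma tree_resolving : @resolving _ x C.
Proof.
move=> _ /mapP[i + ->] a b /=; rewrite mem_iota => /andP[_ lt_i].
case: (vertexP a) => [u|r va en]; last by rewrite vrK ?inE ?va //=; case: ifP.
case: (vertexP b) => [v|r va en]; last by move=> _; rewrite vrK ?inE ?va //=; case: ifP.
rewrite !vrK ?inE //= => ea eb.
have pu := w_inj wmono (EFin_inj ea); have pv := w_inj wmono (EFin_inj eb).
have [f e1 e2 e3 e4 e5 e6|f e1 e2 e3 e4 e5 e6|f e1 e2 e3 e4 e5] :=
  zo_pair zo lt_i pu pv.
- have vau b' : rvalid (Some (u, b')) by apply: (rin_valid ok (u := u)); rewrite e1; case: b'; rewrite !inE eqxx ?orbT.
  have vf : rvalid f by apply: (rout_valid ok (u := u)); rewrite e4 inE.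
  apply: Or41; exists (er (Some (u, false))), (er (Some (u, true))), (er f); split.
  + split; first by rewrite inE_node // e1; apply/setP => e; rewrite !inE.
    apply/orP; right; apply/and5P; split.
    * by rewrite er_eq ?vau //; apply/eqP => -[].
    * by rewrite is_end_er ?vau //= e2.
    * by rewrite is_end_er ?vau //= e2.
    * by rewrite !wt_er ?vau //= e3.
    * by apply/existsP; exists (V u); rewrite node_inner // !incident_node ?vau //= !eqxx.
  + by rewrite outE_node // e4 tgt_er // e5; split=> //; apply/setP => e; rewrite !inE.
  + by rewrite card_inE.
  + by have := size_rin_rout v; rewrite card_outE // e6; lia.
- have vav b' : rvalid (Some (v, b')) by apply: (rout_valid ok (u := v)); rewrite e4; case: b'; rewrite !inE eqxx ?orbT.
  have vf : rvalid f by apply: (rin_valid ok (u := v)); rewrite e3 inE.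
  apply: Or42; exists (er (Some (v, false))), (er (Some (v, true))), (er f); split.
  + by rewrite card_inE.
  + by have := size_rin_rout u; rewrite card_outE // e1; lia.
  + by rewrite src_er // e2 inE_node // e3; split=> //; apply/setP => e; rewrite !inE.
  + split; first by rewrite outE_node // e4; apply/setP => e; rewrite !inE.
    apply/orP; right; apply/and5P; split.
    * by rewrite er_eq ?vav //; apply/eqP => -[].
    * by rewrite is_end_er ?vav //= e5.
    * by rewrite is_end_er ?vav //= e5.
    * by rewrite !wt_er ?vav //= e6.
    * by apply/existsP; exists (V v); rewrite node_inner // !incident_node ?vav //= !eqxx.
- apply: Or43; split.
  + by rewrite card_inE.
  + by have := size_rin_rout u; rewrite card_outE // e1; lia.
  + have vf : rvalid f by apply: rin_valid e3.
    have -> : @outE_ _ C (V u) :&: @inE_ _ C (V v) = [set er f]%SET; last by rewrite cards1.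
    apply/setP => e; case: (edgeP e) => r va; rewrite finset.in_set1 er_eq // finset.in_setI mem_outE // mem_inE //.
    by apply/andP/eqP => [[]|->]; first exact: e4.
  + by rewrite card_inE.
  + by have := size_rin_rout v; rewrite card_outE // e5; lia.
Qed.

Lemma zz_is_subgraph : is_subgraph zz_set.
Proof.
move=> e; case: (edgeP e) => r va; rewrite zz_edge // src_er // tgt_er //.
case: r va => [[u b]|] va; last by move=> _; rewrite zz_leaf // zz_node (zo_root zo).
have h : sE (Some (u, b)) -> inl (V u) \in zz_set /\ inl (vr (far u b)) \in zz_set.
  move=> se; rewrite zz_node; have /andP[su _] := se; split=> //.
  rewrite /far; case E: (child u b) => [v|]; first by rewrite zz_node -(sE_child va E).
  by rewrite zz_leaf //= E.
by rewrite /=; case: ifP => _ /h[].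
Qed.

Lemma adj_sym (c d : cell C) : cell_adj c d = cell_adj d c.
Proof. by case: c; case: d. Qed.

Lemma connect_in_sym (X : {set cell C}) c d : connect_in X c d = connect_in X d c.
Proof.
apply: sym_connect_sym => a b; rewrite adj_sym.
by case: (a \in X); case: (b \in X).
Qed.

Lemma connect_in_step (X : {set cell C}) c d :
  c \in X -> d \in X -> cell_adj c d -> connect_in X c d.
Proof. by move=> hc hd h; apply: connect1; rewrite hc hd h. Qed.

Lemma connect_in_trans (X : {set cell C}) c d e :
  connect_in X c d -> connect_in X d e -> connect_in X c e.
Proof. exact: connect_trans. Qed.

Lemma connect_in_sub (X Y : {set cell C}) c d :
  X \subset Y -> connect_in X c d -> connect_in Y c d.
Proof.
move=> /fintype.subsetP sXY; apply: connect_sub => a b /and3P[/sXY ha /sXY hb adj].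
by apply: connect1; rewrite ha hb adj.
Qed.

Lemma zz_connected_root c : c \in zz_set -> connect_in zz_set (inl (V root)) c.
Proof.
have rt : inl (V root) \in zz_set by rewrite zz_node (zo_root zo).
have node_c u : sV u -> connect_in zz_set (inl (V root)) (inl (V u)).
  have [k] := ubnP (lev u); elim: k u => // k IH u le_k su.
  have [->|nr] := eqVneq u root; first exact: connect0.
  have [va ch] := ok_par ok nr; have sp := zo_par zo su nr.
  apply: connect_in_trans (IH _ (leq_trans (ok_lev ok nr) le_k) sp) _.
  have se : inr (er (Some (par u))) \in zz_set.
    by rewrite zz_edge //; move: va ch; case: (par u) => p b va ch; rewrite (sE_child va ch).
  have inc1 : @incident _ C (er (Some (par u))) (V (par u).1).
    by rewrite incident_node //; case: (par u) => p b; rewrite eqxx.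
  have inc2 : @incident _ C (er (Some (par u))) (V u).
    by rewrite incident_node //; move: ch; case: (par u) => p b /= ->; rewrite eqxx orbT.
  apply: (@connect_in_trans _ _ (inr (er (Some (par u))))).
    by apply: connect_in_step; rewrite ?zz_node.
  by apply: connect_in_step; rewrite ?zz_node.
have edge_c r : rvalid r -> sE r -> connect_in zz_set (inl (V root)) (inr (er r)).
  move=> va se; case: r va se => [[u b]|] va se.
    have /andP[su _] := se; apply: connect_in_trans (node_c u su) _.
    by apply: connect_in_step; rewrite ?zz_node ?zz_edge //= incident_node //= eqxx.
  by apply: connect_in_step; rewrite ?zz_edge //= incident_node //= eqxx.
case: c => [v|e].
  case: (vertexP v) => [u|r va en]; first by rewrite zz_node; apply: node_c.
  rewrite zz_leaf // => se; apply: connect_in_trans (edge_c r va se) _.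
  by apply: connect_in_step; rewrite ?zz_leaf ?zz_edge //= incident_leaf.
by case: (edgeP e) => r va; rewrite zz_edge //; apply: edge_c.
Qed.

Lemma rcontr_ends r a b : rvalid r -> rsrc r = inl a -> rtgt r = inl b ->
  rcontr r = [&& ~~ odd (pos a), pos b == (pos a).+1 & (pos a < s.*2)%N].
Proof.
case: r => [[u c]|] //= va; rewrite /far; case: (child u c) => [v|].
  by case: ifP => _ [<-] [<-].
by case: ifP.
Qed.

Lemma pair_edge a b i : (i < s)%N -> pos a = i.*2 -> pos b = i.*2.+1 ->
  exists2 r, rvalid r & [/\ rcontr r, rsrc r = inl a & rtgt r = inl b].
Proof.
move=> lt_i pa pb.
suff [r va [ra rb]] : exists2 r, rvalid r & rsrc r = inl a /\ rtgt r = inl b.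
  exists r => //; split=> //; rewrite (rcontr_ends va ra rb) pa pb odd_double eqxx /=.
  by rewrite ltn_double.
have [f e1 e2 e3 e4 e5 e6|f e1 e2 e3 e4 e5 e6|f e1 e2 e3 e4 e5] := zo_pair zo lt_i pa pb.
- have fo : f \in rout a by rewrite e4 inE.
  have va := rout_valid ok fo; exists f => //; split=> //.
  by apply/eqP; rewrite (mem_rout ok).
- have fo : f \in rin b by rewrite e3 inE.
  have va := rin_valid ok fo; exists f => //; split=> //.
  by apply/eqP; rewrite (mem_rin ok).
- have va := rin_valid ok e3; exists f => //.
  by split; apply/eqP; rewrite ?(mem_rin ok) ?(mem_rout ok).
Qed.

(** Positions below [s.*2] come in pairs joined by a contractible edge. Consequently no fork at such
    a vertex can belong to the excluded symmetric pairs. *)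
Lemma low_touch u : (pos u < s.*2)%N ->
  exists2 r, rvalid r & rcontr r && @incident _ C (er r) (V u).
Proof.
move=> lt_u; have H := pos_surj pok.
have [lo|hi] := boolP (odd (pos u)).
  have [v pv] : exists v, pos v = (pos u).-1 by apply: H; lia.
  have [|||r va [rc _ rt]] := @pair_edge v u (pos u)./2; try lia.
  by exists r => //; rewrite rc /incident tgt_er // rt eqxx orbT.
have [v pv] : exists v, pos v = (pos u).+1 by apply: H; lia.
have [|||r va [rc rs _]] := @pair_edge u v (pos u)./2; try lia.
by exists r => //; rewrite rc /incident src_er // rs eqxx.
Qed.

(** A symmetric cycle with an edge in the subgraph would give two slots leading to one child, which
    would be doubled, contrary to [zo_dbl]. A fork at a low vertex touches a contractible edge, and
    at a high vertex [zo_fork] makes the weights of two ends differ. *)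
Lemma zz_no_Sym2 (e1 e2 : 'I_(ne C)) : in_Sym2 x e1 e2 -> inr e1 \notin zz_set.
Proof.
case: (edgeP e1) => r1 va1; case: (edgeP e2) => r2 va2.
move=> /and4P[sp _ _ touch]; rewrite zz_edge //; apply/negP => se.
case/orP: sp => /and5P[].
  rewrite er_eq // !is_end_er // => ne12 en1 en2 _.
  rewrite /joins !src_er // !tgt_er //.
  case: r1 va1 se ne12 en1 {touch} => [[u b]|] va1 //= /andP[su]; case E: (child u b) => [v|//] sv ne12 _.
  case: r2 va2 ne12 en2 => [[u' b']|] va2 //= ne12; case E': (child u' b') => [v'|//] _.
  have lt1 : (lev u < lev v)%N by have [nr <- _] := ok_child ok va1 E; apply: (ok_lev ok).
  have lt2 : (lev u' < lev v')%N by have [nr <- _] := ok_child ok va2 E'; apply: (ok_lev ok).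
  rewrite /far E E'.
  have h : (u' = u /\ v' = v) \/ (u' = v /\ v' = u) -> False.
    case=> -[? ?]; subst u' v'; last by lia.
    have [_ _] := ok_child ok va1 E; rewrite (negbTE (zo_dbl zo sv)) => pb.
    have [_ _] := ok_child ok va2 E'; rewrite (negbTE (zo_dbl zo sv)) => pb'.
    by move: ne12; rewrite -pb -pb' eqxx.
  case: ifP => _; case: ifP => _; rewrite !vr_inl_eq => /orP[] /andP[/eqP ? /eqP ?];
    apply: h; by [left | right].
move=> ne12; rewrite !is_end_er // !wt_er // => en1 en2 /eqP ww /existsP[z /and3P[]].
case: (vertexP z) => [u _|r va en]; last by rewrite leaf_innerF.
move=> i1 i2.
have [lt_u|ge_u] := ltnP (pos u) s.*2.
  have [r var /andP[rc ir]] := low_touch lt_u.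
  move/forallP: touch => /(_ (er r)); rewrite contractible_er // rc /= => /andP[/negP[]].
  by apply/existsP; exists (V u); rewrite ir i1.
have nr : u != root.
  by apply: contraTneq ge_u => ->; rewrite (zo_posroot zo) leqn0 double_eq0 -lt0n.
move: i1 i2; rewrite !incident_node //.
case: r1 va1 se ne12 en1 ww {touch} => [[u1 b1]|] va1 //= se ne12 /eqP en1 ww; last by rewrite (negbTE nr).
case: r2 va2 ne12 en2 ww => [[u2 b2]|] va2 //= ne12 /eqP en2 ww; last by rewrite (negbTE nr).
rewrite en1 en2 !orbF => /eqP eu1 /eqP eu2; subst u1 u2.
move: ne12; rewrite er_eq //; case/andP: se => su _.
have := zo_fork zo su ge_u.
case: b1 b2 {va1 va2} en1 en2 ww => [] [] en1 en2 ww; rewrite ?eqxx //.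
  by move=> /(_ en2 en1); rewrite ww.
by move=> /(_ en1 en2); rewrite ww.
Qed.

Lemma zz_contr (e : 'I_(ne C)) : contractible x e -> inr e \in zz_set.
Proof.
case: (edgeP e) => r va; rewrite contractible_er // zz_edge //.
case: r va => [[u b]|] //= va; case: (child u b) => [v|//].
by case: ifP => _ /and3P[? /eqP ? ?]; rewrite !(zo_low zo) //; lia.
Qed.

Lemma zz_even_contr (e : 'I_(ne C)) : inr e \in zz_set -> ~~ odd (@wt _ C e) ->
  contractible x e.
Proof.
case: (edgeP e) => r va; rewrite contractible_er // zz_edge // wt_er //.
case: r va => [[u b]|] va; last by rewrite /= (zo_rootw zo).
move=> /= /andP[su]; case E: (child u b) => [v|]; last by move=> ->.
by move=> sv ev; have := zo_even zo va E sv ev; rewrite /= E.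
Qed.

Definition shape_tail (k : nat) (a : 'I_(nv C)) (F : {set cell C}) : Prop :=
  if odd k then odd_tail k a F else end_tail k a F \/ fork_tail k a F.

Lemma slot_adj u b v (z : 'I_(nv C)) : rvalid (Some (u, b)) -> child u b = Some v ->
  @incident _ C (er (Some (u, b))) z -> z = V u \/ z = V v.
Proof.
move=> va ch; case: (vertexP z) => [u'|r var enr].
  by rewrite incident_node //= ch => /orP[/eqP ->|/eqP[->]]; [left | right].
by rewrite incident_leaf // => /eqP e; move: enr; rewrite -e /= ch.
Qed.

Lemma end_adj u b (z : 'I_(nv C)) : rvalid (Some (u, b)) -> child u b = None ->
  @incident _ C (er (Some (u, b))) z -> z = V u \/ z = L (Some (u, b)).
Proof.
move=> va ch; case: (vertexP z) => [u'|r var enr].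
  by rewrite incident_node //= ch orbF => /eqP ->; left.
by rewrite incident_leaf // => /eqP <-; right.
Qed.

Lemma leaf_adj r (e : 'I_(ne C)) : rvalid r -> rend r -> incident e (L r) -> e = er r.
Proof. by move=> va en; case: (edgeP e) => r' va'; rewrite incident_leaf // => /eqP ->. Qed.

Lemma node_adj v (e : 'I_(ne C)) : v != root -> @incident _ C e (V v) ->
  (exists2 b, rvalid (Some (v, b)) & e = er (Some (v, b))) \/
  if dbl v then exists b, e = er (Some ((par v).1, b)) else e = er (Some (par v)).
Proof.
move=> nr; case: (edgeP e) => r va; rewrite incident_node //.
case: r va => [[u b]|] va; last by move=> /eqP h; rewrite h eqxx in nr.
case/orP=> [/eqP h|/eqP ch]; first by left; exists b; rewrite -h.
right; have [_ <-] := ok_child ok va ch; case: (dbl v); first by exists b.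
by move=> <-; rewrite -surjective_pairing.
Qed.

(** The properties of [F] are exactly those that identify it with a component of the complement: it
    avoids the subgraph, it is connected, and it can be left only through the attaching vertex. *)
Lemma tail_shape_cells k u b : tail_shape k u b -> rvalid (Some (u, b)) -> ~~ sE (Some (u, b)) ->
  exists F : {set cell C},
   [/\ shape_tail k (V u) F, inr (er (Some (u, b))) \in F,
       forall c, c \in F -> c \notin zz_set,
       forall c d, c \in F -> cell_adj c d -> d \in F \/ d = inl (V u) &
       forall c, c \in F -> connect_in F (inr (er (Some (u, b)))) c].
Proof.
elim=> {u b} [u b ch wub va nse|u b v ch wub ndv chv va nse|u b v v' ok_k ch wub ndv chv dv' ts IH va nse].
- have en : rend (Some (u, b)) by rewrite /= ch.
  have fE : far u b = inr (Some (u, b)) by rewrite /far ch.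
  have jo := joins_slot va; rewrite fE in jo.
  pose F : {set cell C} := [set inr (er (Some (u, b))); inl (L (Some (u, b)))]%SET.
  have et : @end_tail R C k (V u) F.
    exists (er (Some (u, b))), (L (Some (u, b))); split=> //; first by rewrite leaf_leaf.
    by rewrite wt_er.
  exists F; split.
  + by rewrite /shape_tail; case: ifP => _; [apply: odd_tail_end | left].
  + by rewrite !inE eqxx.
  + move=> c; rewrite finset.in_set2 => /orP[] /eqP ->; by rewrite ?zz_edge ?zz_leaf.
  + move=> c [z|e]; rewrite finset.in_set2 => /orP[] /eqP -> //=.
      case: (vertexP z) => [u'|r var enr].
        rewrite incident_node //= ch orbF => /eqP ->; by right.
      by rewrite incident_leaf // => /eqP <-; left; rewrite !inE eqxx orbT.
    case: (edgeP e) => r var; rewrite incident_leaf // => /eqP ->.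
    by left; rewrite !inE eqxx.
  + move=> c; rewrite finset.in_set2 => /orP[] /eqP ->; first exact: connect0.
    by apply: connect_in_step; rewrite ?inE ?eqxx ?orbT //= incident_leaf.
- have [nr pu] := ok_child ok va ch; rewrite (negbTE ndv) => pb.
  have pv : par v = (u, b) by rewrite -pu -pb -surjective_pairing.
  have vav b' : rvalid (Some (v, b')) by rewrite /= (negbTE ndv).
  have env b' : rend (Some (v, b')) by have [h _] := chv b'; rewrite /= h.
  have nsv : ~~ sV v by rewrite -(sE_child va ch).
  have nsE b' : ~~ sE (Some (v, b')) by rewrite /= (negbTE nsv).
  have jo := joins_slot va; rewrite /far ch in jo.
  have jov b' : @joins _ C (er (Some (v, b'))) (V v) (L (Some (v, b'))).
    by have := joins_slot (vav b'); have [h _] := chv b'; rewrite /far h.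
  have incv b' : @incident _ C (er (Some (v, b'))) (V v).
    by have [] := joins_incident (jov b').
  have incl b' : @incident _ C (er (Some (v, b'))) (L (Some (v, b'))).
    by have [] := joins_incident (jov b').
  have inca : @incident _ C (er (Some (u, b))) (V v) by have [] := joins_incident jo.
  pose F : {set cell C} := [set inr (er (Some (u, b))); inl (V v);
    inr (er (Some (v, false))); inl (L (Some (v, false)));
    inr (er (Some (v, true))); inl (L (Some (v, true)))]%SET.
  have Fa : inr (er (Some (u, b))) \in F by rewrite !inE eqxx.
  have Fv : inl (V v) \in F by rewrite !inE eqxx ?orbT.
  have Fe b' : inr (er (Some (v, b'))) \in F by rewrite !inE; case: b'; rewrite eqxx ?orbT.
  have Fl b' : inl (L (Some (v, b'))) \in F by rewrite !inE; case: b'; rewrite eqxx ?orbT.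
  have Fcase (P : cell C -> Prop) : P (inr (er (Some (u, b)))) -> P (inl (V v)) ->
      (forall b', P (inr (er (Some (v, b'))))) -> (forall b', P (inl (L (Some (v, b'))))) ->
      forall c, c \in F -> P c.
    by move=> p1 p2 p3 p4 c; rewrite !inE => /orP[/orP[/orP[/orP[/orP[]|]|]|]|] /eqP ->.
  have ft : @fork_tail R C k (V u) F.
    exists (er (Some (u, b))), (er (Some (v, false))), (er (Some (v, true))),
      (V v), (L (Some (v, false))), (L (Some (v, true))); split=> //.
    + by rewrite wt_er.
    + rewrite wt_er //; split; last by have [] := chv false.
      apply/and5P; split; rewrite ?is_end_er ?wt_er //.
      * by rewrite er_eq //; apply/eqP => -[].
      * by rewrite /rwt (chv false).2 (chv true).2.
      * by apply/existsP; exists (V v); rewrite node_inner // !incv.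
    + by rewrite leaf_leaf.
    + by rewrite leaf_leaf.
  exists F; split=> //.
  + by rewrite /shape_tail; case: ifP => _; [apply: odd_tail_fork | right].
  + by apply: Fcase => [||b'|b']; rewrite ?zz_edge ?zz_node ?zz_leaf.
  + move=> c d cF; move: c cF d; apply: Fcase => [||b'|b'] [z|e] //= inc.
    * by have [->|->] := slot_adj va ch inc; [right | left].
    * have [[b' _ ->]|] := node_adj nr inc; first by left.
      by rewrite (negbTE ndv) pv => ->; left.
    * by have [h _] := chv b'; have [->|->] := end_adj (vav b') h inc; left.
    * by rewrite (leaf_adj (vav b') (env b') inc); left.
  + have c1 : connect_in F (inr (er (Some (u, b)))) (inl (V v)) by apply: connect_in_step.
    have c2 b' : connect_in F (inr (er (Some (u, b)))) (inr (er (Some (v, b')))).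
      exact: connect_in_trans c1 (connect_in_step Fv (Fe b') (incv b')).
    apply: Fcase => [||b'|b'] //; first exact: connect0.
    exact: connect_in_trans (c2 b') (connect_in_step (Fe b') (Fl b') (incl b')).
have [nr pu] := ok_child ok va ch; rewrite (negbTE ndv) => pb.
have pv : par v = (u, b) by rewrite -pu -pb -surjective_pairing.
have vav b' : rvalid (Some (v, b')) by rewrite /= (negbTE ndv).
have chb b' : child v b' = Some v' by have [] := chv b'.
have [nr' pv' _] := ok_child ok (vav false) (chb false).
have vav' : rvalid (Some (v', false)) by rewrite /= andbF.
have nsv : ~~ sV v by rewrite -(sE_child va ch).
have nsv' : ~~ sV v' by apply: contraL dv' => /(zo_dbl zo).
have nsE b' : ~~ sE (Some (v, b')) by rewrite /= (negbTE nsv).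
have nsE' : ~~ sE (Some (v', false)) by rewrite /= (negbTE nsv').
have [F' [F'sh F'in F'S F'cl F'co]] := IH vav' nsE'.
have jo := joins_slot va; rewrite /far ch in jo.
have jov b' : @joins _ C (er (Some (v, b'))) (V v) (V v').
  by have := joins_slot (vav b'); rewrite /far chb.
have incv b' : @incident _ C (er (Some (v, b'))) (V v).
  by have [] := joins_incident (jov b').
have incv' b' : @incident _ C (er (Some (v, b'))) (V v').
  by have [] := joins_incident (jov b').
have inca : @incident _ C (er (Some (u, b))) (V v) by have [] := joins_incident jo.
have inc' : @incident _ C (er (Some (v', false))) (V v').
  by have [] := joins_incident (joins_slot vav').
pose F : {set cell C} := [set inr (er (Some (u, b))); inl (V v);
    inr (er (Some (v, false))); inr (er (Some (v, true))); inl (V v')]%SET :|: F'.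
have Fa : inr (er (Some (u, b))) \in F by rewrite !inE eqxx.
have Fv : inl (V v) \in F by rewrite !inE eqxx ?orbT.
have Fv' : inl (V v') \in F by rewrite !inE eqxx ?orbT.
have Fe b' : inr (er (Some (v, b'))) \in F by rewrite !inE; case: b'; rewrite eqxx ?orbT.
have sF : F' \subset F by apply: finset.subsetUr.
have FF' c : c \in F' -> c \in F by move/fintype.subsetP: sF; apply.
have Fcase (P : cell C -> Prop) : P (inr (er (Some (u, b)))) -> P (inl (V v)) ->
    (forall b', P (inr (er (Some (v, b'))))) -> P (inl (V v')) -> (forall c, c \in F' -> P c) ->
    forall c, c \in F -> P c.
  move=> p1 p2 p3 p4 p5 c; rewrite finset.in_setU => /orP[|/p5//].
  by rewrite !inE => /orP[/orP[/orP[/orP[]|]|]|] /eqP ->.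
exists F; split=> //.
- move: F'sh; rewrite /shape_tail ok_k => F'sh.
  apply: (@odd_tail_cycle R C k (V u) (V v) (V v') (er (Some (u, b)))
    (er (Some (v, false))) (er (Some (v, true))) F') => //.
  + by rewrite wt_er.
  + have jo2 := joins_slot (vav true); rewrite /far chb in jo2.
    apply/and5P; split.
    * by rewrite er_eq //; apply/eqP => -[].
    * by rewrite is_end_er ?vav //= chb.
    * by rewrite is_end_er ?vav //= chb.
    * by rewrite !wt_er ?vav //= (chv false).2 (chv true).2.
    * rewrite src_er ?vav // tgt_er ?vav //= /far chb.
      by case: ifP => _; rewrite /joins // orbC.
  + by rewrite wt_er ?vav //= (chv false).2.
- apply: Fcase => [||b'||c] //; try by rewrite ?zz_edge ?zz_node.
  by move/F'S.
- move=> c d cF; move: c cF d; apply: Fcase => [||b'||c cF] [z|e].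
  + by move=> inc; have [->|->] := slot_adj va ch inc; [right | left].
  + by [].
  + by [].
  + move=> inc; have [[b' _ ->]|] := node_adj nr inc; first by left.
    by rewrite (negbTE ndv) pv => ->; left.
  + by move=> inc; have [->|->] := slot_adj (vav b') (chb b') inc; left.
  + by [].
  + by [].
  + move=> inc; have [[b' va' ->]|] := node_adj nr' inc.
      by left; apply: FF'; move: va'; rewrite /= dv'; case: b'.
    by rewrite dv' pv' => -[b' ->]; left.
  + by move=> /(F'cl _ _ cF)[/FF'|->]; left.
  + by move=> /(F'cl _ _ cF)[/FF'|->]; left.
have c1 : connect_in F (inr (er (Some (u, b)))) (inl (V v)) by apply: connect_in_step.
have c2 b' : connect_in F (inr (er (Some (u, b)))) (inr (er (Some (v, b')))).
  exact: connect_in_trans c1 (connect_in_step Fv (Fe b') (incv b')).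
have c3 : connect_in F (inr (er (Some (u, b)))) (inl (V v')).
  exact: connect_in_trans (c2 true) (connect_in_step (Fe true) Fv' (incv' true)).
have c4 : connect_in F (inr (er (Some (u, b)))) (inr (er (Some (v', false)))).
  exact: connect_in_trans c3 (connect_in_step Fv' (FF' _ F'in) inc').
apply: Fcase => [||b'||c cF] //; first exact: connect0.
by apply: connect_in_trans c4 (connect_in_sub sF _); apply: F'co.
Qed.

(** Walk from the cell towards the root until a vertex of the subgraph is met; the last slot crossed
    is the one by which the tail is attached. The root lies in the subgraph, so the walk stops. *)
Lemma zz_top c : c \notin zz_set ->
  exists u b, [/\ rvalid (Some (u, b)), sV u, ~~ sE (Some (u, b)) &
    connect_in (~: zz_set) (inr (er (Some (u, b)))) c].
Proof.
have mC a : a \notin zz_set -> a \in ~: zz_set by rewrite finset.in_setC.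
have edge u b : rvalid (Some (u, b)) -> ~~ sE (Some (u, b)) ->
    exists u' b', [/\ rvalid (Some (u', b')), sV u', ~~ sE (Some (u', b')) &
    connect_in (~: zz_set) (inr (er (Some (u', b')))) (inr (er (Some (u, b))))].
  have [k] := ubnP (lev u); elim: k u b => // k IH u b le_k va nse.
  have [su|nsu] := boolP (sV u).
    by exists u, b; split=> //; apply: connect0.
  have nr : u != root by apply: contraNneq nsu => ->; apply: (zo_root zo).
  have [vap chp] := ok_par ok nr; have := ok_lev ok nr.
  case: (par u) vap chp => p b' /= vap chp lt_l.
  have [||u' [b'' [va' su' nse' co]]] := IH p b' _ vap.
  - exact: leq_trans lt_l _.
  - by rewrite (sE_child vap chp).
  exists u', b''; split=> //; apply: connect_in_trans co _.
  apply: (@connect_in_trans _ _ (inl (V u))); apply: connect_in_step; rewrite ?mC ?zz_edge ?zz_node //.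
  - by rewrite (sE_child vap chp).
  - by rewrite /= incident_node //= chp eqxx orbT.
  - by rewrite /= incident_node //= eqxx.
have edge' r : rvalid r -> ~~ sE r -> exists u b, [/\ rvalid (Some (u, b)), sV u, ~~ sE (Some (u, b)) &
    connect_in (~: zz_set) (inr (er (Some (u, b)))) (inr (er r))].
  by case: r => [[u b]|] //; apply: edge.
case: c => [z|e]; last by case: (edgeP e) => r va; rewrite zz_edge //; apply: edge'.
case: (vertexP z) => [u|r va en].
  rewrite zz_node => nsu.
  have nr : u != root by apply: contraNneq nsu => ->; apply: (zo_root zo).
  have [vap chp] := ok_par ok nr.
  case: (par u) vap chp => p b' /= vap chp.
  have nse : ~~ sE (Some (p, b')) by rewrite (sE_child vap chp).
  have [u' [b'' [va' su' nse' co]]] := edge' (Some (p, b')) vap nse.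
  exists u', b''; split=> //; apply: connect_in_trans co _.
  apply: connect_in_step; rewrite ?mC ?zz_edge ?zz_node //.
  by rewrite /= incident_node //= chp eqxx orbT.
rewrite zz_leaf // => nse; have [u' [b'' [va' su' nse' co]]] := edge' _ va nse.
exists u', b''; split=> //; apply: connect_in_trans co _.
by apply: connect_in_step; rewrite ?mC ?zz_edge ?zz_leaf //= incident_leaf.
Qed.

Lemma zz_is_tail c : c \notin zz_set ->
  exists2 u : 'I_(nv C), inl u \in zz_set & @is_tail R C u (component (~: zz_set) c).
Proof.
move=> /zz_top[u [b [va su nse co]]].
exists (V u); first by rewrite zz_node.
have [k ts] : exists k, tail_shape k u b.
  move: nse; rewrite /= su; case E: (child u b) => [v|] nsv; first exact: (zo_tail zo va su E nsv).
  (* An end that is left out at a vertex of the subgraph has even weight and forms a tail by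
     itself. *)
  by exists (swt u b)./2; apply: TailEnd; rewrite // even_halfK.
have [F [F1 F2 F3 F4 F5]] := tail_shape_cells ts va nse.
exists k; suff -> : component (~: zz_set) c = F by [].
apply/setP => d; rewrite inE.
have FS a : a \in F -> a \in ~: zz_set by rewrite finset.in_setC; apply: F3.
have cl : fingraph.closed (fun c d : cell C => [&& c \in ~: zz_set, d \in ~: zz_set & cell_adj c d]) (mem F).
  have H a a' : [&& a \in ~: zz_set, a' \in ~: zz_set & cell_adj a a'] -> a \in F -> a' \in F.
    case/and3P=> _ + adj aF; have [//|->] := F4 _ _ aF adj.
    by rewrite finset.in_setC zz_node su.
  move=> a a' h; apply/idP/idP; first exact: H.
  by apply: H; case/and3P: h => -> ->; rewrite adj_sym.
have cF : c \in F by rewrite -(closed_connect cl co).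
apply/idP/idP => [h|dF]; first by rewrite -(closed_connect cl h).
apply: (@connect_in_trans _ _ (inr (er (Some (u, b))))); first by rewrite connect_in_sym.
by apply: connect_in_sub (F5 d dF); apply/fintype.subsetP.
Qed.

Lemma tree_zigzag : @generalized_zigzag _ x C zz_set.
Proof.
split; first exact: tree_resolving.
split.
- exact: zz_is_subgraph.
- move=> c d hc hd; apply: connect_in_trans (zz_connected_root hd).
  by rewrite connect_in_sym; apply: zz_connected_root.
- exact: zz_no_Sym2.
- exact: zz_contr.
- by exists (V root); rewrite ?zz_node ?(zo_root zo) ?node_inner.
- exact: zz_even_contr.
- exact: zz_is_tail.
Qed.

Lemma v1_valid b : rvalid (Some (v1, b)).
Proof.
case: b; first by apply: (rin_valid ok (u := v1)); rewrite (zo_rin_v1 zo) !inE eqxx orbT.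
by rewrite /= andbF.
Qed.

Lemma root_valid b : rvalid (Some (root : U, b)).
Proof. by rewrite /= (negbTE (ok_root ok)). Qed.

Local Notation Ec := (er (Some (v1, false))).

Definition lowside (z : 'I_(nv C)) : bool :=
  match enum_val z with
  | inl u => (pos u < s.*2)%N
  | inr None => true
  | inr (Some (u, _)) => (pos u < s.*2)%N
  end.

Lemma lowside_node u : lowside (V u) = (pos u < s.*2)%N.
Proof. by rewrite /lowside vrK ?inE. Qed.

Lemma lowside_leaf r : rvalid r -> rend r -> lowside (L r) =
  if r is Some (u, _) then (pos u < s.*2)%N else true.
Proof. by move=> va en; rewrite /lowside vrK ?inE ?va //; case: r {va en} => [[]|]. Qed.

Local Notation minus_rel :=
  (fun u v : 'I_(nv C) => [exists e : 'I_(ne C), (e != Ec) && joins e u v]).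

Lemma minus_csym a b : @connect_minus R C Ec a b = @connect_minus R C Ec b a.
Proof.
apply: (sym_connect_sym (e := minus_rel)) => {}a {}b; apply: eq_existsb => e.
by rewrite /joins [X in _ && X]orbC.
Qed.

Lemma minus_slot u b : rvalid (Some (u, b)) -> (u, b) <> (v1, false) ->
  @connect_minus R C Ec (V u) (vr (far u b)).
Proof.
move=> va ne; apply/connect1/existsP; exists (er (Some (u, b))); rewrite joins_slot // andbT.
by rewrite er_eq ?v1_valid //; apply/eqP => -[? ?]; apply: ne; congr pair.
Qed.

Lemma low_root : (pos (root : U) < s.*2)%N.
Proof. by rewrite (zo_posroot zo) double_gt0. Qed.

Lemma minus_node u :
  @connect_minus R C Ec (V (if (pos u < s.*2)%N then root else v2)) (V u).
Proof.
have [k] := ubnP (lev u); elim: k u => // k IH u le_k.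
have [->|nr] := eqVneq u root; first by rewrite low_root; apply: connect0.
have [vap chp] := ok_par ok nr; have := ok_lev ok nr.
case: (par u) vap chp => p b /= vap chp lt_l.
have [[ep eb]|ne] := pselect ((p, b) = (v1, false)).
  move: chp; rewrite ep eb (zo_v2 zo) => -[<-].
  by rewrite ltnNge (zo_highv2 zo); apply: connect0.
rewrite -(zo_part zo vap chp ne); apply: connect_trans (IH p (leq_trans lt_l le_k)) _.
by have := minus_slot vap ne; rewrite /far chp.
Qed.

Lemma minus_lowside z : @connect_minus R C Ec (V (if lowside z then root else v2)) z.
Proof.
case: (vertexP z) => [u|r va en]; first by rewrite lowside_node; apply: minus_node.
rewrite lowside_leaf //; case: r va en => [[u b]|] va en.
  apply: connect_trans (minus_node u) _.
  have := minus_slot va; rewrite /far; move: (en) => /= /eqP E; rewrite E; apply.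
  by move=> [eu eb]; move: E; rewrite eu eb (zo_v2 zo).
rewrite minus_csym; apply/connect1/existsP; exists (er None).
by rewrite er_eq ?v1_valid //= /joins src_er // tgt_er // !eqxx.
Qed.

(** Without [E_c] no edge joins the two sides, while [minus_lowside] connects each side to its base
    vertex. Together they show that exactly two components remain, based at the root and at [v2]. *)
Lemma minus_closed : fingraph.closed minus_rel [pred z | lowside z].
Proof.
move=> z z' /existsP[e /andP[]].
case: (edgeP e) => r va; rewrite er_eq ?v1_valid // => ne.
suff h : lowside (vr (rsrc r)) = lowside (vr (rtgt r)).
  by rewrite /joins src_er // tgt_er // => /orP[] /andP[/eqP <- /eqP <-]; rewrite !inE h.
case: r va ne => [[u b]|] va ne; last by rewrite /= lowside_node lowside_leaf ?low_root.
have h : lowside (V u) = lowside (vr (far u b)).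
  rewrite /far lowside_node; case E: (child u b) => [v|].
    rewrite lowside_node; apply: (zo_part zo va E) => -[? ?]; subst u b.
    by rewrite eqxx in ne.
  by rewrite lowside_leaf //= E.
by rewrite /=; case: ifP => _.
Qed.

Lemma minus_root z : @connect_minus R C Ec (V root) z = lowside z.
Proof.
apply/idP/idP => [h|h]; last by have := minus_lowside z; rewrite h.
by have := closed_connect minus_closed h; rewrite !inE => <-; rewrite lowside_node low_root.
Qed.

Lemma minus_v2 z : @connect_minus R C Ec (V v2) z = ~~ lowside z.
Proof.
have h2 : ~~ lowside (V v2) by rewrite lowside_node -leqNgt (zo_highv2 zo).
apply/idP/idP => [h|h]; last by have := minus_lowside z; rewrite (negbTE h).
by have := closed_connect minus_closed h; rewrite !inE => <-.
Qed.

Lemma tree_properly_mixed : properly_mixed s t w C.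
Proof.
exists zz_set, Ec; split; first exact: tree_zigzag.
have va1 := v1_valid; have var := root_valid.
have [odd1 odd2 odd3] := zo_odd zo.
have tEc : vr (far v1 false) = V v2 by rewrite /far (zo_v2 zo).
have rE : Some (v1, false) \in rout v1 by rewrite (zo_rout_v1 zo) inE.
have sEc : @src _ C Ec = V v1.
  by rewrite src_er //; apply/eqP; rewrite vr_eq ?rsrc_tvset ?inE // (mem_rout ok).
have {}tEc : @tgt _ C Ec = V v2.
  have r2 : Some (v1, false) \in rin v2 by rewrite (zo_rin_v2 zo) inE eqxx.
  by rewrite tgt_er //; apply/eqP; rewrite vr_eq ?rtgt_tvset ?inE // (mem_rin ok).
split.
- split; first by rewrite zz_edge // (sE_child (va1 _) (zo_v2 zo)) (zo_sv2 zo).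
    by rewrite is_end_er ?va1 //= (zo_v2 zo).
  by rewrite wt_er ?va1.
- exists (V root), (V v2); split.
  + by rewrite minus_root lowside_node -leqNgt (zo_highv2 zo).
  + by move=> z; rewrite minus_root minus_v2; case: lowside.
  + move=> y; apply/mapP/mapP => -[z].
      rewrite mem_filter minus_root => /andP[/andP[]].
      case: (vertexP z) => [u _|r va en]; last by rewrite leaf_innerF.
      by rewrite lowside_node phi_node => lt_u _ ->; exists (pos u); rewrite // mem_iota.
    rewrite mem_iota => /andP[_ lt_z] ->.
    have [|u pu] := pos_surj pok (i := z); first by lia.
    exists (V u); last by rewrite phi_node pu.
    by rewrite mem_filter node_inner // minus_root lowside_node pu lt_z mem_enum.
  + move=> y; apply/mapP/mapP => -[z].
      rewrite mem_filter minus_v2 => /andP[/andP[]].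
      case: (vertexP z) => [u _|r va en]; last by rewrite leaf_innerF.
      rewrite lowside_node phi_node -leqNgt => lt_u _ ->; exists (pos u) => //.
      by rewrite mem_iota lt_u (pos_lt pok).
    rewrite mem_iota => /andP[ge_z lt_z] ->.
    have [|u pu] := pos_surj pok (i := z); first by [].
    exists (V u); last by rewrite phi_node pu.
    by rewrite mem_filter node_inner // minus_v2 lowside_node pu -leqNgt ge_z mem_enum.
- exists (V root), (er None), (er (Some (root, true))), (er (Some (root, false))), (er (Some (v1, true))).
  have vk := var false.
  have sk : @src _ C (er (Some (root, false))) = V root.
    apply/eqP; rewrite src_er // vr_eq ?rsrc_tvset ?inE // (mem_rout ok) //.
    by rewrite (zo_rout_root zo) !inE eqxx.
  have tk : @tgt _ C (er (Some (root, false))) = V v1.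
    apply/eqP; rewrite tgt_er // vr_eq ?rtgt_tvset ?inE // (mem_rin ok) //.
    by rewrite (zo_rin_v1 zo) !inE eqxx.
  rewrite sEc; split.
  + by rewrite !phi_node (zo_posroot zo) (zo_posv1 zo).
  + split=> //; split.
    * by rewrite card_inE // (zo_rin_root zo).
    * by rewrite card_outE // (zo_rout_root zo).
    * have -> : @outE_ _ C (V root) :&: @inE_ _ C (V v1) = [set er (Some (root, false))]%SET; last by rewrite cards1.
      apply/setP => e; case: (edgeP e) => r va.
      rewrite finset.in_set1 er_eq // finset.in_setI mem_outE // mem_inE // (zo_rout_root zo) (zo_rin_v1 zo) !inE.
      case: (r =P Some (root, false)) => //= _; apply/negP => /andP[/eqP -> /eqP[e1]].
      by have := zo_posv1 zo; rewrite -e1 (zo_posroot zo).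
    * by rewrite card_inE // (zo_rin_v1 zo).
    * by rewrite card_outE // (zo_rout_v1 zo).
  + split.
    * by rewrite inE_node // (zo_rin_root zo); apply/setP => e; rewrite !inE.
    * by rewrite outE_node // (zo_rout_root zo); apply/setP => e; rewrite !inE orbC.
    * by rewrite inE_node // (zo_rin_v1 zo); apply/setP => e; rewrite !inE.
    * by rewrite outE_node // (zo_rout_v1 zo); apply/setP => e; rewrite !inE.
  + by rewrite !wt_er ?va1 ?var //= (zo_v1_wt zo) (zo_rootw zo); split.
  + by rewrite !is_end_er ?va1 ?var // !wt_er ?va1 // /rend /rwt (zo_v1_end zo) (zo_v1_wt zo).
rewrite tEc; split; first by rewrite phi_node (zo_posv2 zo).
have va2 : rvalid (Some (v2, false)) by rewrite /= andbF.
have -> : [set e in @inE_ _ C (V v2) | odd (@wt _ C e)]%SET = @inE_ _ C (V v2).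
  apply/setP => e; rewrite finset.inE; apply: andb_idr.
  case: (edgeP e) => r va; rewrite mem_inE // wt_er // (zo_rin_v2 zo) !inE.
  by case/orP => /eqP -> //=; apply: (zo_v2_odd zo).
by rewrite card_inE // (zo_rin_v2 zo).
Qed.

End TreeZigzag.

(** * Rigidity of tree covers *)

Section Rigidity.
Variables (R : realType) (T : ztree) (K : eqType).
Notation U := (node T).
Implicit Types (u v : U).
Variables (w : nat -> R) (s t : nat) (pos pos' : U -> nat) (key : U -> K).

Definition tree_adj u v : Prop :=
  exists b, (rvalid (Some (u, b)) /\ child u b = Some v) \/
            (rvalid (Some (v, b)) /\ child v b = Some u).

Hypothesis wmono : forall i j, (i < j)%N -> w i < w j.
Hypothesis ok : ztree_ok T.
Hypothesis pok : @pos_ok T pos s t.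

Lemma tree_adj_joins (p : U -> nat) a b : tree_adj a b <->
  exists e, @joins R (tree_cover p w) e (vr (inl a)) (vr (inl b)).
Proof.
have sym e (x y : 'I_(nv (tree_cover p w))) : joins e x y = joins e y x by rewrite /joins orbC.
have H u c v : rvalid (Some (u, c)) -> child u c = Some v ->
    exists e, @joins R (tree_cover p w) e (vr (inl u)) (vr (inl v)).
  move=> va ch; exists (er (Some (u, c))); rewrite /joins src_er // tgt_er //= /far ch.
  by case: ifP => _; rewrite !eqxx ?orbT.
split=> [[c [[va ch]|[va ch]]]|[e]]; first exact: H va ch.
  by have [e he] := H _ _ _ va ch; exists e; rewrite sym.
case: (edgeP e) => r va; rewrite /joins src_er // tgt_er //.
case: r va => [[u c]|] va; last first.
  by rewrite /= ![_ == vr (inl _)]vr_eq ?inE // => /orP[] /andP[].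
rewrite /= /far; case E: (child u c) => [v|]; last first.
  have nl z : vr (inr (Some (u, c))) == vr (inl z) = false.
    by rewrite vr_eq ?inE ?va /= ?E.
  by case: ifP => _; rewrite !nl ?andbF.
by case: ifP => _; rewrite !vr_inl_eq => /orP[] /andP[/eqP <- /eqP <-]; exists c; auto.
Qed.

(** Inner vertices are the vertices with finite image, so an isomorphism maps them to inner
    vertices, and [w] is injective, so it preserves their positions. *)
Lemma tree_iso_nodes : cover_iso (tree_cover pos w) (tree_cover pos' w) ->
  exists f : U -> U, [/\ injective f, forall u, pos' (f u) = pos u &
    forall u v, tree_adj u v -> tree_adj (f u) (f v)].
Proof.
move=> [fv [fe [bv be fst _ [fphi _]]]].
have fE u : {u' | fv (vr (inl u)) = vr (inl u') & pos' u' = pos u}.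
  apply: cid2; have := fphi (vr (inl u)); rewrite phi_node.
  case: (vertexP (fv (vr (inl u)))) => [u'|r va en].
    by move=> h; exists u' => //; apply: (w_inj wmono); apply: EFin_inj; rewrite -h phi_node.
  by rewrite phi_vr ?inE ?va //=; case: ifP.
pose f u := s2val (fE u).
have fV u : fv (vr (inl u)) = vr (inl (f u)) by rewrite /f; case: (fE u).
have fP u : pos' (f u) = pos u by rewrite /f; case: (fE u).
exists f; split=> //.
  move=> u v e; apply/eqP; rewrite -(vr_inl_eq u v); apply/eqP.
  by apply: (bij_inj bv); rewrite !fV e.
move=> u v /(tree_adj_joins pos)[e je]; apply/(tree_adj_joins pos').
exists (fe e); have [hs ht] := fst e; rewrite -!fV.
by move: je; rewrite /joins hs ht => /orP[] /andP[/eqP -> /eqP ->]; rewrite !eqxx ?orbT.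
Qed.

Hypothesis keyP : forall u b b' v v', rvalid (Some (u, b)) -> rvalid (Some (u, b')) ->
  child u b = Some v -> child u b' = Some v' -> key v = key v' -> v = v'.

Lemma tree_rigid (f : U -> U) : injective f -> f root = root ->
  (forall u, key (f u) = key u) ->
  (forall u v, tree_adj u v -> tree_adj (f u) (f v)) -> forall u, f u = u.
Proof.
move=> inj_f f_root key_f adj_f u.
have [k] := ubnP (lev u); elim: k u => // k IH u le_k.
have [->//|nr] := eqVneq u root.
have [vap chp] := ok_par ok nr; have := ok_lev ok nr.
case: (par u) vap chp => p b /= vap chp lt_l.
have fp : f p = p by apply: IH; apply: leq_trans lt_l _.
have : tree_adj (f p) (f u) by apply: adj_f; exists b; left.
(* The neighbours of [p] are its children and its parent. A child with the key of [u] is [u] itself.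
   If [f u] were the parent of [p], it would be fixed by induction, and injectivity of [f] would
   give [f u = u] again. *)
rewrite fp => -[b' [[va ch]|[va ch]]].
  exact: keyP va vap ch chp (key_f u).
have [nrp pp _] := ok_child ok va ch.
have lt_pp := ok_lev ok nrp; rewrite pp in lt_pp.
by apply: inj_f; apply: IH; lia.
Qed.

End Rigidity.

(** * Trees given by codes *)

Section TreeLists.
Variable T : ztree.
Notation U := (node T).
Implicit Types (u v : U).

Lemma rin_nondbl u : ~~ dbl u -> u != root -> rin u =
  (if up (par u).1 (par u).2 then [:: Some (par u)] else [::]) ++
  (if up u false then [::] else [:: Some (u, false)]) ++
  (if up u true then [::] else [:: Some (u, true)]).
Proof.
move=> nd nr; rewrite /rin /parents /slots (negbTE nd) (negbTE nr) eqb_id /=.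
by case: (up u false); case: (up u true).
Qed.

Lemma rout_nondbl u : ~~ dbl u -> u != root -> rout u =
  (if up (par u).1 (par u).2 then [::] else [:: Some (par u)]) ++
  (if up u false then [:: Some (u, false)] else [::]) ++
  (if up u true then [:: Some (u, true)] else [::]).
Proof.
move=> nd nr; rewrite /rout /parents /slots (negbTE nd) (negbTE nr) /=.
by case: (up _ (par u).2); case: (up u false); case: (up u true).
Qed.

Lemma rin_rootE : ~~ dbl (root : U) -> rin (root : U) =
  None :: (if up (root : U) false then [::] else [:: Some (root, false)])
  ++ (if up (root : U) true then [::] else [:: Some (root, true)]).
Proof.
move=> nd; rewrite /rin /parents /slots (negbTE nd) eqxx /=.
by case: (up _ false); case: (up _ true).
Qed.

Lemma rout_rootE : ~~ dbl (root : U) -> rout (root : U) =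
  (if up (root : U) false then [:: Some (root, false)] else [::])
  ++ (if up (root : U) true then [:: Some (root, true)] else [::]).
Proof.
move=> nd; rewrite /rout /parents /slots (negbTE nd) eqxx /=.
by case: (up _ false); case: (up _ true).
Qed.

(** Orientations enter as factors 0 or 1, so a single linear identity replaces the case distinction
    on which edges are incoming. The next two lemmas follow the same pattern. *)
Lemma balance_root : ~~ dbl (root : U) ->
  (rootw T + (~~ up (root : U) false) * swt (root : U) false
     + (~~ up (root : U) true) * swt (root : U) true =
   up (root : U) false * swt (root : U) false + up (root : U) true * swt (root : U) true)%N ->
  (\sum_(r <- rin (root : U)) rwt r = \sum_(r <- rout (root : U)) rwt r)%N.
Proof.
move=> nd; rewrite /rin /rout /parents /slots (negbTE nd) eqxx /=.
by case: (up _ false); case: (up _ true); rewrite /= ?big_cons ?big_nil /=; lia.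
Qed.

Lemma balance_dbl u (p := (par u).1) : dbl u ->
  (up p false * swt p false + up p true * swt p true + (~~ up u false) * swt u false =
   (~~ up p false) * swt p false + (~~ up p true) * swt p true + up u false * swt u false)%N ->
  (\sum_(r <- rin u) rwt r = \sum_(r <- rout u) rwt r)%N.
Proof.
move=> d; rewrite /rin /rout /parents /slots d -/p /=.
by case: (up p false); case: (up p true); case: (up u false);
  rewrite /= ?big_cons ?big_nil /=; lia.
Qed.

Lemma balance_nondbl u (p := (par u).1) (b := (par u).2) : ~~ dbl u -> u != root ->
  (up p b * swt p b + (~~ up u false) * swt u false + (~~ up u true) * swt u true =
   (~~ up p b) * swt p b + up u false * swt u false + up u true * swt u true)%N ->
  (\sum_(r <- rin u) rwt r = \sum_(r <- rout u) rwt r)%N.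
Proof.
move=> nd nr; rewrite rin_nondbl // rout_nondbl // -/p -/b.
have -> : par u = (p, b) by rewrite /p /b -surjective_pairing.
by case: (up p b); case: (up u false); case: (up u true);
  rewrite /= ?big_cons ?big_nil /=; lia.
Qed.

Definition slot_ends (d : bool) u : seq nat :=
  [seq swt u b | b <- [:: false; true] & [&& rvalid (Some (u, b)), child u b == None & up u b == d]].

Lemma end_weights_nodes d : perm_eq (end_weights T d)
  ((if d then [::] else [:: rootw T]) ++ flatten [seq slot_ends d u | u <- enum U]).
Proof.
pose s := None :: [seq Some (u, b) | u <- enum U, b <- [:: false; true]].
have ps : perm_eq (enum {: option (U * bool)}) s.
  apply: uniq_perm; first exact: enum_uniq.
    rewrite /s cons_uniq allpairs_uniq ?enum_uniq //; last by move=> [a b] [a' b'] _ _ [-> ->].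
    by rewrite andbT; apply/allpairsP => -[[u b] []].
  move=> [[u b]|]; rewrite mem_enum !inE //; apply/esym/allpairsP.
  by exists (u, b); split; rewrite ?mem_enum //; case: b.
rewrite /end_weights; apply: perm_trans (perm_map _ (perm_filter _ ps)) _.
have H l : [seq rwt r | r <- [seq Some (u, b) | u <- l, b <- [:: false; true]] &
    [&& rvalid r, rend r & rup r == d]] = flatten [seq slot_ends d u | u <- l].
  elim: l => // u l IH; rewrite map_cons [in RHS]/= -IH allpairs_cons filter_cat map_cat.
  by congr cat; rewrite /slot_ends /=; case: ifP => _; case: ifP => _.
by rewrite -H /s; case: d {ps H}.
Qed.

End TreeLists.

Section RawTrees.
Variables (rU : choiceType) (nodes : seq rU) (rroot : rU) (rw0 : nat).
Variables (rch : rU -> bool -> option rU) (ru : rU -> bool -> bool) (rw : rU -> bool -> nat).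
Variables (rpar : rU -> rU * bool) (rdbl : rU -> bool) (rlev : rU -> nat).

Record raw_ok : Prop := RawOk {
  ro_uniq : uniq nodes;
  ro_root : rroot \in nodes;
  ro_child : forall x b y, x \in nodes -> ~~ (rdbl x && b) -> rch x b = Some y ->
    [/\ y \in nodes, y != rroot, (rpar y).1 = x &
        if rdbl y then ~~ rdbl x /\ rch x (~~ b) = Some y else (rpar y).2 = b];
  ro_par : forall y, y \in nodes -> y != rroot ->
    [/\ (rpar y).1 \in nodes, ~~ (rdbl (rpar y).1 && (rpar y).2),
        rch (rpar y).1 (rpar y).2 = Some y & (rlev (rpar y).1 < rlev y)%N];
  ro_dbl : ~~ rdbl rroot;
  ro_wt0 : (0 < rw0)%N;
  ro_wt : forall x b, x \in nodes -> ~~ (rdbl x && b) -> (0 < rw x b)%N;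
  ro_bal0 : (rw0 + (~~ ru rroot false) * rw rroot false + (~~ ru rroot true) * rw rroot true =
     ru rroot false * rw rroot false + ru rroot true * rw rroot true)%N;
  ro_bal : forall x, x \in nodes -> x != rroot -> ~~ rdbl x ->
     let: (p, b) := rpar x in
     (ru p b * rw p b + (~~ ru x false) * rw x false + (~~ ru x true) * rw x true =
     (~~ ru p b) * rw p b + ru x false * rw x false + ru x true * rw x true)%N;
  ro_bald : forall x, x \in nodes -> rdbl x ->
     let p := (rpar x).1 in
     (ru p false * rw p false + ru p true * rw p true + (~~ ru x false) * rw x false =
     (~~ ru p false) * rw p false + (~~ ru p true) * rw p true + ru x false * rw x false)%N }.

Hypothesis rok : raw_ok.

Notation N := (seq_sub nodes).
Definition rawroot : N := SeqSub (ro_root rok).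
(** At a valid slot [ro_child] keeps the code inside [nodes], so [insub] fails only where [rch]
    already returns [None]. *)
Definition rawchild (u : N) (b : bool) : option N := obind insub (rch (ssval u) b).
Definition rawpar (u : N) : N * bool := (insubd rawroot (rpar (ssval u)).1, (rpar (ssval u)).2).

Definition rawtree : ztree :=
  @ZTree N rawroot rw0 rawchild (fun u b => ru (ssval u) b) (fun u b => rw (ssval u) b) rawpar
    (fun u => rdbl (ssval u)) (fun u => rlev (ssval u)).

Lemma rawchildP (u v : N) b : ~~ (rdbl (ssval u) && b) ->
  rawchild u b = Some v <-> rch (ssval u) b = Some (ssval v).
Proof.
move=> va; rewrite /rawchild; split; last by move=> -> /=; rewrite (valK v).
case E: (rch _ _) => [y|//] /=; case: insubP => // v' _ <- [->] //.
Qed.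

Lemma rawchildN (u : N) b : ~~ (rdbl (ssval u) && b) ->
  (rawchild u b == None) = (rch (ssval u) b == None).
Proof.
move=> va; rewrite /rawchild; case E: (rch _ _) => [y|//] /=.
have [yn _ _ _] := ro_child rok (ssvalP u) va E.
by case: insubP => //; rewrite yn.
Qed.

Lemma rawparP (u : N) : ssval u != rroot -> ssval (rawpar u).1 = (rpar (ssval u)).1.
Proof.
move=> nr; have [pn _ _ _] := ro_par rok (ssvalP u) nr.
by rewrite /rawpar insubdK.
Qed.

Lemma rawtree_ok : ztree_ok rawtree.
Proof.
split.
- move=> u b v /= va /(rawchildP _ va) ch.
  have [_ nr pv hd] := ro_child rok (ssvalP u) va ch.
  split=> //; first by apply: val_inj; rewrite /= rawparP.
  case: ifP hd => // _ [nd ch']; split=> //.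
  by apply/rawchildP; rewrite ?(negbTE nd).
- move=> v nr /=; have [pn va ch _] := ro_par rok (ssvalP v) nr.
  rewrite rawparP //; split=> //.
  by apply/rawchildP; rewrite rawparP.
- exact: ro_dbl rok.
- by move=> v nr /=; rewrite rawparP //; have [] := ro_par rok (ssvalP v) nr.
- move=> [[u b]|] /=; last by move=> _; apply: ro_wt0 rok.
  by move=> va; apply: (ro_wt rok) => //; apply: ssvalP.
move=> u; have [->|nr] := eqVneq u rawroot.
  exact: (balance_root (T := rawtree) (ro_dbl rok) (ro_bal0 rok)).
have pE := rawparP (nr : ssval u != rroot).
have [du|nd] := boolP (rdbl (ssval u)).
  have B := ro_bald rok (ssvalP u) du; rewrite /= -pE in B.
  exact: (balance_dbl (T := rawtree) du B).
have B := ro_bal rok (ssvalP u) nr nd.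
have E : rpar (ssval u) = (ssval (rawpar u).1, (rawpar u).2).
  by rewrite pE -surjective_pairing.
rewrite E in B; exact: (balance_nondbl (T := rawtree) nd nr B).
Qed.

Lemma enum_rawnodes : perm_eq [seq ssval u | u <- enum {: N}] nodes.
Proof.
apply: uniq_perm; rewrite ?(ro_uniq rok) //.
  by rewrite map_inj_uniq ?enum_uniq //; apply: val_inj.
move=> x; apply/mapP/idP => [[u _ ->]|xn]; first exact: ssvalP.
by exists (SeqSub xn); rewrite ?mem_enum.
Qed.

Definition raw_ends (d : bool) (x : rU) : seq nat :=
  [seq rw x b | b <- [:: false; true] & [&& ~~ (rdbl x && b), rch x b == None & ru x b == d]].

Lemma raw_end_weights d : perm_eq (end_weights rawtree d)
  ((if d then [::] else [:: rw0]) ++ flatten [seq raw_ends d x | x <- nodes]).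
Proof.
apply: perm_trans (end_weights_nodes _ d) _; rewrite perm_cat2l.
rewrite (_ : [seq slot_ends d u | u <- enum (node rawtree)] =
   [seq raw_ends d x | x <- [seq ssval u | u <- enum {: N}]]).
  by apply/perm_flatten/perm_map/enum_rawnodes.
rewrite -[RHS]map_comp; apply: eq_map => u; rewrite /slot_ends /raw_ends.
congr map; apply: eq_filter => b; rewrite /=.
by case: (boolP (~~ (rdbl (ssval u) && b))) => //= va; rewrite rawchildN.
Qed.

End RawTrees.

(** * Logarithmic bounds *)

Section LogBounds.
Variable R : realType.

(** This is [ln (1 + x) <= x] at [x = b / a - 1], multiplied by [a]. *)
Lemma mul_ln_ratio_le (a b : R) : 0 < a -> 0 < b -> a * (ln b - ln a) <= b - a.
Proof.
move=> a0 b0; rewrite -ln_div //.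
have -> : b - a = a * (b / a - 1) by field; rewrite gt_eqF.
rewrite ler_pM2l // -[X in ln X](subrK 1) [X in ln X]addrC.
by apply: le_ln1Dx; have := divr_gt0 b0 a0; lra.
Qed.

(** The induction step amounts to [k (ln (k + 1) - ln k) <= 1], an instance of the preceding
    inequality. *)
Lemma ln_fact_ge k : k%:R * ln k%:R - k%:R <= ln (k`!)%:R :> R.
Proof.
elim: k => [|k IH]; first by rewrite mul0r subr0 fact0 ln1.
rewrite factS natrM lnM ?posrE ?ltr0n ?fact_gt0 //.
case: k IH => [|k] IH; first by rewrite fact0 ln1; lra.
have := @mul_ln_ratio_le k.+1%:R k.+2%:R (ltr0Sn _ _) (ltr0Sn _ _).
move: IH; rewrite -[k.+2%:R]natr1; move: (ln (_ + 1)) (ln k.+1%:R) => x y; lra.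
Qed.

(** A layer of size [r] is measured against [n0] through [r ln n0 - n0 <= r ln r - r], so each of
    the two small layers costs one extra [n0]. Writing [- 2] in place of Stirling's [- 1] pays for
    that. *)
Lemma ln_count_ge (nbr n0 q r : nat) : (r < n0)%N ->
  nbr%:R * (ln nbr%:R - 2) + (2 * (q * n0 + r)%:R + 4 * n0%:R) * (ln n0%:R - 2)
  <= ln (nbr`! * (n0`! ^ (q.*2 + 4) * r`! ^ 2))%:R :> R.
Proof.
move=> lt_r; have n0_gt0 : 0 < n0%:R :> R by rewrite ltr0n (leq_ltn_trans _ lt_r).
have fp k : ((k`!)%:R : R) \in Num.pos by rewrite posrE ltr0n fact_gt0.
rewrite !natrM natrX !lnM ?lnXn -?posrE ?rpredM ?rpredX ?fp //.
have h1 := ln_fact_ge nbr; have h2 := ln_fact_ge n0; have h3 := ln_fact_ge r.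
have h4 : r%:R * ln n0%:R - n0%:R <= r%:R * ln r%:R - r%:R :> R.
  case: (posnP r) => [->|r0]; first by rewrite !mul0r subr0; lra.
  have := @mul_ln_ratio_le r%:R n0%:R; rewrite ltr0n r0 => /(_ isT n0_gt0); lra.
rewrite -[_ *+ (_ + 4)]mulr_natr -mul2n.
rewrite (natrD _ (q * n0)) (natrD _ (2 * q)) !natrM.
have nb0 : 0 <= nbr%:R :> R by [].
have r0 : 0 <= r%:R :> R by [].
have q0 : 0 <= q%:R :> R by [].
have := ler_wpM2r (_ : 0 <= 2 * q%:R + 4 :> R) h2; move=> /(_ ltac:(lra)).
have : 0 <= q%:R * n0%:R :> R by rewrite mulr_ge0.
lra.
Qed.

Lemma ln_shift_ge (d : R) (a C : nat) : (0 < a)%N -> 0 < d -> exists N : nat,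
  forall h n : nat, (N <= h)%N -> (h <= a * n + C)%N ->
    (1 - d) * h%:R <= a%:R * n%:R /\ (1 - d) * ln h%:R <= ln n%:R - 2.
Proof.
move=> a0 d0.
(* The three summands serve in turn to make [C <= d h], to make [n >= h / (2 a)], and to absorb
   [2 + ln (2 a)] into [d ln h]. *)
pose x : R := C%:R / d + (2 * C%:R + 1) + expR ((2 + ln (2 * a%:R)) / d).
exists (Num.bound x) => h n le_h le_hn.
have C0 : 0 <= C%:R :> R by [].
have aR : 0 < a%:R :> R by rewrite ltr0n.
have Cd0 : 0 <= C%:R / d by rewrite divr_ge0 // ltW.
have e0 := expR_gt0 ((2 + ln (2 * a%:R)) / d).
have x0 : 0 <= x by rewrite /x; lra.
have lt_xh : x < h%:R.
  by apply: lt_le_trans (_ : x < (Num.bound x)%:R) _; rewrite ?ler_nat // archi_boundP.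
have le_R : h%:R <= a%:R * n%:R + C%:R :> R by rewrite -natrM -natrD ler_nat.
have h0 : 0 < h%:R :> R by apply: le_lt_trans lt_xh.
split.
  have : C%:R / d <= h%:R by apply: le_trans (ltW lt_xh); rewrite /x; lra.
  by rewrite ler_pdivrMr // => le_C; lra.
have le_n : h%:R / (2 * a%:R) <= n%:R :> R.
  rewrite ler_pdivrMr; last by lra.
  have : 2 * C%:R <= h%:R :> R by apply: le_trans (ltW lt_xh); rewrite /x; lra.
  lra.
have n0 : 0 < n%:R :> R by apply: lt_le_trans le_n; rewrite divr_gt0 //; lra.
have : ln (h%:R / (2 * a%:R)) <= ln n%:R :> R.
  by rewrite ler_ln ?posrE // divr_gt0 //; lra.
rewrite ln_div ?posrE //; last by lra.
have : (2 + ln (2 * a%:R)) / d <= ln h%:R.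
  rewrite -[leLHS]expRK ler_ln ?posrE //; apply: le_trans (ltW lt_xh); rewrite /x; lra.
by rewrite ler_pdivrMr // => h1 h2; lra.
Qed.

Lemma liminf_bound (eps : R) (C : nat) (z : nat -> nat -> nat -> nat) : 0 < eps ->
  (forall g h m, (C <= h)%N -> (C <= m)%N -> exists nbr n0,
    [/\ (h <= 3 * nbr + C)%N, (m <= n0 + C)%N, (0 < n0)%N &
      (nbr`! * (n0`! ^ ((g %/ n0).*2 + 4) * (g %% n0)`! ^ 2) <= z g h m)%N]) ->
  exists N : nat, forall g h m : nat, (N <= g)%N -> (N <= h)%N -> (N <= m)%N ->
    1 - eps <= ln (z g h m)%:R /
      (h%:R / 3 * ln h%:R + 2 * g%:R * ln m%:R + 4 * m%:R * ln m%:R).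
Proof.
(* The final bound is [(1 - d)^2 >= 1 - 2 d >= 1 - eps]; the cap by 1 keeps [1 - d] positive when
   [eps] is large. *)
move=> eps0 zP; pose d := Num.min eps 1 / 2.
have [d0 d1 d2] : [/\ 0 < d, d <= 1/2 & d * 2 <= eps].
  by rewrite /d; case: (leP eps 1) => h; split; lra.
have [N1 N1P] := @ln_shift_ge d 3 C isT d0.
have [N2 N2P] := @ln_shift_ge d 1 C isT d0.
exists (N1 + N2 + C + 2)%N => g h m _ le_h le_m.
have [|| nbr [n0 [le_nbr le_n0 n0_gt0 le_z]]] := zP g h m; [lia|lia|].
have [] := N1P h nbr _ le_nbr; first by lia.
have [] := N2P m n0; [lia|by rewrite mul1n|rewrite mul1r => b1 b2 b3 b4].
have m1 : 1 < m%:R :> R by rewrite ltr1n; lia.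
have h1 : 1 < h%:R :> R by rewrite ltr1n; lia.
have lnm : 0 < ln m%:R :> R by apply: ln_gt0.
have lnh : 0 <= ln h%:R :> R by apply: ln_ge0; lra.
have mm : 0 < m%:R * ln m%:R :> R by rewrite mulr_gt0 //; lra.
have gm : 0 <= g%:R * ln m%:R :> R by rewrite mulr_ge0 // ltW.
have hh : 0 <= h%:R * ln h%:R :> R by rewrite mulr_ge0.
rewrite ler_pdivlMr; last by lra.
have fp k j : (0 < k`! ^ j)%N by rewrite expn_gt0 fact_gt0.
apply: le_trans (_ : ln (nbr`! * (n0`! ^ ((g %/ n0).*2 + 4) * (g %% n0)`! ^ 2))%:R <= _); last first.
  have X0 : (0 < nbr`! * (n0`! ^ ((g %/ n0).*2 + 4) * (g %% n0)`! ^ 2))%N by rewrite !muln_gt0 ?fact_gt0 ?fp.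
  by rewrite ler_ln ?ler_nat // posrE ltr0n // (leq_trans X0).
have lt_r : (g %% n0 < n0)%N by rewrite ltn_mod.
apply: le_trans (ln_count_ge nbr (g %/ n0) lt_r); rewrite -divn_eq.
have dd : 1 - eps <= (1 - d) * (1 - d) by have := sqr_ge0 d; rewrite expr2; lra.
(* One factor [1 - d] covers the loss in the number of permuted points, the other the loss inside
   the logarithm. *)
apply: (@le_trans _ _ ((1 - d) * (1 - d) *
  (h%:R / 3 * ln h%:R + 2 * g%:R * ln m%:R + 4 * m%:R * ln m%:R))).
  by rewrite ler_wpM2r //; lra.
have t1 : (1 - d) * (h%:R / 3) * ((1 - d) * ln h%:R) <= nbr%:R * (ln nbr%:R - 2).
  by apply: ler_pM; rewrite ?mulr_ge0 ?divr_ge0 //; lra.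
have t2 : (1 - d) * (2 * g%:R + 4 * m%:R) * ((1 - d) * ln m%:R) <=
    (2 * g%:R + 4 * n0%:R) * (ln n0%:R - 2).
  have g0 : 0 <= g%:R :> R by [].
  have dg : 0 <= d * g%:R by rewrite mulr_ge0 // ltW.
  by apply: ler_pM; rewrite ?mulr_ge0 //; lra.
lra.
Qed.

End LogBounds.

Local Close Scope ring_scope.
From mathcomp Require Import fingroup perm.

(** * Layered permutations *)

Section LayeredPositions.
Variables (T : finType) (ht : T -> nat).

(** The rank of [u] when [T] is sorted by height. The order inside a layer is an arbitrary reference
    order, later changed by a height-preserving permutation. *)
Definition layer_pos (u : T) : nat := index u (sort (relpre ht leq) (enum T)).

Lemma layer_pos_lt u : (layer_pos u < #|T|)%N.
Proof. by rewrite cardE -(size_sort (relpre ht leq)) index_mem mem_sort mem_enum. Qed.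

Lemma layer_pos_inj : injective layer_pos.
Proof.
move=> u v e; have in_s x : x \in sort (relpre ht leq) (enum T) by rewrite mem_sort mem_enum.
by rewrite -(nth_index u (in_s u)) -[RHS](nth_index u (in_s v)); congr nth.
Qed.

Lemma layer_pos_mono u v : (ht u < ht v)%N -> (layer_pos u < layer_pos v)%N.
Proof.
apply: contraTT; rewrite -!leqNgt => le_vu.
have tr : transitive (relpre ht leq) by move=> a b c /=; apply: leq_trans.
have rf : reflexive (relpre ht leq) by move=> a /=.
apply: (sorted_leq_index tr rf) le_vu; rewrite ?mem_sort ?mem_enum //.
by apply: sort_sorted => a b /=; apply: leq_total.
Qed.

Definition layer_perms : {set {perm T}} := [set p : {perm T} | [forall v, ht (p v) == ht v]]%SET.

Lemma layer_permsP (p : {perm T}) : reflect (forall v, ht (p v) = ht v) (p \in layer_perms).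
Proof. by rewrite inE; apply: (iffP forallP) => h v; apply/eqP. Qed.

(** A member of [F] chooses, for every layer, a permutation supported in that layer. [gf] glues them
    by applying to each point the permutation of its own layer, fixing points of height at least
    [k]. The glued map preserves heights, hence is injective, and its restrictions to the layers
    recover the choice. *)
Lemma card_layer_perms k :
  (\prod_(l < k) (#|[set v | ht v == l]%SET|)`! <= #|layer_perms|)%N.
Proof.
pose L (l : 'I_k) := [set v | ht v == l]%SET.
pose F := family (fun l => mem (Sym (L l))).
have <- : #|F| = (\prod_(l < k) (#|L l|)`!)%N.
  rewrite card_family foldrE big_image /=.
  by apply: eq_bigr => l _; rewrite card_Sym.
pose gf (f : {ffun 'I_k -> {perm T}}) v := if insub (ht v) is Some l then f l v else v.
have ht_gf f v : f \in F -> ht (gf f v) = ht v.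
  move=> /familyP fF; rewrite /gf; case: insubP => // l _ hl.
  have := fF l; rewrite inE => fl.
  have : f l v \in L l by rewrite (perm_closed _ fl) inE hl.
  by rewrite inE hl => /eqP.
have inj_gf f : f \in F -> injective (gf f).
  move=> fF u v e; have := ht_gf f u fF; rewrite e ht_gf // => eh.
  by move: e; rewrite /gf eh; case: insubP => // l _ _ /perm_inj.
pose h f : {perm T} := if pselect (injective (gf f)) is left p then perm p else 1%g.
have hE f v : f \in F -> h f v = gf f v.
  by move=> fF; rewrite /h; case: pselect => [p|/(_ (inj_gf f fF)) //]; rewrite permE.
have inj_h : {in F &, injective h}.
  move=> f f' fF f'F e; apply/ffunP => l; apply/permP => v.
  move/familyP: (fF) => /(_ l); rewrite inE => Sf.
  move/familyP: (f'F) => /(_ l); rewrite inE => Sf'.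
  have [vL|vL] := boolP (v \in L l); last by rewrite !(out_perm _ vL).
  move/permP: e => /(_ v); rewrite !hE // /gf.
  move: vL; rewrite inE => /eqP ->.
  by rewrite valK.
rewrite -(card_in_imset inj_h); apply: subset_leq_card.
apply/fintype.subsetP => _ /imsetP[f fF ->]; apply/layer_permsP => v.
by rewrite hE // ht_gf.
Qed.
End LayeredPositions.

(** * A concrete family of trees *)

(* [Fk d x] is a pair of form (A) ([d = false]) or (A') with a fork of weight [x], and
   [Bk x y] is a pair of form (B) that takes in weight [x] and gives off weight [y]. *)
Inductive step := Fk (d : bool) (x : nat) | Bk (x y : nat).

Definition next_weight (st : step) (W : nat) : nat :=
  match st with
  | Fk d x => if d then W - x.*2 else W + x.*2
  | Bk x y => W - y + x
  end.

Definition raw : choiceType := ((nat + nat * bool) * bool + nat * nat)%type.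
(* [TN i b] is the lower ([b = false]) or upper vertex of the trunk pair [i], [BN j c b]
   is that of the pair [c] of the branch [j], and [SN i j] is the [j]-th vertex of the
   tail at the vertex [SN i 0] of the string. *)
Definition TN (i : nat) (b : bool) : raw := inl (inl i, b).
Definition BN (j : nat) (c b : bool) : raw := inl (inr (j, c), b).
Definition SN (i j : nat) : raw := inr (i, j).

(* [stp i] describes the trunk pair [i < nt], those with [b0 <= i < b0 + nb] carrying a
   branch; [tl i], [tdir i] and [tw i] are the length, the direction and the first weight
   of the tail at the string vertex [i < nl], and [sht i j] is the layer of [SN i j]. *)
Record blueprint := Blueprint {
  nt : nat; nb : nat; b0 : nat; nl : nat; bo : nat;
  stp : nat -> step; tl : nat -> nat; tdir : nat -> bool; tw : nat -> nat;
  sht : nat -> nat -> nat }.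

Section Concrete.
Variable B : blueprint.
Notation nt := (nt B).
Notation nb := (nb B).
Notation b0 := (b0 B).
Notation L := (nl B).
Notation o := (bo B).
Notation stp := (stp B).
Notation tl := (tl B).
Notation tdir := (tdir B).
Notation tw := (tw B).
Notation sht := (sht B).

(** Index 1 is exceptional: behind pair 0 the trunk goes on with the weight 1 that the root gives
    off, while the main output [2 o - 1] of [v_1] feeds the string. *)
Fixpoint trunk_weight (i : nat) : nat :=
  if i is i'.+1 then if i' is 0 then 1 else next_weight (stp i') (trunk_weight i') else o.
Notation W := trunk_weight.
Definition main_weight (i : nat) : nat := next_weight (stp i) (W i).

(** The signed weight of the edge entering [SN i 0] from the side of the root, positive when the
    edge is oriented towards [SN i 0]. At [i = 0] this edge is [E_c]. *)
Definition flow (i : nat) : int :=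
  ((2 * o)%:Z - 1 + \sum_(k < i) (if tdir k then - (tw k)%:Z else (tw k)%:Z))%R.

(** [ent i] and [outb i] tell at which vertex of pair [i] the trunk enters and leaves. A fork pair
    is entered and left at the same vertex, the upper one for (A) and the lower one for (A'); a pair
    of form (B) is entered below and left above. *)
Definition ent (i : nat) : bool := if stp i is Fk d _ then ~~ d else false.
Definition outb (i : nat) : bool := if stp i is Fk d _ then ~~ d else true.
Definition nxt (i : nat) : option raw :=
  if i.+1 < nt then Some (TN i.+1 (ent i.+1)) else None.

(** A branch is a merging pair ([c = false]), entered above with weight 1 and left with weight 3,
    followed by a splitting pair ([c = true]), which is entered below and has three outgoing ends of
    weight 1. In a tail, an odd [j] opens a symmetric cycle or, at [j = tl i], carries the final
    fork; a positive even [j] closes a cycle, and both slots of its predecessor lead to it. *)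
Definition rch (x : raw) (sl : bool) : option raw :=
  match x with
  | inl (inl i, b) =>
    match stp i with
    | Fk d _ => if b == ~~ d then if sl then Some (TN i d) else nxt i else None
    | Bk _ _ =>
      if b then if sl then None else if i is 0 then Some (SN 0 0) else nxt i
      else if sl then
        if i is 0 then nxt 0
        else if b0 <= i < b0 + nb then Some (BN (i - b0) false true) else None
      else Some (TN i true)
    end
  | inl (inr (j, c), b) =>
    if b == ~~ c then
      if sl then Some (BN j c c) else if c then None else Some (BN j true false)
    else None
  | inr (i, j) =>
    if j is 0 then
      if sl then if tl i is 0 then None else Some (SN i 1)
      else if i.+1 < L then Some (SN i.+1 0) else None
    else if j == tl i then None else Some (SN i j.+1)
  end.

Definition ru (x : raw) (sl : bool) : bool :=
  match x with
  | inl (inl i, b) =>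
    match stp i with
    | Fk d _ => if b == ~~ d then if sl then d else true else d
    | Bk _ _ => if b then ~~ sl else true
    end
  | inl (inr (j, c), b) => if b == ~~ c then if sl then c else true else c
  | inr (i, j) => if j is 0 then if sl then tdir i else (0 < flow i.+1)%R else tdir i
  end.

Definition rw (x : raw) (sl : bool) : nat :=
  match x with
  | inl (inl i, b) =>
    match stp i with
    | Fk d x => if b == ~~ d then if sl then x.*2 else main_weight i else x
    | Bk x y => if b then if sl then x else main_weight i
                else if sl then y else W i - y
    end
  | inl (inr (j, c), b) =>
    if b == ~~ c then if sl then 2 else if c then 1 else 3 else 1
  | inr (i, j) =>
    if j is 0 then if sl then tw i else `|flow i.+1|%N
    else if odd j then 1 else 2
  end.

Definition rpar (x : raw) : raw * bool :=
  match x with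
  | inl (inl i, b) =>
    if b == ent i then
      match i with
      | 0 => (TN 0 false, false)
      | 1 => (TN 0 false, true)
      | i'.+1 => (TN i' (outb i'), false)
      end
    else (TN i (ent i), if stp i is Fk _ _ then true else false)
  | inl (inr (j, c), b) =>
    if b == ~~ c then if c then (BN j false true, false) else (TN (b0 + j) false, true)
    else (BN j c (~~ c), true)
  | inr (i, j) =>
    match j with
    | 0 => if i is i'.+1 then (SN i' 0, false) else (TN 0 true, false)
    | 1 => (SN i 0, true)
    | j'.+1 => (SN i j', false)
    end
  end.

Definition rdbl (x : raw) : bool :=
  if x is inr (i, j) then (0 < j) && ~~ odd j else false.

Definition rlev (x : raw) : nat :=
  match x with
  | inl (inl i, b) => i.*2 + (b != ent i)
  | inl (inr (j, c), b) => nt.*2 + c.*2 + (b == c)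
  | inr (i, j) => nt.*2 + i + j
  end.

Definition pair_code : choiceType := (nat + nat * bool)%type.
Definition pairs : seq pair_code :=
  [seq inl i | i <- iota 0 nt] ++
  [seq inr (j, c) | j <- iota 0 nb, c <- [:: false; true]].
Definition snodes : seq (nat * nat) := [seq (i, j) | i <- iota 0 L, j <- iota 0 (tl i).+1].
Definition nodes : seq raw :=
  [seq inl (p, b) | p <- pairs, b <- [:: false; true]] ++ [seq inr x | x <- snodes].

(** Among the height conditions, [bp_sht] and [bp_shtl] match the orientation of the edges,
    [bp_shtn] separates the two children of a string vertex for the rigidity argument, and [bp_top]
    sends [v_2] to the last point. In [bp_tl], a tail that is not a single end has first weight 2,
    because its cycles and its fork have weight 1. *)
Record blueprint_ok : Prop := BlueprintOk {
  bp_nt : 2 <= nt;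
  bp_stp0 : stp 0 = Bk o 1;
  bp_o : 3 <= o;
  bp_odd_o : odd o;
  bp_stp : forall i, 0 < i < nt -> match stp i with
     | Fk d x => 0 < x /\ (d -> x.*2 < W i)
     | Bk x y => [/\ y < W i, odd x & odd y] end;
  bp_b0 : 0 < b0;
  bp_nb : b0 + nb <= nt;
  bp_branch : forall i, b0 <= i < b0 + nb -> stp i = Bk 1 1;
  bp_L : 0 < L;
  bp_tdir0 : tdir 0;
  bp_tl0 : tl 0 = 0;
  bp_tw0 : 2 * o <= tw 0;
  bp_tw : forall i, i < L -> 0 < tw i /\ ~~ odd (tw i);
  bp_tl : forall i, i < L -> 0 < tl i -> odd (tl i) /\ tw i = 2;
  bp_sht : forall i, i.+1 < L ->
    if (0 < flow i.+1)%R then sht i 0 < sht i.+1 0 else sht i.+1 0 < sht i 0;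
  bp_shtl : forall i j, i < L -> j < tl i ->
    if tdir i then sht i j < sht i j.+1 else sht i j.+1 < sht i j;
  bp_shtn : forall i, i.+1 < L -> 0 < tl i -> sht i.+1 0 <> sht i 1;
  bp_top : forall i j, i < L -> j <= tl i -> (i, j) <> (0, 0) -> sht i j < sht 0 0 }.

Hypothesis bok : blueprint_ok.

Lemma mem_TN i b : (TN i b \in nodes) = (i < nt).
Proof.
rewrite mem_cat; apply/orP/idP => [[/allpairsP[[p b'] /= [+ _ [e _]]]|/mapP[] //]|lt_i].
  by rewrite -e mem_cat => /orP[/mapP[i' + [->]]|/allpairsP[[? ?] [_ _ //]]]; rewrite mem_iota.
left; apply/allpairsP; exists (inl i, b); split=> //=; last by case: b.
by rewrite mem_cat; apply/orP; left; apply/mapP; exists i; rewrite ?mem_iota.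
Qed.

Lemma mem_BN j c b : (BN j c b \in nodes) = (j < nb).
Proof.
rewrite mem_cat; apply/orP/idP => [[/allpairsP[[p b'] /= [+ _ [e _]]]|/mapP[] //]|lt_i].
  by rewrite -e mem_cat => /orP[/mapP[]//|/allpairsP[[j' c'] /= [+ _ [-> _]]]]; rewrite mem_iota.
left; apply/allpairsP; exists (inr (j, c), b); split=> //=; last by case: b.
rewrite mem_cat; apply/orP; right; apply/allpairsP; exists (j, c); split=> //=.
  by rewrite mem_iota.
by case: c.
Qed.

Lemma mem_SN i j : (SN i j \in nodes) = (i < L) && (j <= tl i).
Proof.
rewrite mem_cat; apply/orP/andP => [[/allpairsP[[p b'] /= [_ _ //]]|/mapP[[i' j'] + [-> ->]]]|[lt_i lt_j]].
  by move=> /allpairsPdep[i2 [j2 [+ + [-> ->]]]]; rewrite !mem_iota.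
right; apply/mapP; exists (i, j) => //.
by apply/allpairsPdep; exists i, j; split; rewrite ?mem_iota.
Qed.

Definition mem_nodes := (mem_TN, mem_BN, mem_SN).

Lemma nodes_uniq : uniq nodes.
Proof.
rewrite cat_uniq; apply/and3P; split.
- rewrite allpairs_uniq //; last by move=> [p b] [p' b'] _ _ [-> ->].
  rewrite cat_uniq map_inj_uniq ?iota_uniq; last by move=> i j [].
  rewrite allpairs_uniq ?iota_uniq //; last by move=> [p b] [p' b'] _ _ [-> ->].
  rewrite andbT; apply/hasPn => _ /allpairsP[[j c] [_ _ ->]].
  by apply/negP => /mapP[].
- apply/hasPn => _ /mapP[x _ ->]; by apply/negP => /allpairsP[[p b] [_ _]].
- rewrite map_inj_uniq; last by move=> x y [].
  rewrite allpairs_uniq_dep ?iota_uniq // => [i|]; first by rewrite iota_uniq.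
  by move=> [i j] [i' j'] _ _ [-> ->].
Qed.

Lemma flowS i : flow i.+1 = (flow i + (if tdir i then - (tw i)%:Z else (tw i)%:Z))%R.
Proof. by rewrite /flow big_ord_recr addrA. Qed.

Lemma flow0 : flow 0 = ((2 * o)%:Z - 1)%R.
Proof. by rewrite /flow big_ord0 addr0. Qed.

(** The flow starts at [2 o - 1] and changes by even amounts. In particular it never vanishes, so
    every string edge has positive weight and a definite orientation. *)
Lemma flow_odd i : i <= L -> exists k : int, flow i = (k * 2 + 1)%R.
Proof.
elim: i => [|i IH] lt_i; first by exists (o%:Z - 1)%R; rewrite flow0; lia.
have [k fk] := IH (ltnW lt_i); have [_ ev] := bp_tw bok lt_i.
by exists (if tdir i then k - (tw i)./2%:Z else k + (tw i)./2%:Z)%R; rewrite flowS fk; case: ifP; lia.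
Qed.

(** This makes the next string edge at [v_2] incoming, as a properly mixed cover demands. *)
Lemma flow1_lt0 : (flow 1 < 0)%R.
Proof.
rewrite flowS flow0 (bp_tdir0 bok); have := bp_tw0 bok; lia.
Qed.

Lemma stp_gt0 i : 0 < i -> i < nt -> match stp i with
     | Fk d x => 0 < x /\ (d -> x.*2 < W i)
     | Bk x y => [/\ y < W i, odd x & odd y] end.
Proof. by move=> h1 h2; apply: (bp_stp bok); rewrite h1. Qed.

Lemma WS i : 0 < i -> W i.+1 = next_weight (stp i) (W i).
Proof. by case: i. Qed.

Lemma W_odd i : i <= nt -> odd (W i).
Proof.
elim: i => [|i IH] le_i; first exact: bp_odd_o bok.
case: (posnP i) => [->//|i0]; rewrite WS //.
have {}IH := IH (ltnW le_i).
have := stp_gt0 i0 le_i; case: (stp i) => [[] x|x y] /= [h1 h2]; lia.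
Qed.

Lemma main_weight_gt0 i : i < nt -> 0 < main_weight i.
Proof.
case: (posnP i) => [->|i0] lt_i; rewrite /main_weight.
  by rewrite (bp_stp0 bok) /=; have := bp_o bok; lia.
have := stp_gt0 i0 lt_i; have := W_odd (ltnW lt_i).
case: (stp i) => [[] x|x y] /= oW [h1 h2]; lia.
Qed.

Lemma main_weight_odd i : i < nt -> odd (main_weight i).
Proof.
case: (posnP i) => [->|i0] lt_i.
  by rewrite /main_weight (bp_stp0 bok) /=; have := bp_o bok; have := bp_odd_o bok; lia.
by rewrite /main_weight -WS // W_odd.
Qed.

Lemma TN_eq i b i' b' : (TN i b == TN i' b') = (i == i') && (b == b').
Proof. by []. Qed.

Lemma ent0 : ent 0 = false. Proof. by rewrite /ent (bp_stp0 bok). Qed.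

Lemma raw_children x b y : x \in nodes -> ~~ (rdbl x && b) -> rch x b = Some y ->
    [/\ y \in nodes, y != TN 0 false, (rpar y).1 = x &
        if rdbl y then ~~ rdbl x /\ rch x (~~ b) = Some y else (rpar y).2 = b].
Proof.
case: x => [[[i|[j c]] b']|[i j]]; rewrite -/(TN _ _) -/(BN _ _ _) -/(SN _ _) mem_nodes.
- move=> lt_i _ /=.
  have H c : outb i = c -> 0 < i -> nxt i = Some y ->
      [/\ y \in nodes, y != TN 0 false, (rpar y).1 = TN i c, rdbl y = false & (rpar y).2 = false].
    move=> <- i0; rewrite /nxt; case: ifP => // lt_i1 [<-]; rewrite mem_nodes lt_i1 /= eqxx.
    by case: i i0 {lt_i lt_i1}.
  case: (posnP i) lt_i H => [->|i0] lt_i H.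
    rewrite (bp_stp0 bok); case: b'; case: b => //.
    + by move=> [<-]; rewrite mem_nodes (bp_L bok).
    + rewrite /nxt; case: ifP => // lt_1 [<-]; rewrite mem_nodes lt_1 /= eqxx.
      by split.
    + by move=> [<-]; rewrite mem_nodes lt_i /= ent0 (bp_stp0 bok).
  have ni0 : (i == 0) = false by apply/eqP; lia.
  case E: (stp i) => [d x|x y'].
    case: eqP => // ->; case: b => [[<-]|nx].
      rewrite mem_nodes lt_i TN_eq ni0 /= /ent E; split=> //; by case: d {E}.
    by have [|-> -> -> -> ->] := H (~~ d) _ isT nx; rewrite /outb ?E.
  case: b'; case: b => //.
  + have -> : (if i is 0 then Some (SN 0 0) else nxt i) = nxt i by case: (i) i0.
    by move=> nx; have [|-> -> -> -> ->] := H true _ isT nx; rewrite /outb ?E.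
  + have -> : (if i is 0 then nxt 0 else if b0 <= i < b0 + nb then Some (BN (i - b0) false true) else None)
      = if b0 <= i < b0 + nb then Some (BN (i - b0) false true) else None by case: (i) i0.
    case: ifP => // /andP[h1 h2] [<-]; rewrite mem_nodes /= subnKC //; split=> //; first by lia.
  + by move=> [<-]; rewrite mem_nodes lt_i TN_eq ni0 /= /ent E.
- move=> lt_j _ /=; case: eqP => // ->; case: b => [[<-]|].
    by rewrite mem_nodes lt_j /=; case: c.
  by case: c => // -[<-]; rewrite mem_nodes lt_j.
- move=> /andP[lt_i le_j]; case: j le_j => [|j] le_j va /=.
    case: b {va}; last first.
      case: ifP => // lt_i1 [<-]; rewrite mem_nodes lt_i1 /=; by split.
    case E: (tl i) => [//|k] [<-]; rewrite mem_nodes lt_i E /=; by split.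
  case: eqP => // ne [<-]; rewrite mem_nodes lt_i /= ltn_neqAle le_j andbT.
  split=> //; first by apply/eqP.
  by move: va; rewrite /= !negbK; case: (odd j) => //=; case: b.
Qed.

Lemma raw_parents y : y \in nodes -> y != TN 0 false ->
    [/\ (rpar y).1 \in nodes, ~~ (rdbl (rpar y).1 && (rpar y).2),
        rch (rpar y).1 (rpar y).2 = Some y & rlev (rpar y).1 < rlev y].
Proof.
have nt0 : 0 < nt by have := bp_nt bok; lia.
case: y => [[[i|[j c]] b]|[i j]]; rewrite -/(TN _ _) -/(BN _ _ _) -/(SN _ _) mem_nodes.
- move=> lt_i; rewrite TN_eq /=; case: (b =P ent i) => [->|nb] ne.
    case: i lt_i ne => [|[|i]] lt_i ne; first by rewrite ent0 in ne.
      rewrite mem_nodes nt0 /= (bp_stp0 bok) /nxt lt_i ent0 /=; split=> //; by lia.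
    rewrite mem_nodes (ltnW lt_i) /= /nxt lt_i /outb; split=> //.
      by case: (stp i.+1) => [d x|x y] //; rewrite eqxx.
    by lia.
  rewrite mem_nodes lt_i /= eqxx; split=> //.
    move: nb; rewrite /ent; case: (stp i) => [d x|x y]; last by case: (b).
    by rewrite eqxx; case: d; case: (b).
  by case: (b) (ent i) nb => [] [] //= _; lia.
- move=> lt_j _ /=; case: eqP => [->|nb].
    case: c; rewrite mem_nodes ?lt_j //=.
      by split=> //; lia.
    have lt_bj : b0 <= b0 + j < b0 + nb by lia.
    have lt_nt : b0 + j < nt by have := bp_nb bok; lia.
    rewrite lt_nt (bp_branch bok lt_bj); split=> //.
      have := bp_b0 bok; case E: (b0 + j) => [|k]; first by lia.
      by rewrite -E lt_bj addKn.
    by lia.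
  rewrite mem_nodes lt_j /= eqxx; split=> //.
    by case: (b) (c) nb => [] [].
  by case: (b) (c) nb => [] [] //=; lia.
- move=> /andP[lt_i le_j] _; case: j le_j => [|[|j]] le_j /=.
  + case: i lt_i {le_j} => [|i] lt_i.
      rewrite mem_nodes nt0 /= (bp_stp0 bok); split=> //.
      by lia.
    rewrite mem_nodes (ltnW lt_i) /= lt_i; split=> //; by lia.
  + rewrite mem_nodes lt_i /=; split=> //; last by lia.
    by case: (tl i) le_j.
  + rewrite mem_nodes lt_i (ltnW le_j) /= andbF; split=> //; last by lia.
    by case: eqP => // e; lia.
Qed.

Lemma stp_pos i : i < nt ->
  match stp i with Fk d x => is_true (0 < x) | Bk x y => [/\ 0 < x, 0 < y & y < W i] end.
Proof.
case: (posnP i) => [->|i0] lt_i.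
  by rewrite (bp_stp0 bok) /=; have := bp_o bok; split; lia.
have := stp_gt0 i0 lt_i; case: (stp i) => [d x []//|x y [lt_y ox oy]].
by split=> //; apply: odd_gt0.
Qed.

Lemma parent_entry i : 0 < i -> i < nt ->
  exists p b, [/\ rpar (TN i (ent i)) = (p, b), ru p b & rw p b = W i].
Proof.
case: i => [//|[|i]] _ lt_i; rewrite /= eqxx.
  by exists (TN 0 false), true; rewrite /= (bp_stp0 bok).
exists (TN i.+1 (outb i.+1)), false; split=> //=; rewrite /outb.
  by case: (stp i.+1) => [d x|x y] //; rewrite eqxx.
by rewrite /main_weight; case: (stp i.+1) => [d x|x y] //; rewrite eqxx.
Qed.

Lemma parent_string i : i < L ->
  exists p b, [/\ rpar (SN i 0) = (p, b), ru p b = (0 < flow i)%R & rw p b = `|flow i|%N].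
Proof.
case: i => [|i] lt_i /=; last by exists (SN i 0), false.
exists (TN 0 true), false; rewrite /= (bp_stp0 bok) flow0 /main_weight (bp_stp0 bok) /=.
by have := bp_o bok; split=> //; lia.
Qed.

Lemma raw_balanced x : x \in nodes -> x != TN 0 false -> ~~ rdbl x ->
     let: (p, b) := rpar x in
     (ru p b * rw p b + (~~ ru x false) * rw x false + (~~ ru x true) * rw x true =
     (~~ ru p b) * rw p b + ru x false * rw x false + ru x true * rw x true)%N.
Proof.
case: x => [[[i|[j c]] b]|[i j]]; rewrite -/(TN _ _) -/(BN _ _ _) -/(SN _ _) mem_nodes.
- move=> lt_i; rewrite TN_eq; have sp := stp_pos lt_i; case: (b =P ent i) => [->|nb] ne _.
    have i0 : 0 < i by case: (posnP i) ne => // ->; rewrite ent0.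
    have [p [b' [-> -> ->]]] := parent_entry i0 lt_i.
    have := stp_gt0 i0 lt_i; rewrite /= /ent /main_weight; case: (stp i) sp => [d x|x y] sp h.
      by rewrite eqxx; case: d h => /= -[x0 h]; [have := h isT; lia | lia].
    by case: sp => x0 y0 lt_y; rewrite /=; lia.
  have -> : rpar (TN i b) = (TN i (ent i), if stp i is Fk _ _ then true else false).
    by rewrite /=; move/eqP: nb => /negbTE ->.
  move: nb; rewrite /= /ent /main_weight; case: (stp i) sp => [d x|x y] sp /= nb.
    have -> : b = d by case: (b) d nb {sp} => [] [].
    by rewrite eqxx; case: d {nb} => /=; lia.
  by case: sp => x0 y0 lt_y; case: b {ne} nb => //= _; lia.
- move=> lt_j _ _; have lt_bj : b0 <= b0 + j < b0 + nb by lia.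
  by case: b c => [] [] //=; rewrite (bp_branch bok lt_bj).
- move=> /andP[lt_i le_j] _; case: j le_j => [|[|j]] le_j nd.
  + have [p [b' [-> -> ->]]] := parent_string lt_i.
    by rewrite /= flowS; case: (tdir i); lia.
  + by rewrite /=; have [_ ->] := bp_tl bok lt_i le_j; case: (tdir i).
  + by move: nd; rewrite /= !negbK => ->; case: (tdir i).
Qed.

Lemma rawtree_ok_data : raw_ok nodes (TN 0 false) o rch ru rw rpar rdbl rlev.
Proof.
have nt0 : 0 < nt by have := bp_nt bok; lia.
split.
- exact: nodes_uniq.
- by rewrite mem_nodes.
- exact: raw_children.
- exact: raw_parents.
- by [].
- by have := bp_o bok; lia.
- case=> [[[i|[j c]] b']|[i j]] b; rewrite -/(TN _ _) -/(BN _ _ _) -/(SN _ _) mem_nodes.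
  + move=> lt_i _ /=; have mw := main_weight_gt0 lt_i; have := stp_pos lt_i.
    case: (stp i) => [d x x0|x y [x0 y0 lt_y]].
      by case: ifP => _; case: (b) => //; rewrite double_gt0.
    by case: (b'); case: (b); rewrite // subn_gt0.
  + by move=> lt_j _ /=; case: ifP; case: (b); case: (c).
  + move=> /andP[lt_i le_j] va /=; case: j le_j {va} => [|j] le_j; last by case: ifP.
    have [z0 _] := bp_tw bok lt_i; case: (b) => //.
    by have [k ->] := flow_odd lt_i; lia.
- rewrite /= (bp_stp0 bok) /=; have := bp_o bok; lia.
- exact: raw_balanced.
- case=> [[[i|[j c]] b']|[i j]] //; case: j => [|[|j]] // _ /=.
  by rewrite !negbK; case: (odd j) => // _; case: (tdir i).
Qed.

End Concrete.

(** * Positions obtained from height-preserving permutations of codes *)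

Section CodePositions.
Variables (K : choiceType) (s : seq K) (ht : K -> nat).
Hypothesis us : uniq s.
Notation P := (seq_sub s).
Definition code_ht (p : P) : nat := ht (ssval p).
Variable pi : {perm P}.
Hypothesis pi_ht : pi \in layer_perms code_ht.

Definition code_pos (k : K) : nat :=
  if insub k is Some p then layer_pos code_ht (pi p) else 0.

Lemma code_posE (p : P) : code_pos (ssval p) = layer_pos code_ht (pi p).
Proof. by rewrite /code_pos (valK p). Qed.

Lemma card_codes : #|{: P}| = size s.
Proof.
rewrite cardE -(size_map val); apply: perm_size; apply: uniq_perm => //.
  by rewrite map_inj_uniq ?enum_uniq //; apply: val_inj.
move=> x; apply/mapP/idP => [[u _ ->]|xn]; first exact: ssvalP.
by exists (SeqSub xn); rewrite ?mem_enum.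
Qed.

Lemma code_pos_lt k : k \in s -> code_pos k < size s.
Proof. by move=> ks; rewrite (code_posE (SeqSub ks)) -card_codes layer_pos_lt. Qed.

Lemma code_pos_inj : {in s &, injective code_pos}.
Proof.
move=> k k' ks ks'; rewrite (code_posE (SeqSub ks)) (code_posE (SeqSub ks')).
by move=> /layer_pos_inj/perm_inj[].
Qed.

Lemma code_pos_mono k k' : k \in s -> k' \in s -> ht k < ht k' -> code_pos k < code_pos k'.
Proof.
move=> ks ks' h; rewrite (code_posE (SeqSub ks)) (code_posE (SeqSub ks')).
by apply: layer_pos_mono; rewrite !(layer_permsP _ _ pi_ht).
Qed.

Lemma code_pos_onto i : i < size s -> exists2 k, k \in s & code_pos k = i.
Proof.
move=> lt_i; pose f (p : P) : 'I_(size s) := Ordinal (code_pos_lt (ssvalP p)).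
have inj_f : injective f.
  move=> p q /(congr1 val) /= /code_pos_inj e; apply: val_inj.
  by apply: e; apply: ssvalP.
have := inj_card_onto inj_f; rewrite card_ord card_codes leqnn => /(_ isT).
move=> /(_ (Ordinal lt_i)) /codomP[p /(congr1 val) /= ->].
by exists (ssval p); first exact: ssvalP.
Qed.

Lemma code_pos_min k : k \in s -> (forall k', k' \in s -> k' != k -> ht k < ht k') -> code_pos k = 0.
Proof.
move=> ks hk; have [k' ks' e] := code_pos_onto (leq_ltn_trans (leq0n _) (code_pos_lt ks)).
have [<-//|ne] := eqVneq k' k.
by have := code_pos_mono ks ks' (hk _ ks' ne); rewrite e.
Qed.

Lemma code_pos_max k : k \in s -> (forall k', k' \in s -> k' != k -> ht k' < ht k) ->
  code_pos k = (size s).-1.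
Proof.
move=> ks hk; have lt_k := code_pos_lt ks.
have [k' ks' e] := @code_pos_onto (size s).-1 ltac:(lia).
have [<-//|ne] := eqVneq k' k.
have := code_pos_mono ks' ks (hk _ ks' ne); lia.
Qed.

End CodePositions.

(** * Positions and pair forms in the blueprint tree *)

Section ConcreteCover.
Variable B : blueprint.
Hypothesis bok : blueprint_ok B.
Notation nt := (nt B).
Notation nb := (nb B).
Notation b0 := (b0 B).
Notation L := (nl B).
Notation o := (bo B).
Notation stp := (stp B).
Notation tl := (tl B).
Notation tdir := (tdir B).
Notation tw := (tw B).
Notation sht := (sht B).
Notation nodes := (nodes B).
Notation pairs := (pairs B).
Notation snodes := (snodes B).

(** Each trunk pair is a layer of its own, so the trunk order is rigid. All merging pairs form the
    layer [nt] and all splitting pairs the layer [nt + 1], which puts every branch after the whole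
    trunk. *)
Definition pair_ht (p : pair_code) : nat :=
  match p with inl i => i | inr (j, c) => nt + c end.
Definition string_ht (x : nat * nat) : nat := sht x.1 x.2.

Lemma mem_pairs_inl i : (inl i \in pairs) = (i < nt).
Proof.
rewrite mem_cat; apply/orP/idP => [[/mapP[i' + [->]]|/allpairsP[[? ?] [_ _ //]]]|lt_i].
  by rewrite mem_iota.
by left; apply/mapP; exists i; rewrite ?mem_iota.
Qed.

Lemma mem_pairs_inr j c : (inr (j, c) \in pairs) = (j < nb).
Proof.
rewrite mem_cat; apply/orP/idP => [[/mapP[]//|/allpairsP[[j' c'] /= [+ _ [-> _]]]]|lt_j].
  by rewrite mem_iota.
right; apply/allpairsP; exists (j, c); split; rewrite ?mem_iota //.
by case: c.
Qed.

Lemma mem_snodes i j : ((i, j) \in snodes) = (i < L) && (j <= tl i).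
Proof.
apply/allpairsPdep/andP => [[i2 [j2 [+ + [-> ->]]]]|[lt_i lt_j]]; first by rewrite !mem_iota.
by exists i, j; split; rewrite ?mem_iota.
Qed.

Lemma mem_nodes_inl p b : ((inl (p, b) : raw) \in nodes) = (p \in pairs).
Proof.
by case: p => [i|[j c]]; rewrite ?mem_pairs_inl ?mem_pairs_inr; [apply: mem_TN | apply: mem_BN].
Qed.

Lemma mem_nodes_inr x : ((inr x : raw) \in nodes) = (x \in snodes).
Proof. by case: x => i j; rewrite mem_snodes; apply: mem_SN. Qed.

Lemma pairs_uniq : uniq pairs.
Proof.
rewrite cat_uniq map_inj_uniq ?iota_uniq; last by move=> i j [].
rewrite allpairs_uniq ?iota_uniq //; last by move=> [p b] [p' b'] _ _ [-> ->].
rewrite andbT; apply/hasPn => _ /allpairsP[[j c] [_ _ ->]].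
by apply/negP => /mapP[].
Qed.

Lemma snodes_uniq : uniq snodes.
Proof.
rewrite allpairs_uniq_dep ?iota_uniq // => [i|]; first by rewrite iota_uniq.
by move=> [i j] [i' j'] _ _ [-> ->].
Qed.

Lemma size_pairs : size pairs = nt + nb.*2.
Proof. by rewrite size_cat size_map size_iota size_allpairs size_iota /= muln2. Qed.

Definition npairs : nat := size pairs.
Definition nstring : nat := size snodes.

Lemma size_nodes : size nodes = (size pairs).*2 + size snodes.
Proof. by rewrite size_cat size_allpairs size_map muln2. Qed.

Variables (pi1 : {perm seq_sub pairs}) (pi2 : {perm seq_sub snodes}).
Hypothesis pi1_ht : pi1 \in layer_perms (code_ht pair_ht (s := pairs)).
Hypothesis pi2_ht : pi2 \in layer_perms (code_ht string_ht (s := snodes)).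

Notation s := npairs.
Notation t := nstring.
Definition posP (p : pair_code) : nat := code_pos pair_ht pi1 p.
Definition posQ (x : nat * nat) : nat := code_pos string_ht pi2 x.

Lemma posP_lt p : p \in pairs -> posP p < s.
Proof. exact: (code_pos_lt pair_ht pairs_uniq pi1). Qed.
Lemma posQ_lt x : x \in snodes -> posQ x < t.
Proof. exact: (code_pos_lt string_ht snodes_uniq pi2). Qed.
Lemma posP_inj : {in pairs &, injective posP}.
Proof. exact: code_pos_inj. Qed.
Lemma posQ_inj : {in snodes &, injective posQ}.
Proof. exact: code_pos_inj. Qed.
Lemma posP_mono p p' : p \in pairs -> p' \in pairs -> pair_ht p < pair_ht p' -> posP p < posP p'.
Proof. exact: code_pos_mono. Qed.
Lemma posQ_mono x x' : x \in snodes -> x' \in snodes -> string_ht x < string_ht x' -> posQ x < posQ x'.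
Proof. exact: code_pos_mono. Qed.

(** Permuting pairs rather than vertices keeps the two vertices of a pair on consecutive points, as
    the trivial distribution requires; the string vertices fill the remaining points. *)
Definition rpos (x : raw) : nat :=
  match x with
  | inl (p, b) => (posP p).*2 + b
  | inr x => s.*2 + posQ x
  end.

Definition ctree : ztree := rawtree (rawtree_ok_data bok).
Definition cpos (u : node ctree) : nat := rpos (ssval u).

Lemma ctree_ok : ztree_ok ctree. Proof. exact: rawtree_ok. Qed.

Lemma rpos_lt x : x \in nodes -> rpos x < s.*2 + t.
Proof.
case: x => [[p b]|x]; rewrite ?mem_nodes_inl ?mem_nodes_inr => h /=.
  by have := posP_lt h; have := leq_b1 b; lia.
by have := posQ_lt h; lia.
Qed.

Lemma rpos_low p b : p \in pairs -> rpos (inl (p, b)) < s.*2.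
Proof. by move=> h /=; have := leq_b1 b; have := posP_lt h; have := leq_b1 b; lia. Qed.

Lemma rpos_inj : {in nodes &, injective rpos}.
Proof.
case=> [[p b]|x]; case=> [[p' b']|x']; rewrite ?mem_nodes_inl ?mem_nodes_inr => h h' /= e.
- have [e1 ->] : posP p = posP p' /\ b = b' by case: b b' e => [] [] /= e; (split=> //; lia) || (exfalso; lia).
  by rewrite (posP_inj h h' e1).
- by have := posP_lt h; have := leq_b1 b; lia.
- by have := posP_lt h'; have := leq_b1 b'; lia.
- by have e1 : posQ x = posQ x' by [lia]; rewrite (posQ_inj h h' e1).
Qed.

Lemma rpos_pair p p' b b' : p \in pairs -> p' \in pairs -> pair_ht p < pair_ht p' ->
  rpos (inl (p, b)) < rpos (inl (p', b')).
Proof. by move=> h h' /(posP_mono h h') /=; have := leq_b1 b; lia. Qed.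

Lemma rpos_string x x' : x \in snodes -> x' \in snodes -> string_ht x < string_ht x' ->
  rpos (inr x) < rpos (inr x').
Proof. by move=> h h' /(posQ_mono h h') /=; lia. Qed.

Lemma rpos_mono x b y : x \in nodes -> ~~ (rdbl x && b) -> rch B x b = Some y ->
  if ru B x b then rpos x < rpos y else rpos y < rpos x.
Proof.
move=> xn va ch; have [yn _ _ _] := raw_children bok xn va ch.
case: x xn va ch => [[[i|[j c]] b']|[i j]]; rewrite -/(TN _ _) -/(BN _ _ _) -/(SN _ _) mem_nodes.
- move=> lt_i _ /=.
  have pi : inl i \in pairs by rewrite mem_pairs_inl.
  have H c : nxt B i = Some y -> rpos (TN i c) < rpos y.
    rewrite /nxt; case: ifP => // lt_i1 [<-].
    by apply: rpos_pair => //; rewrite ?mem_pairs_inl //=.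
  case E: (stp i) => [d x|x y'].
    case: eqP => // ->; case: b => [[<-]|nx]; last exact: H.
    by case: d {E} => /=; lia.
  case: b'; case: b => //.
  + case: i lt_i pi H {E} => [|i] lt_i pi H; last exact: H.
    by move=> [<-]; have := rpos_low true pi; rewrite /=; lia.
  + case: i lt_i pi H {E} => [|i] lt_i pi H; first exact: H.
    case: ifP => // /andP[h1 h2] [ey]; rewrite -ey mem_nodes in yn *.
    by apply: rpos_pair => //; rewrite ?mem_pairs_inr //= addn0.
  + by move=> [<-] /=; lia.
- move=> lt_j _ /=; case: eqP => // ->; case: b => [[<-]|].
    by case: c => /=; lia.
  case: c => // -[<-]; apply: rpos_pair; rewrite ?mem_pairs_inr //=; lia.
- move=> /andP[lt_i le_j]; case: j le_j => [|j] le_j va /=.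
    case: b {va}; last first.
      case: ifP => // lt_i1 [<-]; have := bp_sht bok lt_i1.
      by case: ifP => _ h; apply: rpos_string; rewrite ?mem_snodes ?lt_i ?lt_i1 //=.
    case E: (tl i) => [//|k] [<-]; have := @bp_shtl _ bok i 0 lt_i; rewrite E => /(_ isT).
    by case: ifP => _ h; apply: rpos_string; rewrite ?mem_snodes ?lt_i ?E //=.
  case: eqP => // ne [<-]; have lt_j : j.+1 < tl i by lia.
  have := bp_shtl bok lt_i lt_j.
  by case: ifP => _ h; apply: rpos_string; rewrite ?mem_snodes ?lt_i ?(ltnW lt_j) //=.
Qed.

Notation N := (node ctree).

Lemma cchildP (u v : N) b : rvalid (Some (u, b)) ->
  child u b = Some v <-> rch B (ssval u) b = Some (ssval v).
Proof. exact: rawchildP. Qed.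

Lemma cchildN (u : N) b : rvalid (Some (u, b)) -> rch B (ssval u) b = None -> child u b = None.
Proof.
by move=> va h; apply/eqP; rewrite (rawchildN (rawtree_ok_data bok)) // h.
Qed.

Lemma cpar_eq (u p : N) b : ssval u != TN 0 false -> rpar B (ssval u) = (ssval p, b) ->
  par u = (p, b).
Proof.
move=> nr e; rewrite (surjective_pairing (par u)); congr pair; last by rewrite /= /rawpar e.
by apply: val_inj; rewrite [val _](rawparP (rawtree_ok_data bok) nr) e.
Qed.

Lemma cpos_ok : @pos_ok ctree cpos s t.
Proof.
split.
- by move=> u v e; apply: val_inj; apply: rpos_inj; rewrite ?ssvalP.
- by move=> u; apply: rpos_lt; apply: ssvalP.
- by rewrite card_codes ?nodes_uniq // size_nodes.
move=> u b v va /(cchildP _ va) ch.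
exact: rpos_mono (ssvalP u) va ch.
Qed.

(** The zigzag subgraph contains all vertices over the pairs and the spine [SN i 0] of the string;
    what hangs off the spine is a tail. *)
Definition inS (x : raw) : bool := if x is inr (_, j) then j == 0 else true.
Definition core_node (u : N) : bool := inS (ssval u).

Lemma rin_root : rin (root : N) = None :: (if ru B (TN 0 false) false then [::] else [:: Some (root, false)])
  ++ (if ru B (TN 0 false) true then [::] else [:: Some (root, true)]).
Proof. exact: rin_rootE (ok_root ctree_ok). Qed.

Lemma rout_root : rout (root : N) = (if ru B (TN 0 false) false then [:: Some (root, false)] else [::])
  ++ (if ru B (TN 0 false) true then [:: Some (root, true)] else [::]).
Proof. exact: rout_rootE (ok_root ctree_ok). Qed.

Lemma crin (u p : N) b : ~~ rdbl (ssval u) -> ssval u != TN 0 false ->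
  rpar B (ssval u) = (ssval p, b) -> rin u =
  (if ru B (ssval p) b then [:: Some (p, b)] else [::]) ++
  (if ru B (ssval u) false then [::] else [:: Some (u, false)]) ++
  (if ru B (ssval u) true then [::] else [:: Some (u, true)]).
Proof. by move=> nd nr e; rewrite rin_nondbl // (cpar_eq nr e). Qed.

Lemma crout (u p : N) b : ~~ rdbl (ssval u) -> ssval u != TN 0 false ->
  rpar B (ssval u) = (ssval p, b) -> rout u =
  (if ru B (ssval p) b then [::] else [:: Some (p, b)]) ++
  (if ru B (ssval u) false then [:: Some (u, false)] else [::]) ++
  (if ru B (ssval u) true then [:: Some (u, true)] else [::]).
Proof. by move=> nd nr e; rewrite rout_nondbl // (cpar_eq nr e). Qed.

(** [en] is the vertex on the path through the pair, [fk] the vertex carrying the fork. For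
    [d = true] the fork lies above and the form is (A'), for [d = false] it lies below and the form
    is (A). *)
Lemma pair_form_fork (en fk p : N) b d :
  ~~ rdbl (ssval fk) -> ssval fk != TN 0 false -> rpar B (ssval fk) = (ssval en, true) ->
  ~~ rdbl (ssval en) -> ssval en != TN 0 false -> rpar B (ssval en) = (ssval p, b) ->
  ru B (ssval p) b -> (forall b', ru B (ssval fk) b' = d) ->
  (forall b', rch B (ssval fk) b' = None) -> rw B (ssval fk) false = rw B (ssval fk) true ->
  ru B (ssval en) true = d -> ru B (ssval en) false = true ->
  if d then pair_form en fk else pair_form fk en.
Proof.
move=> ndf nrf pf nde nre pe up1 uf cf wf ue1 ue2.
have vaf b' : rvalid (Some (fk, b')) by rewrite /= (negbTE ndf).
have chf b' : child fk b' = None by apply: cchildN.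
case: d uf ue1 => uf ue1.
  apply: (@PairA' _ _ _ (Some (en, true))) => //.
  - by rewrite (crin nde nre pe) up1 ue1 ue2.
  - by rewrite /= (ue1 : ru B (ssval en) true = true).
  - by rewrite (crin ndf nrf pf) ue1 !uf.
  - by rewrite (crout ndf nrf pf) ue1 !uf.
apply: (@PairA _ _ _ (Some (en, true))) => //.
- by rewrite (crin ndf nrf pf) ue1 !uf.
- by rewrite (crout ndf nrf pf) ue1 !uf.
- by rewrite /= (ue1 : ru B (ssval en) true = false).
- by rewrite (crin nde nre pe) up1 ue1 ue2.
Qed.

Lemma pair_form_through (u v : N) :
  ~~ rdbl (ssval v) -> ssval v != TN 0 false -> rpar B (ssval v) = (ssval u, false) ->
  u != v -> size (rin u) = 1 -> ru B (ssval u) false ->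
  rout u = [:: Some (u, false); Some (u, true)] ->
  ru B (ssval v) false = true -> ru B (ssval v) true = false -> pair_form u v.
Proof.
move=> ndv nrv pv nuv sz ru1 ro uv1 uv2.
have rv : rin v = [:: Some (u, false); Some (v, true)].
  by rewrite (crin ndv nrv pv) ru1 uv1 uv2.
apply: (@PairB _ _ _ (Some (u, false))) => //.
- by rewrite ro inE eqxx.
- by rewrite rv inE eqxx.
- move=> f; rewrite ro !inE => /orP[/eqP -> //|/eqP ->]; rewrite rv !inE => /orP[/eqP[]//|/eqP[e]].
  by rewrite e eqxx in nuv.
- by rewrite rv.
Qed.

Lemma node_neq (u v : N) : (u == v) = (ssval u == ssval v).
Proof. by []. Qed.

Lemma cpair_form (u v : N) p : ssval u = inl (p, false) -> ssval v = inl (p, true) -> pair_form u v.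
Proof.
move=> eu ev; have un := ssvalP u; have vn := ssvalP v.
have pin : p \in pairs by rewrite eu mem_nodes_inl in un.
case: p eu ev pin => [i|[j c]] eu ev pin.
- rewrite mem_pairs_inl in pin.
  have forkcase d (en fk : N) x : stp i = Fk d x -> ssval en = TN i (~~ d) -> ssval fk = TN i d ->
      if d then pair_form en fk else pair_form fk en.
    move=> E een efk.
    have i0 : 0 < i by case: (posnP i) E => // ->; rewrite (bp_stp0 bok).
    have entE : ent B i = ~~ d by rewrite /ent E.
    have [p [b [pe pu _]]] := parent_entry bok i0 pin.
    have pn : p \in nodes.
      have := raw_parents bok (y := TN i (ent B i)); rewrite mem_TN TN_eq pe => /(_ pin) [] //.
      by apply/negP => /andP[/eqP h _]; rewrite h in i0.
    have nr b' : TN i b' != TN 0 false by rewrite TN_eq; case: (i) i0.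
    apply: (@pair_form_fork en fk (SeqSub pn) b); rewrite ?een ?efk //=.
    + by rewrite entE E; case: (d).
    + by rewrite -entE.
    + by move=> b'; rewrite E; case: (d).
    + by move=> b'; rewrite E; case: (d).
    + by rewrite E; case: (d).
    + by rewrite E eqxx.
    + by rewrite E eqxx.
  case E: (stp i) => [[] x|x y].
  + exact: (forkcase true u v x E eu ev).
  + exact: (forkcase false v u x E ev eu).
  have entE : ent B i = false by rewrite /ent E.
  have [sz ro] : size (rin u) = 1 /\ rout u = [:: Some (u, false); Some (u, true)].
    have [i0|i0] := posnP i.
      have -> : u = root by apply: val_inj; rewrite [val u]eu i0.
      by rewrite rin_root rout_root /= (bp_stp0 bok).
    have [p [b [pe pu _]]] := parent_entry bok i0 pin.
    have nr : TN i (ent B i) != TN 0 false by rewrite TN_eq; case: (i) i0.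
    have pn : p \in nodes.
      by have := raw_parents bok (y := TN i (ent B i)); rewrite mem_TN pe => /(_ pin nr) [].
    have e : rpar B (ssval u) = (ssval (SeqSub pn), b) by rewrite eu; move: pe; rewrite entE.
    have nr' : ssval u != TN 0 false by rewrite eu; move: nr; rewrite entE.
    have nd : ~~ rdbl (ssval u) by rewrite eu.
    by rewrite (crin nd nr' e) (crout nd nr' e) [ru _ _ _]pu eu /= E.
  apply: pair_form_through => //; rewrite ?ev ?eu -?/(TN i _) ?TN_eq ?andbF //=.
  + by rewrite entE E.
  + by rewrite node_neq eu ev -/(TN i false) -/(TN i true) TN_eq andbF.
  + by rewrite E.
  + by rewrite E.
  + by rewrite E.
- rewrite mem_pairs_inr in pin.
  have forkcase (en fk : N) : ssval en = BN j c (~~ c) -> ssval fk = BN j c c ->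
      if c then pair_form en fk else pair_form fk en.
    move=> een efk.
    have lt_bj : b0 <= b0 + j < b0 + nb by lia.
    have [p [b [pe pu]]] : exists p b, rpar B (BN j c (~~ c)) = (p, b) /\ ru B p b.
      rewrite /= eqxx; case: (c); first by exists (BN j false true), false.
      by exists (TN (b0 + j) false), true; rewrite /= (bp_branch bok lt_bj).
    have pn : p \in nodes.
      have := raw_parents bok (y := BN j c (~~ c)); rewrite mem_BN pe => /(_ pin isT) [] //.
    apply: (@pair_form_fork en fk (SeqSub pn) b); rewrite ?een ?efk //=.
    + by case: (c).
    + by move=> b'; case: (c).
    + by move=> b'; case: (c).
    + by case: (c).
    + by rewrite eqxx.
    + by rewrite eqxx.
  case: c eu ev forkcase => eu ev forkcase; exact: forkcase.
Qed.

End ConcreteCover.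

(** * Zigzag conditions for the blueprint tree *)

Section ConcreteZigzag.
Variable B : blueprint.
Hypothesis bok : blueprint_ok B.
Notation nt := (nt B).
Notation nb := (nb B).
Notation b0 := (b0 B).
Notation L := (nl B).
Notation o := (bo B).
Notation stp := (stp B).
Notation tl := (tl B).
Notation tdir := (tdir B).
Notation tw := (tw B).
Notation sht := (sht B).
Notation nodes := (nodes B).
Notation pairs := (pairs B).
Notation snodes := (snodes B).
Notation s := (npairs B).
Notation t := (nstring B).
Notation T := (ctree bok).
Notation N := (node T).

Lemma nt_gt0 : 0 < nt. Proof. by have := bp_nt bok; lia. Qed.

Variables (pi1 : {perm seq_sub pairs}) (pi2 : {perm seq_sub snodes}).
Notation cpos := (@cpos B bok pi1 pi2).
Notation posP := (posP pi1).
Notation posQ := (posQ pi2).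
Notation cS := (@core_node B bok).

Lemma v1_in : TN 0 true \in nodes. Proof. by rewrite mem_TN nt_gt0. Qed.
Lemma v2_in : SN 0 0 \in nodes. Proof. by rewrite mem_SN (bp_L bok). Qed.
Definition cv1 : N := SeqSub v1_in.
Definition cv2 : N := SeqSub v2_in.

Lemma cpos_node (u : N) : cpos u = match ssval u with
  | inl (p, b) => (posP p).*2 + b
  | inr x => s.*2 + posQ x end.
Proof. by []. Qed.

Lemma cpos_low (u : N) : (cpos u < s.*2) = if ssval u is inl _ then true else false.
Proof.
rewrite cpos_node; have := ssvalP u; case: (ssval u) => [[p b]|x].
  by rewrite mem_nodes_inl => h; have := posP_lt pi1 h; have := leq_b1 b; lia.
by move=> _; lia.
Qed.

Lemma raw_part x b y : rch B x b = Some y -> (x, b) <> (TN 0 true, false) ->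
  (if x is inl _ then true else false) = (if y is inl _ then true else false).
Proof.
have nx i : nxt B i = Some y -> true = (if y is inl _ then true else false).
  by rewrite /nxt; case: ifP => // _ [<-].
case: x => [[[i|[j c]] b']|[i j]] /=.
- case E: (stp i) => [d x|x y'].
    by case: ifP => // _; case: b => [[<-]|/nx].
  case: b'; case: b => //.
  + by case: i {E} => [|i] // /nx.
  + by case: i {E} => [/nx //|i]; case: ifP => // _ [<-].
  + by move=> [<-].
- by case: ifP => // _; case: b => [[<-]|] //; case: c => // -[<-].
- case: j => [|j]; last by case: ifP => // _ [<-].
  case: b; last by case: ifP => // _ [<-].
  by case: (tl i) => // k [<-].
Qed.

(** Induction in steps of two, one symmetric cycle at a time. The tail leaves the spine through slot
    [true] and each later doubled vertex through its only slot [false], whence the slot [j == 0]. *)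
Lemma ctail i j (u : N) : i < L -> ssval u = SN i j -> ~~ odd j -> j < tl i ->
  tail_shape 1 u (j == 0).
Proof.
move=> lt_i; have [n] := ubnP (tl i - j); elim: n j u => // n IH j u le_n eu ev lt_j.
have [otl tw2] := bp_tl bok lt_i (leq_ltn_trans (leq0n _) lt_j).
have in1 : SN i j.+1 \in nodes by rewrite mem_SN lt_i.
pose u1 : N := SeqSub in1.
have va : rvalid (Some (u, j == 0)).
  by rewrite /= eu /= ev andbT; case: (j).
have va1 b' : rvalid (Some (u1, b')) by rewrite /= ev.
have ch : child u (j == 0) = Some u1.
  apply/cchildP => //; rewrite eu /=; case: (j) lt_j => [|k] lt_k.
    by case: (tl i) lt_k.
  by case: eqP => // e; rewrite e ltnn in lt_k.
have wu : swt u (j == 0) = 1.*2.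
  rewrite -[swt u _]/(rw B (ssval u) _) eu /=; case: (j) ev => [|k] // ek.
  by rewrite (negbTE ek).
have rch1 b' : rch B (ssval u1) b' = if j.+1 == tl i then None else Some (SN i j.+2) by [].
have [ej|nj] := eqVneq j.+1 (tl i).
  apply: (TailFork ch wu); first by rewrite /= ev.
  move=> b'; split; first by apply: cchildN => //; rewrite rch1 ej eqxx.
  by rewrite /= ev.
have lt_j2 : j.+2 < tl i.
  have : ~~ odd j.+2 by rewrite /= negbK.
  by lia.
have in2 : SN i j.+2 \in nodes by rewrite mem_SN lt_i ltnW.
pose u2 : N := SeqSub in2.
apply: (@TailCycle T 1 u (j == 0) u1 u2) => //.
- by rewrite /= ev.
- move=> b'; split; last by rewrite /= ev.
  by apply/cchildP => //; rewrite rch1 (negbTE nj).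
- by rewrite /= negbK.
- by apply: (IH j.+2) => //=; [lia | rewrite negbK].
Qed.

Lemma rcontr_pair (u v : N) b p c : child u b = Some v ->
  ssval u = inl (p, c) -> ssval v = inl (p, ~~ c) -> ru B (ssval u) b = ~~ c -> rcontr cpos s (Some (u, b)).
Proof.
move=> ch eu ev eb; have := cpos_low u; rewrite eu => lt_u.
have := cpos_low v; rewrite ev => lt_v.
rewrite /rcontr ch -[up u b]/(ru B (ssval u) b) eb.
by case: c eu ev {eb} lt_u lt_v => eu ev /=; rewrite !cpos_node eu ev /= => ? ?; apply/and3P; split;
  rewrite ?addn0 ?addn1 ?odd_double ?eqxx //; lia.
Qed.

(** Main weights of the trunk, the weights given off and the flow are all odd, so an even edge
    between two vertices of the subgraph joins the two vertices of one pair. *)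
Lemma ceven (u v : N) b : rvalid (Some (u, b)) -> child u b = Some v -> cS v ->
  ~~ odd (swt u b) -> rcontr cpos s (Some (u, b)).
Proof.
move=> va ch; have := ch => /(cchildP _ va); rewrite /core_node -[swt u b]/(rw B (ssval u) b).
have := ssvalP u; case eu: (ssval u) => [[[i|[j c]] b']|[i j]];
  rewrite -/(TN _ _) -/(BN _ _ _) -/(SN _ _) mem_nodes.
- move=> lt_i /=; have mo := main_weight_odd bok lt_i.
  have RC c : Some (TN i c) = Some (ssval v) -> c = ~~ b' -> ru B (ssval u) b = c ->
      rcontr cpos s (Some (u, b)).
    by move=> [ev] ec ru1; apply: (rcontr_pair ch eu); rewrite -?ec.
  case E: (stp i) => [d x|x y] in RC *.
    case: eqP => // eb'; case: b RC {va ch} => RC; last by rewrite mo.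
    move=> ev _ _; apply: (RC d) => //; first by rewrite eb' negbK.
    by rewrite eu /= E eb' eqxx.
  case: b' eu RC => eu RC; case: b RC {va ch} => RC //; try by rewrite mo.
    have oy : odd y.
      have [i0|i0] := posnP i; first by move: E; rewrite i0 (bp_stp0 bok) => -[_ <-].
      by have := stp_gt0 bok i0 lt_i; rewrite E => -[].
    by rewrite oy.
  by move=> ev _ _; apply: (RC true) => //; rewrite eu /= E.
- move=> lt_j /=; case: eqP => // eb'; case: b va ch => va ch; last by case: (c).
  move=> [ev] _ _; apply: (rcontr_pair ch eu); rewrite -?ev ?eb' ?negbK //.
  by rewrite eu /= eb' eqxx.
- move=> /andP[lt_i le_j] /=; case: j eu le_j => [|j] eu le_j.
    case: b {va ch}; first by case: (tl i) => // k [<-].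
    by have [k ->] := flow_odd bok lt_i => _ _; lia.
  by case: ifP => // _ [<-].
Qed.

Hypothesis pi1_ht : pi1 \in layer_perms (code_ht (pair_ht B) (s := pairs)).
Hypothesis pi2_ht : pi2 \in layer_perms (code_ht (string_ht B) (s := snodes)).

Lemma czigzag_ok : @zigzag_ok T cpos s t cS cv1 cv2.
Proof.
have s0 : 0 < s by rewrite /npairs size_pairs; have := nt_gt0; lia.
have in_t0 : inl 0 \in pairs by rewrite mem_pairs_inl nt_gt0.
(* Pair 0 is alone at the lowest height, and below the string vertex [(0, 0)] is alone at the
   greatest, so every height-preserving permutation leaves them first and last. *)
have pos00 : posP (inl 0) = 0.
  apply: (code_pos_min (pairs_uniq B) pi1_ht in_t0) => -[i|[j c]] _ ne /=.
    by rewrite lt0n; apply: contra ne => /eqP ->.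
  by have := nt_gt0; lia.
have in_s0 : (0, 0) \in snodes by rewrite mem_snodes (bp_L bok).
have pos_top : posQ (0, 0) = t.-1.
  apply: (code_pos_max (snodes_uniq B) pi2_ht in_s0) => -[i j].
  rewrite mem_snodes => /andP[lt_i le_j] /eqP ne; exact: (bp_top bok).
have t0 : 0 < t by have := posQ_lt pi2 in_s0; lia.
have f1 := flow1_lt0 bok.
split.
- by [].
- move=> v sv nr; have [pn va ch lv] := raw_parents bok (ssvalP v) nr.
  rewrite /core_node rawparP //; move: sv; rewrite /core_node.
  have := ssvalP v; case: (ssval v) => [[[i|[j c]] b]|[i [|j]]] //= _ _.
  + by case: ifP => // _; case: i {nr pn va ch lv} => [|[|i]].
  + by case: ifP => // _; case: c {nr pn va ch lv}.
  + by case: i {nr pn va ch lv}.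
- by move=> v; rewrite /core_node -[dbl v]/(rdbl (ssval v)); case: (ssval v) => [[? ?]|[i []]].
- by move=> u b v; apply: ceven.
- by move=> u; rewrite cpos_low /core_node; case: (ssval u).
- move=> u v i lt_i; rewrite !cpos_node => pu pv.
  have := ssvalP u; have := ssvalP v.
  case eu: (ssval u) pu => [[p b]|x] pu; last by lia.
  case ev: (ssval v) pv => [[p' b']|x'] pv; last by lia.
  rewrite !mem_nodes_inl => p'n pn.
  have [b00 pi] : b = false /\ posP p = i by case: b {eu} pu => /= pu; split=> //; lia.
  have [b1 pi'] : b' = true /\ posP p' = i by case: b' {ev} pv => /= pv; split=> //; lia.
  have epp : p = p' by apply: (posP_inj (pi1 := pi1)); rewrite ?pi ?pi'.
  by apply: (@cpair_form B bok pi1 pi2 pi1_ht pi2_ht u v p); rewrite ?eu ?ev ?epp ?b00 ?b1.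
(* Two ends at a spine vertex cannot form a symmetric fork: one weighs an odd flow, the other an
   even tail weight. *)
- move=> u su; rewrite leqNgt cpos_low; move: su; rewrite /core_node.
  have := ssvalP u; case eu: (ssval u) => [//|[i j]]; rewrite -/(SN i j) mem_nodes /= => /andP[lt_i _].
  move=> /eqP j0 _ _ _; rewrite ?eu j0 /=.
  by have [k ->] := flow_odd bok lt_i; have [_ ev] := bp_tw bok lt_i; lia.
- move=> u b v va; rewrite /core_node => su /(cchildP _ va).
  have := ssvalP u; move: su; case eu: (ssval u) => [[[i|[j c]] b']|[i j]];
    rewrite -/(TN _ _) -/(BN _ _ _) -/(SN _ _) mem_nodes.
  + move=> _ _ ch; have := raw_part ch; case ev: (ssval v) ch => [//|[i' j']] ch.
    case: (pselect ((TN i b', b) = (TN 0 true, false))) => [e _|ne /(_ ne) //].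
    by case: e ch => -> -> ->; rewrite /= (bp_stp0 bok) => -[_ <-].
  + by move=> _ _ ch; have := raw_part ch; case ev: (ssval v) ch => [//|[i' j']] _ /(_ _) h; have := h ltac:(by []).
  + move=> /eqP j0 /andP[lt_i _]; rewrite j0 /= in eu *.
    case: b va => va; last by case: ifP => // _ [<-].
    case E: (tl i) => [//|k] _ _; exists 1.
    by have := ctail lt_i eu isT; rewrite E; apply.
- exact: bp_odd_o bok.
- by rewrite cpos_node /= pos00.
- by apply/cchildP; rewrite ?(negbTE (ok_root (ctree_ok bok))) //= (bp_stp0 bok).
- by rewrite cpos_node /= pos00.
- by rewrite rin_root /= (bp_stp0 bok).
- by rewrite rout_root /= (bp_stp0 bok).
- rewrite (@crin _ bok cv1 root false) //= ?(bp_stp0 bok) //.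
  by rewrite (ent0 bok).
- rewrite (@crout _ bok cv1 root false) //= ?(bp_stp0 bok) //.
  by rewrite (ent0 bok).
- by apply: cchildN => //=; rewrite (bp_stp0 bok).
- by rewrite /= (bp_stp0 bok).
- rewrite /= (bp_stp0 bok); split=> //; last by apply: main_weight_odd (bok) _ nt_gt0.
  by have := bp_odd_o bok; have := bp_o bok; rewrite /=; lia.
- by apply/cchildP => //=; rewrite (bp_stp0 bok).
- by [].
- by rewrite cpos_node /= pos_top; lia.
- by rewrite leqNgt cpos_low.
- rewrite (@crin _ bok cv2 cv1 false) //= (bp_stp0 bok) /= (bp_tdir0 bok).
  by case: ifP => //; lia.
- by rewrite /=; have [k ->] := flow_odd bok (bp_L bok); lia.
- move=> u b v va /(cchildP _ va) ch ne; rewrite !cpos_low; apply: raw_part ch _.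
  move=> [e1 e2]; apply: ne; congr pair => //; exact: val_inj.
Qed.

End ConcreteZigzag.

Section CodeHeights.
Variables (K : choiceType) (s : seq K) (ht : K -> nat).
Variables (pi pi' : {perm seq_sub s}).
Hypothesis pi_ht : pi \in layer_perms (code_ht ht (s := s)).
Hypothesis pi'_ht : pi' \in layer_perms (code_ht ht (s := s)).

(** A rank in the sorted list has a fixed height, and both permutations preserve heights; so codes
    at the same position for different permutations lie in the same layer. *)
Lemma code_pos_ht k k' : k \in s -> k' \in s ->
  code_pos ht pi k = code_pos ht pi' k' -> ht k = ht k'.
Proof.
move=> ks ks'; rewrite (code_posE ht pi (SeqSub ks)) (code_posE ht pi' (SeqSub ks')).
move=> /layer_pos_inj e.
have := layer_permsP _ _ pi_ht (SeqSub ks); rewrite e (layer_permsP _ _ pi'_ht) => h.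
exact: esym h.
Qed.

Lemma code_pos_perm_inj : {in s, code_pos ht pi =1 code_pos ht pi'} -> pi = pi'.
Proof.
move=> e; apply/permP => k; have := e _ (ssvalP k).
by rewrite !code_posE => /layer_pos_inj.
Qed.

End CodeHeights.

Lemma double_bool_inj a a' (b b' : bool) : a.*2 + b = a'.*2 + b' -> a = a' /\ b = b'.
Proof. by case: b; case: b' => /= e; (split=> //; lia) || (exfalso; lia). Qed.

(** * Distinct permutations give non-isomorphic covers *)

Section ConcreteCount.
Variables (R : realType) (B : blueprint).
Hypothesis bok : blueprint_ok B.
Notation nt := (nt B).
Notation nb := (nb B).
Notation b0 := (b0 B).
Notation L := (nl B).
Notation stp := (stp B).
Notation tl := (tl B).
Notation sht := (sht B).
Notation nodes := (nodes B).
Notation pairs := (pairs B).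
Notation snodes := (snodes B).
Notation s := (npairs B).
Notation t := (nstring B).
Notation T := (ctree bok).
Notation N := (node T).

(** What every isomorphism between two members of the family preserves: the part over pairs or
    single points, the layer, and the place inside a pair. *)
Definition raw_key (x : raw) : bool * nat * bool :=
  match x with
  | inl (p, b) => (true, pair_ht B p, b)
  | inr x => (false, string_ht B x, false)
  end.

(** Over the pairs, siblings are at different heights because the next trunk pair, the partner in
    the pair and the branch all have different [pair_ht]. On the spine this is [bp_shtn], and
    further along a tail both slots lead to the same child. *)
Lemma raw_key_children x b b' y y' : x \in nodes -> rch B x b = Some y -> rch B x b' = Some y' ->
  raw_key y = raw_key y' -> y = y'.
Proof.
wlog: b b' y y' / b = false /\ b' = true.
  move=> H xn ch ch'; have [e|ne] := eqVneq b b'; first by move: ch'; rewrite -e ch => -[].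
  case: b b' ch ch' ne => [] [] ch ch' // _ e.
    by apply/esym; apply: (H false true) => //.
  by apply: (H false true).
case=> -> ->.
case: x => [[[i|[j c]] b1]|[i j]]; rewrite -/(TN _ _) -/(BN _ _ _) -/(SN _ _) mem_nodes /=.
- have nx c z d k c' : nxt B k = Some z -> raw_key z = raw_key (TN i d) -> i <= k -> c = c' :> bool.
    by rewrite /nxt; case: ifP => // _ [<-] /= [e] _; lia.
  move=> lt_i; case E: (stp i) => [d x|x y2].
    case: ifP => // _ nx1 [<-] e; have := nx true _ _ _ false nx1 e (leqnn i).
    by [].
  case: b1 => // -[<-].
  case: i lt_i E nx => [|i] lt_i E nx nx1 e.
    have := nx true _ true 0 false nx1 (esym e) (leqnn _); by [].
  move: nx1; case: ifP => // _ [ey]; move: e; rewrite -ey /= => -[e]; lia.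
- by move=> lt_j; case: ifP => // _; case: c => // -[<-] [<-] /= -[]; lia.
- move=> /andP[lt_i le_j]; case: j le_j => [|j] le_j.
    case: ifP => // lt_i1 [<-]; case E: (tl i) => [//|k] [<-] /= -[e].
    by have := bp_shtn bok lt_i1; rewrite E => /(_ isT) [].
  by case: ifP => // _ [->] [->].
Qed.

Definition family_t : finType :=
  {x : {perm seq_sub pairs} * {perm seq_sub snodes} |
     (x.1 \in layer_perms (code_ht (pair_ht B) (s := pairs))) &&
     (x.2 \in layer_perms (code_ht (string_ht B) (s := snodes)))}.

Lemma card_family_t : #|{: family_t}| =
  #|layer_perms (code_ht (pair_ht B) (s := pairs))| *
  #|layer_perms (code_ht (string_ht B) (s := snodes))|.
Proof.
rewrite card_sig -cardsX; by apply: eq_card => -[p q]; rewrite finset.in_setX.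
Qed.

Variables (w : nat -> R) (g : nat) (la mu : seq nat).
Hypothesis wmono : (forall i j, (i < j)%N -> w i < w j)%R.
Hypothesis la_ok : perm_eq (end_weights T false) la.
Hypothesis mu_ok : perm_eq (end_weights T true) mu.
Hypothesis genus_ok : s.*2 + t + 2 = size la + size mu + 2 * g.

Definition family_cover (x : family_t) : graph_map R :=
  tree_cover (@cpos B bok (val x).1 (val x).2) w.

Lemma family_cover_in x : proper_zigzag_covers w g la mu s t (family_cover x).
Proof.
have /andP[h1 h2] := valP x.
have pok := cpos_ok bok h1 h2; have s0 : 0 < s by rewrite /npairs size_pairs addn_gt0 (nt_gt0 bok).
split; first exact: tree_tropical_cover (ctree_ok bok) pok la_ok mu_ok genus_ok.
exact: tree_properly_mixed wmono (ctree_ok bok) pok s0 (czigzag_ok bok h1 h2).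
Qed.

Lemma family_cover_inj x x' : cover_iso (family_cover x) (family_cover x') -> x = x'.
Proof.
have /andP[h1 h2] := valP x; have /andP[h1' h2'] := valP x'.
have pok := cpos_ok bok h1 h2; have pok' := cpos_ok bok h1' h2'.
move=> /(tree_iso_nodes wmono) [f [inj_f posf adj_f]].
have f_root : f root = root.
  apply: (pos_inj pok'); rewrite posf.
  by rewrite (zo_posroot (czigzag_ok bok h1 h2)) (zo_posroot (czigzag_ok bok h1' h2')).
have key_f u : raw_key (ssval (f u)) = raw_key (ssval u).
  have : (cpos (val x').1 (val x').2 (f u) < s.*2) = (cpos (val x).1 (val x).2 u < s.*2).
    by rewrite posf.
  have := posf u; rewrite !cpos_low !cpos_node; have := ssvalP u; have := ssvalP (f u).
  case: (ssval u) => [[p b]|y]; case: (ssval (f u)) => [[p' b']|y'] //;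
    rewrite ?mem_nodes_inl ?mem_nodes_inr => hn' hn e _.
    have [ep eb] := double_bool_inj e.
    by rewrite /= eb (code_pos_ht h1' h1 hn' hn ep).
  have ey := addnI e.
  by rewrite /= (code_pos_ht h2' h2 hn' hn ey).
have fid u : f u = u.
  apply: (tree_rigid (key := fun u : N => raw_key (ssval u)) (ctree_ok bok)) => //.
  move=> v b b' z z' va va' /(cchildP _ va) ch /(cchildP _ va') ch' e.
  by apply: val_inj; apply: raw_key_children (ssvalP v) ch ch' e.
(* Since [f] is the identity, the two position functions agree; they determine the permutations
   because ranks are injective. *)
have posE (u : N) : cpos (val x').1 (val x').2 u = cpos (val x).1 (val x).2 u by have := posf u; rewrite fid.
apply: val_inj; rewrite [val x]surjective_pairing [val x']surjective_pairing; congr pair.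
  apply: (code_pos_perm_inj (ht := pair_ht B)) => p pn.
  have un : (inl (p, false) : raw) \in nodes by rewrite mem_nodes_inl.
  have [h _] := double_bool_inj (posE (SeqSub un)); exact: esym h.
apply: (code_pos_perm_inj (ht := string_ht B)) => y yn.
have un : (inr y : raw) \in nodes by rewrite mem_nodes_inr.
exact: esym (addnI (posE (SeqSub un))).
Qed.

Theorem leq_layer_perms_zigzag :
  #|layer_perms (code_ht (pair_ht B) (s := pairs))| *
  #|layer_perms (code_ht (string_ht B) (s := snodes))| <= proper_zigzag_number w g la mu s t.
Proof.
rewrite -card_family_t.
exact: leq_proper_zigzag_number family_cover_in family_cover_inj.
Qed.

End ConcreteCount.

(** * End weights of the blueprint tree *)

Lemma perm_flatten_map (S K : eqType) (f g : S -> seq K) (s : seq S) :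
  {in s, forall x, perm_eq (f x) (g x)} -> perm_eq (flatten (map f s)) (flatten (map g s)).
Proof.
elim: s => //= x s IH fg; apply: perm_cat; first by apply: fg; rewrite inE eqxx.
by apply: IH => y ys; apply: fg; rewrite inE ys orbT.
Qed.

Lemma flatten_map_allpairs (S1 S2 S3 K : Type) (F : S3 -> seq K) (h : S1 -> S2 -> S3)
    (s1 : seq S1) (s2 : S1 -> seq S2) :
  flatten (map F [seq h x y | x <- s1, y <- s2 x]) =
  flatten [seq flatten [seq F (h x y) | y <- s2 x] | x <- s1].
Proof.
elim: s1 => //= x s1 IH; rewrite map_cat flatten_cat IH; congr cat.
by rewrite -map_comp.
Qed.

Lemma perm_flatten_cat (S : Type) (K : eqType) (f g : S -> seq K) (s : seq S) :
  perm_eq (flatten [seq f x ++ g x | x <- s]) (flatten (map f s) ++ flatten (map g s)).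
Proof.
elim: s => //= x s IH; rewrite -catA perm_sym -catA perm_cat2l perm_sym.
by rewrite (perm_catl _ IH) perm_catCA.
Qed.

Section EndWeights.
Variable B : blueprint.
Hypothesis bok : blueprint_ok B.
Notation nt := (nt B).
Notation nb := (nb B).
Notation b0 := (b0 B).
Notation L := (nl B).
Notation o := (bo B).
Notation stp := (stp B).
Notation tl := (tl B).
Notation tdir := (tdir B).
Notation tw := (tw B).

Definition step_in (st : step) : seq nat :=
  match st with Fk d x => if d then [::] else [:: x; x] | Bk x _ => [:: x] end.
Definition step_out (st : step) : seq nat :=
  match st with Fk d x => if d then [:: x; x] else [::] | Bk _ y => [:: y] end.

(** The weight given off by a pair of form (B) leaves through an end, except at pair 0, where it
    continues the trunk, and at the branching pairs, where it starts a branch. *)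
Definition trunk_out (i : nat) : seq nat :=
  if (i == 0) || (b0 <= i < b0 + nb) then [::] else step_out (stp i).

Definition trunk_ends (d : bool) (i : nat) : seq nat :=
  if d then trunk_out i ++ (if i.+1 == nt then [:: main_weight B i] else [::])
  else step_in (stp i).

Definition branch_ends (d : bool) : seq nat := if d then [:: 1; 1; 1] else [:: 1; 1].

Definition string_ends (d : bool) (i : nat) : seq nat :=
  if tdir i == d then if tl i == 0 then [:: tw i] else [:: 1; 1] else [::].

Definition last_end (d : bool) : seq nat :=
  if (0 < flow B L)%R == d then [:: `|flow B L|%N] else [::].

Notation rends d x := (raw_ends (rch B) (ru B) (rw B) rdbl d x).

Lemma nxt_none i : i < nt -> (nxt B i == None) = (i.+1 == nt).
Proof.
move=> lt_i; rewrite /nxt; case: ifP => h; apply/esym; first by apply/negbTE; lia.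
by apply/eqP; apply/eqP; rewrite eqn_leq lt_i leqNgt h.
Qed.

Lemma trunk_endsE d i : i < nt ->
  perm_eq (rends d (TN i false) ++ rends d (TN i true)) (trunk_ends d i).
Proof.
move=> lt_i; rewrite /raw_ends /trunk_ends /trunk_out /=.
have := nxt_none lt_i; have := bp_nt bok.
case: (posnP i) lt_i => [->|i0] lt_i nt2.
  have /negbTE n1 : 1 != nt by lia.
  by rewrite (bp_stp0 bok) /= => ->; rewrite n1; case: d.
have e1 (X Y : option raw) : (if i is 0 then X else Y) = Y by case: (i) i0.
rewrite /= !e1 => nn.
have nbr : b0 <= i < b0 + nb -> stp i = Bk 1 1 by apply: (bp_branch bok).
case E: (stp i) nbr => [d' x|x y] nbr.
  have nb' : (b0 <= i < b0 + nb) = false by apply/negP => /nbr.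
  by rewrite nb'; case: d' {E nbr}; case: d; rewrite /= ?nn; case: (i.+1 == nt);
    apply/seq.permP => a /=; lia.
by case: (b0 <= i < b0 + nb) {nbr}; case: d; rewrite /= ?nn; case: (i.+1 == nt);
  apply/seq.permP => a /=; lia.
Qed.

Lemma tail_endsE d i j : odd (tl i) -> perm_eq (rends d (SN i j.+1))
  (if (j.+1 == tl i) && (tdir i == d) then [:: 1; 1] else [::]).
Proof.
move=> otl; rewrite /raw_ends.
have h b : rch B (SN i j.+1) b = if j.+1 == tl i then None else Some (SN i j.+2) by [].
rewrite (eq_filter (a2 := fun b => [&& ~~ (rdbl (SN i j.+1) && b), j.+1 == tl i & tdir i == d]));
  last by move=> b; rewrite h; case: (_ == tl i).
have [e|ne] := boolP (j.+1 == tl i); last by rewrite /= !andbF.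
have oj : odd j.+1 by rewrite (eqP e).
rewrite /= in oj; rewrite /= oj.
by case: (_ == d).
Qed.

Lemma string_endsE d i : i < L ->
  perm_eq (flatten [seq rends d (SN i j) | j <- iota 0 (tl i).+1])
    (string_ends d i ++ (if i.+1 == L then last_end d else [::])).
Proof.
move=> lt_i; rewrite /= /string_ends /last_end.
have nL : (i.+1 < L) = ~~ (i.+1 == L) by rewrite ltn_neqAle lt_i andbT.
case E: (tl i) => [|k].
  rewrite /= cats0 /raw_ends /= nL E.
  have [<-|ne] := eqVneq i.+1 L; rewrite /= ?cats0.
    by case: (_ == d); case: (_ == d); apply/seq.permP => a /=; lia.
  by case: (_ == d).
have otl : odd k.+1 by have := bp_tl bok lt_i; rewrite E => /(_ isT) [].
have -> : iota 1 k.+1 = rcons (iota 1 k) k.+1 by rewrite -{1}[k.+1]addn1 iotaD cats1 add1n.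
rewrite map_rcons flatten_rcons.
have -> : flatten [seq rends d (SN i j) | j <- iota 1 k] = [::].
  have oti : odd (tl i) by rewrite E.
  have H j : j \in iota 1 k -> rends d (SN i j) = [::].
    rewrite mem_iota; case: j => // j /andP[_ j2].
    apply/perm_nilP; apply: perm_trans (tail_endsE d j oti) _; rewrite E.
    have -> : (j.+1 == k.+1) = false by lia.
    by [].
  by elim: (iota 1 k) H => //= j l IH H; rewrite H ?inE ?eqxx // IH // => j' hj'; apply: H; rewrite inE hj' orbT.
have te := tail_endsE (i := i) d k; rewrite E eqxx /= in te.
rewrite cat0s -/(rends d (SN i k.+1)).
apply: (@perm_trans _ (rends d (SN i 0) ++ (if tdir i == d then [:: 1; 1] else [::]))).
  by rewrite perm_cat2l; apply: te.
rewrite /raw_ends /= E nL; have [<-|ne] := eqVneq i.+1 L; last by rewrite /= cats0.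
by case: (_ == d); case: (tdir i == d); apply/seq.permP => a /=; lia.
Qed.

Lemma last_endE d :
  flatten [seq if i.+1 == L then last_end d else [::] | i <- iota 0 L] = last_end d.
Proof.
have := bp_L bok; case: L => // k _.
rewrite -addn1 iotaD add0n map_cat flatten_cat /= addn1 eqxx cats0.
rewrite (_ : flatten _ = [::]) //.
have H j : j \in iota 0 k -> (j.+1 == k.+1) = false by rewrite mem_iota; lia.
elim: (iota 0 k) H => //= j l IH H; rewrite H ?inE ?eqxx // IH // => j' hj'.
by apply: H; rewrite inE hj' orbT.
Qed.

Lemma blueprint_end_weights d : perm_eq (end_weights (ctree bok) d)
  ((if d then [::] else [:: o]) ++ flatten [seq trunk_ends d i | i <- iota 0 nt]
   ++ flatten [seq branch_ends d | j <- iota 0 nb]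
   ++ flatten [seq string_ends d i | i <- iota 0 L] ++ last_end d).
Proof.
apply: perm_trans (raw_end_weights _ d) _; rewrite perm_cat2l.
rewrite /nodes map_cat flatten_cat flatten_map_allpairs /pairs map_cat flatten_cat.
rewrite -!map_comp flatten_map_allpairs -catA.
apply: perm_cat.
  apply: perm_flatten_map => i; rewrite mem_iota /= => lt_i; rewrite cats0.
  exact: trunk_endsE.
apply: perm_cat.
  by apply: perm_flatten_map => j _; rewrite /raw_ends /=; case: d.
rewrite /snodes flatten_map_allpairs -[X in perm_eq _ (_ ++ X)]last_endE.
apply: perm_trans (perm_flatten_cat _ _ _).
apply: perm_flatten_map => i; rewrite mem_iota => /andP[_ lt_i].
exact: string_endsE.
Qed.

End EndWeights.

(** * The family with prescribed ends *)

Definition step_ok (st : step) (W : nat) : bool :=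
  match st with
  | Fk d x => (0 < x) && (d ==> (x.*2 < W))
  | Bk x y => [&& y < W, odd x & odd y]
  end.

Fixpoint run_ok (W : nat) (l : seq step) : bool :=
  if l is st :: l' then step_ok st W && run_ok (next_weight st W) l' else true.

Definition run_weight (W : nat) (l : seq step) : nat := foldl (fun W st => next_weight st W) W l.

Lemma run_ok_cat W l1 l2 : run_ok W (l1 ++ l2) = run_ok W l1 && run_ok (run_weight W l1) l2.
Proof. by elim: l1 W => //= st l1 IH W; rewrite IH andbA. Qed.

Lemma run_weight_cat W l1 l2 : run_weight W (l1 ++ l2) = run_weight (run_weight W l1) l2.
Proof. exact: foldl_cat. Qed.

Lemma run_ok_nth x0 W l i : run_ok W l -> i < size l ->
  step_ok (nth x0 l i) (run_weight W (take i l)).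
Proof. by elim: l W i => //= st l IH W [|i] /andP[h1 h2] //= lt_i; apply: IH. Qed.

Definition tail_t : Type := (bool * nat * nat)%type.
Definition tail_flow (x : tail_t) : int := (if x.1.1 then - (x.1.2)%:Z else (x.1.2)%:Z)%R.

(** Negative flow on the prefix means that its spine descends steadily from [v_2], so decreasing
    heights can be assigned to it. *)
Fixpoint neg_run (f : int) (l : seq tail_t) : bool :=
  if l is x :: l' then ((f + tail_flow x < 0) && neg_run (f + tail_flow x) l')%R else true.

Definition flow_sum (f : int) (l : seq tail_t) : int := (f + \sum_(x <- l) tail_flow x)%R.

Lemma flow_sum_cons f x l : flow_sum f (x :: l) = flow_sum (f + tail_flow x)%R l.
Proof. by rewrite /flow_sum big_cons addrA. Qed.

Lemma flow_sum_cat f l1 l2 : flow_sum f (l1 ++ l2) = flow_sum (flow_sum f l1) l2.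
Proof. by rewrite /flow_sum big_cat addrA. Qed.

Lemma neg_run_cat f l1 l2 : neg_run f (l1 ++ l2) = neg_run f l1 && neg_run (flow_sum f l1) l2.
Proof.
elim: l1 f => [|x l1 IH] f /=; first by rewrite /flow_sum big_nil addr0.
by rewrite IH flow_sum_cons andbA.
Qed.

Lemma neg_run_take f l i : neg_run f l -> 0 < i -> i <= size l -> (flow_sum f (take i l) < 0)%R.
Proof.
elim: l f i => [|x l IH] f [|i] //= /andP[h1 h2] _ lt_i; rewrite flow_sum_cons.
case: i lt_i => [|i] lt_i; first by rewrite take0 /flow_sum big_nil addr0.
exact: IH.
Qed.

Section Family.
Variables (o e : nat) (Ex Ox Ey Oy lae outs : seq nat).
Variables (K J Rf nbr K1 K2 L0 q r : nat).

(** [K] forks of weight 1 first raise the trunk weight far enough for all later subtractions. Even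
    entries come as forks [Ex] and [Ey], odd entries one by one through form (B), exchanged against
    a 1 on the other side. In [trunk_post], [Rf] neutral pairs fill up the number of pairs modulo 3,
    and [J] forks bring the weight down to 1. *)
Definition trunk_pre : seq step :=
  nseq K (Fk false 1) ++ [seq Fk false x | x <- Ex] ++ [seq Bk x 1 | x <- Ox]
  ++ [seq Fk true y | y <- Ey] ++ [seq Bk 1 y | y <- Oy].
Definition trunk_post : seq step := nseq Rf (Bk 1 1) ++ nseq J (Fk true 1).
Definition trunk_steps : seq step := trunk_pre ++ nseq nbr (Bk 1 1) ++ trunk_post.

(** The end [e] at [v_2] comes first. Then [K1] upward forks and the ends [outs] lower the flow,
    after which the incoming even ends [lae] and [K2] downward forks raise it to exactly -1. *)
Definition string_pre : seq tail_t :=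
  (true, e, 0) :: nseq K1 (true, 2, 1) ++ [seq (true, x, 0) | x <- outs]
  ++ [seq (false, x, 0) | x <- lae] ++ nseq K2 (false, 2, 1).
(* The tails on the even zigzag vertices carry [g = q * (L0./2) + r] symmetric cycles. *)
Definition zigzag_tail (j : nat) : tail_t :=
  if odd j then (true, 2, 1)
  else (false, 2, if j./2 < L0./2 then (q + (j./2 < r)).*2.+1 else 1).
Definition string_tails : seq tail_t := string_pre ++ mkseq zigzag_tail L0.

Notation Pn := (size string_pre).
Notation M := (q.*2 + 4).

Definition tail_at (i : nat) : tail_t := nth (true, 2, 0) string_tails i.

(** [v_2] is on top, followed by the upward forks at [M + Pn + 3] and the upper zigzag layer at
    [M + Pn + 2]. Then come the descending prefix, the lower zigzag layer at [M], and the downward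
    tails at [M - j]. Tails have length at most [q.*2 + 3 < M], so this subtraction is never
    truncated. *)
Definition string_height (i j : nat) : nat :=
  if j is j'.+1 then if (tail_at i).1.1 then M + Pn + 3 else M - j
  else if i is 0 then M + Pn + 10
  else if i < Pn then M + 1 + (Pn - i)
  else if odd (i - Pn) then M + Pn + 2 else M.

(** The special pair [Bk o 1] at [v_1'] has index 0, whence the shifts by one. *)
Definition bp : blueprint :=
  Blueprint (size trunk_steps).+1 nbr (size trunk_pre).+1 (Pn + L0) o
    (nth (Fk true 0) (Bk o 1 :: trunk_steps))
    (fun i => (tail_at i).2) (fun i => (tail_at i).1.1) (fun i => (tail_at i).1.2)
    string_height.

Hypothesis o3 : 3 <= o.
Hypothesis odd_o : odd o.
Hypothesis even_e : ~~ odd e.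
Hypothesis le_e : 2 * o <= e.
Hypothesis laeP : all (fun x => (0 < x) && ~~ odd x) lae.
Hypothesis outsP : all (fun x => (0 < x) && ~~ odd x) outs.
Hypothesis trunk_ok : run_ok 1 trunk_steps.
Hypothesis trunk_end : run_weight 1 trunk_steps = 1.
Hypothesis K_gt0 : 0 < K.
Hypothesis pre_neg : neg_run ((2 * o)%:Z - 1)%R string_pre.
Hypothesis pre_end : flow_sum ((2 * o)%:Z - 1)%R string_pre = (-1)%R.
Hypothesis L0_ge2 : 2 <= L0.
Hypothesis r_lt : r < L0./2.

Lemma size_tails : size string_tails = Pn + L0.
Proof. by rewrite size_cat size_mkseq. Qed.

Lemma tail_at_pre i : i < Pn -> tail_at i = nth (true, 2, 0) string_pre i.
Proof. by move=> lt_i; rewrite /tail_at nth_cat lt_i. Qed.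

Lemma tail_at_zz j : j < L0 -> tail_at (Pn + j) = zigzag_tail j.
Proof. by move=> lt_j; rewrite /tail_at nth_cat ltnNge leq_addr /= addKn nth_mkseq. Qed.

Lemma bp_flow i : i <= Pn + L0 -> flow bp i = flow_sum ((2 * o)%:Z - 1)%R (take i string_tails).
Proof.
move=> le_i; rewrite /flow /flow_sum; congr (_ + _)%R.
elim: i le_i => [|i IH] le_i; first by rewrite take0 big_nil big_ord0.
rewrite big_ord_recr IH 1?ltnW // (take_nth (true, 2, 0)) ?size_tails // -cats1 big_cat big_seq1.
by [].
Qed.

Lemma bp_flow_pre i : 0 < i -> i <= Pn -> (flow bp i < 0)%R.
Proof.
move=> i0 le_i; rewrite bp_flow; last by lia.
rewrite take_cat; case: ltnP => h; first exact: neg_run_take.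
by have -> : i = Pn by [lia]; rewrite subnn take0 cats0 pre_end.
Qed.

Lemma bp_flow_zz j : j <= L0 -> flow bp (Pn + j) = (if odd j then 1 else -1)%R.
Proof.
elim: j => [|j IH] lt_j.
  by rewrite addn0 bp_flow ?leq_addr // take_cat ltnn subnn take0 cats0 pre_end.
rewrite addnS flowS IH 1?ltnW //= tail_at_zz // /zigzag_tail.
by case: (odd j).
Qed.

Lemma bp_weight i : i <= size trunk_steps ->
  trunk_weight bp i.+1 = run_weight 1 (take i trunk_steps).
Proof.
elim: i => [|i IH] le_i; first by rewrite take0.
rewrite WS // IH 1?ltnW // (take_nth (Fk true 0)) // /run_weight -cats1 foldl_cat.
by [].
Qed.

Lemma string_pre_tails x : x \in string_pre ->
  [/\ 0 < x.1.2, ~~ odd x.1.2 & 0 < x.2 -> x.2 = 1 /\ x.1.2 = 2].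
Proof.
rewrite inE => /orP[/eqP -> /=|]; first by split=> //; lia.
rewrite !mem_cat => /or4P[/nseqP[-> _]|/mapP[y yo ->]|/mapP[y yo ->]|/nseqP[-> _]] //=.
  by have /andP[] := allP outsP _ yo.
by have /andP[] := allP laeP _ yo.
Qed.

Lemma zigzag_tailP j : [/\ (zigzag_tail j).1.2 = 2, odd (zigzag_tail j).2,
  (zigzag_tail j).2 <= q.*2 + 3, (zigzag_tail j).1.1 = odd j & odd j -> (zigzag_tail j).2 = 1].
Proof.
rewrite /zigzag_tail; case: (odd j) => /=; first by split=> //; lia.
case: ifP => _; split=> //; rewrite ?oddS ?odd_double //; try lia.
Qed.

Lemma tail_atP i : i < Pn + L0 ->
  [/\ 0 < (tail_at i).1.2, ~~ odd (tail_at i).1.2,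
      0 < (tail_at i).2 -> odd (tail_at i).2 /\ (tail_at i).1.2 = 2,
      (tail_at i).2 <= q.*2 + 3 & (tail_at i).1.1 -> (tail_at i).2 <= 1].
Proof.
move=> lt_i; have [lt|ge] := ltnP i Pn.
  rewrite tail_at_pre //; have [h1 h2 h3] := string_pre_tails (mem_nth (true, 2, 0) lt).
  split=> //; first by move=> /h3[-> ->].
    by case: posnP h3 => [->//|_ /(_ isT)[-> _]]; lia.
  by case: posnP h3 => [->//|_ /(_ isT)[-> _]].
have -> : i = Pn + (i - Pn) by rewrite subnKC.
rewrite tail_at_zz; last by lia.
have [-> h2 h3 -> h5] := zigzag_tailP (i - Pn).
by split=> // /h5 ->.
Qed.

Lemma height_top : string_height 0 0 = M + Pn + 10. Proof. by []. Qed.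

Lemma heightS i : string_height i.+1 0 =
  if i.+1 < Pn then M + 1 + (Pn - i.+1) else if odd (i.+1 - Pn) then M + Pn + 2 else M.
Proof. by []. Qed.

Lemma height_gt0 i : M <= string_height i 0.
Proof. by rewrite /string_height; case: i => [|i]; [lia|]; case: ifP => _; [lia|]; case: ifP => _; lia. Qed.

Lemma height_le i : 0 < i -> string_height i 0 <= M + Pn + 2.
Proof. by case: i => // i _; rewrite /string_height; case: ifP => _; [lia|]; case: ifP => _; lia. Qed.

Lemma bp_is_ok : blueprint_ok bp.
Proof.
have size_st : size trunk_steps = size trunk_pre + (nbr + (Rf + J)).
  by rewrite !size_cat !size_nseq.
have size_pre_gt0 : 0 < size trunk_pre by rewrite size_cat size_nseq; lia.
have tail0 : tail_at 0 = (true, e, 0) by [].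
have HS i : 0 < i < nt bp -> match stp bp i with
     | Fk d x => 0 < x /\ (d -> x.*2 < trunk_weight bp i)
     | Bk x y => [/\ y < trunk_weight bp i, odd x & odd y] end.
  case: i => // i /andP[_ lt_i]; have := run_ok_nth (Fk true 0) trunk_ok lt_i.
  rewrite -[stp bp i.+1]/(nth (Fk true 0) trunk_steps i) (bp_weight (ltnW lt_i)).
  case: (nth _ _ _) => [d x /andP[h1 /implyP h2]|x y /and3P[]]; by split.
split=> //.
- by rewrite /= size_st; lia.
- by rewrite /= size_st; lia.
- move=> i; rewrite -[b0 bp]/(size trunk_pre).+1 -[nb bp]/nbr => h; have -> : i = i.-1.+1 by lia.
  rewrite -[stp bp _]/(nth (Fk true 0) trunk_steps i.-1) nth_cat ifF; last by lia.
  by rewrite nth_cat size_nseq ifT ?nth_nseq ?ifT //; lia.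
- move=> i lt_i; have [] := tail_atP lt_i; by split.
- by move=> i lt_i; have [] := tail_atP lt_i.
- move=> i; rewrite -[nl bp]/(Pn + L0) -[sht bp]/string_height => lt_i; have [lt|ge] := ltnP i Pn.
    have fl := bp_flow_pre (ltn0Sn i) lt; rewrite (lt_gtF fl).
    case: i lt {lt_i fl} => [|i] lt.
      by have := height_le (ltn0Sn 0); rewrite height_top; lia.
    rewrite !heightS lt; case: ifP => h; first by lia.
    by have -> : i.+2 - Pn = 0 by [lia]; rewrite [odd 0]/=; lia.
  have := @bp_flow_zz (i - Pn).+1 ltac:(lia); rewrite addnS subnKC // => ->.
  case: i ge {lt_i} => [|i] ge; first by [].
  have g1 : (i.+1 < Pn) = false by rewrite ltnNge ge.
  have g2 : (i.+2 < Pn) = false by rewrite ltnNge (leqW ge).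
  rewrite !heightS g1 g2 (subSn ge) !oddS.
  by case: (odd (i.+1 - Pn)); rewrite /= ?ltr01 ?ltrN10 ?ltr0N1; lia.
- move=> i j; rewrite -[tdir bp i]/(tail_at i).1.1 -[tl bp i]/(tail_at i).2 -[sht bp]/string_height => lt_i lt_j; have [_ _ _ h4 h5] := tail_atP lt_i.
  have i0 : 0 < i by case: (i) lt_j => //; rewrite tail0.
  case: ifP => dir.
    have j0 : j = 0 by move: lt_j; have := h5 dir; lia.
    rewrite j0 [string_height i 1]/string_height dir; have := height_le i0; lia.
  rewrite [string_height i j.+1]/string_height dir.
  case: j lt_j => [|j] lt_j; first by have := height_gt0 i; lia.
  by rewrite /string_height dir; lia.
- move=> i; rewrite -[tl bp i]/(tail_at i).2 -[sht bp]/string_height => lt_i; have [_ _ _ h4 h5] := tail_atP (ltnW lt_i).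
  move=> tl0; rewrite [string_height i 1]/string_height.
  have := height_le (ltn0Sn i); have := height_gt0 i.+1; case: ifP => _; lia.
- move=> i j; rewrite -[tl bp i]/(tail_at i).2 -[sht bp]/string_height => lt_i le_j ne; rewrite [string_height 0 0]/string_height.
  case: j le_j ne => [|j] le_j ne.
    have i0 : 0 < i by case: (i) ne.
    by have := height_le i0; lia.
  by rewrite /string_height; case: ifP => _; lia.
Qed.

End Family.

(** * Lower bounds from selected layers *)

Section LayerBounds.
Variables (T : finType) (ht : T -> nat).

(** Only some layers need to be listed, with lower bounds for their sizes; all other layers
    contribute factorials, which are at least 1. *)
Lemma prod_fact_layers (hs : seq (nat * nat)) :
  uniq [seq x.1 | x <- hs] ->
  {in hs, forall x, x.2 <= #|[set v | ht v == x.1]%SET|} ->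
  \prod_(x <- hs) (x.2)`! <= #|layer_perms ht|.
Proof.
move=> uhs hsP; pose F h := (#|[set v | ht v == h]%SET|)`!.
pose k := (\max_(x <- hs) x.1).+1.
have lt_k x : x \in hs -> x.1 < k by move=> xs; rewrite ltnS; apply: leq_bigmax_seq.
apply: leq_trans (card_layer_perms ht k).
apply: (@leq_trans (\prod_(x <- hs) F x.1)).
  rewrite big_seq [X in _ <= X]big_seq; elim/big_ind2: _ => // [a b c d|x xs]; first exact: leq_mul.
  by rewrite leq_fact // hsP.
rewrite -(big_map (fun x => x.1) xpredT F) -(big_mkord xpredT F) /index_iota subn0.
rewrite [X in _ <= X](bigID (mem [seq x.1 | x <- hs])) /=.
apply: (@leq_trans (\prod_(i <- iota 0 k | i \in [seq x.1 | x <- hs]) F i)).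
  rewrite -[X in _ <= X]big_filter; apply: eq_leq.
  have pe : perm_eq [seq x.1 | x <- hs] [seq i <- iota 0 k | i \in [seq x.1 | x <- hs]]; last by exact: perm_big pe.
  apply: uniq_perm => //.
    by rewrite filter_uniq ?iota_uniq.
  move=> h; rewrite mem_filter mem_iota add0n; apply: esym; apply: andb_idr.
  by case/mapP=> x /lt_k lt_x ->.
by rewrite leq_pmulr // prodn_gt0 // => i; rewrite fact_gt0.
Qed.

End LayerBounds.

Lemma leq_layer (K : choiceType) (s : seq K) (ht : K -> nat) (h c : nat) (f : nat -> K) :
  (forall i, i < c -> f i \in s /\ ht (f i) = h) ->
  (forall i j, i < c -> j < c -> f i = f j -> i = j) ->
  c <= #|[set v : seq_sub s | code_ht ht v == h]%SET|.
Proof.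
move=> fs inj_f; pose g (i : 'I_c) : seq_sub s := SeqSub (fs i (ltn_ord i)).1.
have inj_g : injective g.
  by move=> i j [e]; apply: val_inj; apply: inj_f e.
rewrite -{1}(card_ord c) -(card_imset _ inj_g); apply: subset_leq_card.
apply/fintype.subsetP => _ /imsetP[i _ ->]; rewrite inE /code_ht /=.
by rewrite (fs i (ltn_ord i)).2.
Qed.

(** * Evolution of the trunk weight and of the string flow *)

Section Runs.

Lemma run_up_ok W (l : seq nat) : all (leq 1) l -> run_ok W [seq Fk false x | x <- l].
Proof. by elim: l W => //= x l IH W /andP[-> /IH ->]. Qed.
Lemma run_up_weight W (l : seq nat) : run_weight W [seq Fk false x | x <- l] = W + (sumn l).*2.
Proof. by elim: l W => [|x l IH] W /=; rewrite ?addn0 // IH doubleD addnA. Qed.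

Lemma run_down_ok W (l : seq nat) : all (leq 1) l -> (sumn l).*2 < W ->
  run_ok W [seq Fk true x | x <- l].
Proof.
elim: l W => //= x l IH W /andP[x0 l0] lt_W; rewrite x0 /= IH //; last by lia.
by rewrite andbT; lia.
Qed.
Lemma run_down_weight W (l : seq nat) : run_weight W [seq Fk true x | x <- l] = W - (sumn l).*2.
Proof. by elim: l W => [|x l IH] W /=; rewrite ?subn0 // IH doubleD subnDA. Qed.

Lemma run_in_ok W (l : seq nat) : all odd l -> 1 < W -> run_ok W [seq Bk x 1 | x <- l].
Proof.
elim: l W => //= x l IH W /andP[ox ol] lt_W; rewrite lt_W ox /= IH //.
by have := odd_gt0 ox; lia.
Qed.
(** Stated additively, here and in [run_out_weight], to keep truncated subtraction out of the later
    arithmetic. *)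
Lemma run_in_weight W (l : seq nat) : all odd l -> 1 < W ->
  run_weight W [seq Bk x 1 | x <- l] + size l = W + sumn l.
Proof.
elim: l W => [|x l IH] W /=; rewrite ?addn0 // => /andP[ox ol] lt_W.
have x0 := odd_gt0 ox; have := IH (W - 1 + x) ol; lia.
Qed.

Lemma run_out_ok W (l : seq nat) : all odd l -> sumn l < W -> run_ok W [seq Bk 1 y | y <- l].
Proof.
elim: l W => //= y l IH W /andP[oy ol] lt_W; rewrite oy IH //; last by lia.
by rewrite andbT andbT; lia.
Qed.
Lemma run_out_weight W (l : seq nat) : all odd l -> sumn l < W ->
  run_weight W [seq Bk 1 y | y <- l] + sumn l = W + size l.
Proof.
elim: l W => [|y l IH] W /=; rewrite ?addn0 // => /andP[oy ol] lt_W.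
have := IH (W - y + 1) ol; lia.
Qed.

Lemma run_id_ok W n : 1 < W -> run_ok W (nseq n (Bk 1 1)) && (run_weight W (nseq n (Bk 1 1)) == W).
Proof.
move=> lt_W; elim: n => [|n IH] /=; first by rewrite eqxx.
by have -> : W - 1 + 1 = W by [lia]; rewrite lt_W.
Qed.

Lemma neg_run_down f (l : seq tail_t) : (f < 0)%R -> all (fun x => x.1.1) l -> neg_run f l.
Proof.
elim: l f => //= -[[d x] k] l IH f f0 /= /andP[-> al].
by rewrite /tail_flow /= IH // ?andbT; lia.
Qed.

Lemma flow_sum_down f (l : seq tail_t) : all (fun x => x.1.1) l ->
  flow_sum f l = (f - (sumn [seq x.1.2 | x <- l])%:Z)%R.
Proof.
elim: l f => [|[[d x] k] l IH] f /=; first by rewrite /flow_sum big_nil; lia.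
by case/andP=> -> al; rewrite flow_sum_cons IH // /tail_flow /=; lia.
Qed.

Lemma flow_sum_up f (l : seq tail_t) : all (fun x => ~~ x.1.1) l ->
  flow_sum f l = (f + (sumn [seq x.1.2 | x <- l])%:Z)%R.
Proof.
elim: l f => [|[[d x] k] l IH] f /=; first by rewrite /flow_sum big_nil; lia.
by case/andP=> /negbTE -> al; rewrite flow_sum_cons IH // /tail_flow /=; lia.
Qed.

Lemma neg_run_up f (l : seq tail_t) : all (fun x => ~~ x.1.1) l ->
  (f + (sumn [seq x.1.2 | x <- l])%:Z < 0)%R -> neg_run f l.
Proof.
elim: l f => //= -[[d x] k] l IH f /= /andP[/negbTE -> al].
by rewrite /tail_flow /= => h; rewrite IH // ?andbT; lia.
Qed.

End Runs.

Section FamilyTrunk.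
Variables (Ex Ox Ey Oy : seq nat) (K J Rf nbr : nat).
Hypothesis ExP : all (leq 1) Ex.
Hypothesis EyP : all (leq 1) Ey.
Hypothesis OxP : all odd Ox.
Hypothesis OyP : all odd Oy.
Hypothesis K_gt : (sumn Ey).*2 + sumn Oy < K.
Hypothesis J_eq : K.*2 + (sumn Ex).*2 + sumn Ox + size Oy = J.*2 + size Ox + (sumn Ey).*2 + sumn Oy.

Notation st := (trunk_steps Ex Ox Ey Oy K J Rf nbr).

(** [W1] to [W4] are the trunk weights after the raising forks, after [Ox], after [Ey] and after
    [Oy]. Taking in [Ox] never lowers the weight, and [K_gt] leaves room for everything given off
    afterwards. *)
Lemma family_trunk : run_ok 1 st /\ run_weight 1 st = 1.
Proof.
have upE n : nseq n (Fk false 1) = [seq Fk false x | x <- nseq n 1] by rewrite map_nseq.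
have downE n : nseq n (Fk true 1) = [seq Fk true x | x <- nseq n 1] by rewrite map_nseq.
have a1 n : all (leq 1) (nseq n 1) by rewrite all_nseq orbT.
have s1 n : sumn (nseq n 1) = n by rewrite sumn_nseq mul1n.
rewrite /trunk_steps /trunk_pre /trunk_post upE downE.
rewrite !run_ok_cat !run_weight_cat !run_up_weight !run_up_ok // s1.
set W1 := 1 + _ + _.
have W1gt : K < W1 by rewrite /W1; lia.
have h2 := run_in_ok OxP (ltac:(lia) : 1 < W1); have e2 := run_in_weight OxP (ltac:(lia) : 1 < W1).
rewrite h2; set W2 := run_weight W1 _ in e2 *.
have sO : size Ox <= sumn Ox.
  by elim: (Ox) OxP => //= x l IH /andP[/odd_gt0 x0 /IH]; lia.
have W2ge : W1 <= W2 by lia.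
rewrite run_down_weight run_down_ok //; last by lia.
set W3 := W2 - _.
have h4 : sumn Oy < W3 by rewrite /W3; lia.
rewrite run_out_ok //; have e4 := run_out_weight OyP h4.
set W4 := run_weight W3 _ in e4 *.
(* By [J_eq] exactly [J] splitting forks remain to be done. As [J] is positive, the branching pairs
   meet a weight above 1, as giving off weight 1 requires. *)
have W4E : W4 = 1 + J.*2 by move: e2 e4; rewrite /W3 /W1; lia.
have W4gt : 1 < W4.
  rewrite W4E; have : 0 < J by lia.
  by lia.
have /andP[-> /eqP ->] := run_id_ok nbr W4gt; have /andP[-> /eqP ->] := run_id_ok Rf W4gt.
by rewrite run_down_weight run_down_ok // s1 W4E; lia.
Qed.

End FamilyTrunk.

Section FamilyString.
Variables (o e : nat) (lae outs : seq nat) (K1 K2 : nat).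
Hypothesis le_e : 2 * o <= e.
Hypothesis K1_ge : sumn lae <= K1.
Hypothesis K2_eq : 2 * o + sumn lae + K2.*2 = e + K1.*2 + sumn outs.
Notation pre := (string_pre e lae outs K1 K2).

(** [K1] upward forks lower the flow by [2 K1], more than enough for the ends [lae] to raise it
    again without reaching 0. From then on it only increases, and [K2_eq] makes it stop at -1. *)
Lemma family_string : neg_run ((2 * o)%:Z - 1)%R pre /\
  flow_sum ((2 * o)%:Z - 1)%R pre = (-1)%R.
Proof.
have sO : sumn [seq x.1.2 | x <- [seq (true, x, 0) | x <- outs]] = sumn outs.
  by rewrite -map_comp map_id.
have sL : sumn [seq x.1.2 | x <- [seq (false, x, 0) | x <- lae]] = sumn lae.
  by rewrite -map_comp map_id.
have sN d n : sumn [seq x.1.2 | x <- nseq n (d, 2, 1)] = n.*2.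
  by rewrite map_nseq sumn_nseq mul2n.
have aT (l : seq nat) : all (fun x : tail_t => x.1.1) [seq (true, x, 0) | x <- l] by rewrite all_map all_predT.
have aF (l : seq nat) : all (fun x : tail_t => ~~ x.1.1) [seq (false, x, 0) | x <- l] by rewrite all_map all_predT.
have aTn n : all (fun x : tail_t => x.1.1) (nseq n (true, 2, 1)) by rewrite all_nseq orbT.
have aFn n : all (fun x : tail_t => ~~ x.1.1) (nseq n (false, 2, 1)) by rewrite all_nseq orbT.
rewrite /string_pre /= flow_sum_cons /tail_flow /= !neg_run_cat !flow_sum_cat.
rewrite !(flow_sum_down _ (aT _)) !(flow_sum_up _ (aF _)) !(flow_sum_down _ (aTn _)) !(flow_sum_up _ (aFn _)) !sN sO sL.
split; last by lia.
apply/and5P; split; last 1 first.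
- by apply: neg_run_up; rewrite ?aFn // sN; lia.
- by lia.
- by apply: neg_run_down; rewrite ?aTn //; lia.
- by apply: neg_run_down; rewrite ?aT //; lia.
- by apply: neg_run_up; rewrite ?aF // sL; lia.
Qed.

End FamilyString.

(** * Multiplicities of the end weights *)

Section FlattenCounts.
Variables (S K : Type) (a : pred K).
Implicit Type F : S -> seq K.

Lemma count_flatten_nseq F n x :
  count a (flatten (map F (nseq n x))) = n * count a (F x).
Proof. by elim: n => //= n IH; rewrite count_cat IH mulSn. Qed.

Lemma count_flatten_const F c (l : seq S) :
  (forall x, count a (F x) = c) -> count a (flatten (map F l)) = size l * c.
Proof. by move=> h; elim: l => //= x l IH; rewrite count_cat IH h mulSn. Qed.

Lemma count_flatten_mul F f c (l : seq S) :
  (forall x, count a (F x) = c * a (f x)) -> count a (flatten (map F l)) = c * count a (map f l).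
Proof. by move=> h; elim: l => [|x l IH] /=; rewrite ?muln0 // count_cat IH h mulnDr. Qed.

End FlattenCounts.

Lemma flatten_map_nth (S K : Type) (F : S -> seq K) x0 (l : seq S) :
  flatten [seq F (nth x0 l i) | i <- iota 0 (size l)] = flatten (map F l).
Proof. by congr flatten; rewrite (map_comp F (nth x0 l)) -/(mkseq _ _) mkseq_nth. Qed.

Section FamilyEnds.
Variables (o e : nat) (Ex Ox Ey Oy lae outs : seq nat).
Variables (K J Rf nbr K1 K2 L0 q r : nat).
Notation B := (bp o e Ex Ox Ey Oy lae outs K J Rf nbr K1 K2 L0 q r).
Notation pre := (string_pre e lae outs K1 K2).
Notation stpre := (trunk_pre Ex Ox Ey Oy K).
Notation stpost := (trunk_post J Rf).
Notation st := (trunk_steps Ex Ox Ey Oy K J Rf nbr).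
Notation tails := (string_tails e lae outs K1 K2 L0 q r).

Lemma trunk_ends_in : flatten [seq trunk_ends B false i | i <- iota 0 (nt B)] =
  o :: flatten (map step_in st).
Proof. exact: (flatten_map_nth step_in (Fk true 0) (Bk o 1 :: st)). Qed.

Lemma flatten_iota_last (x : nat) n :
  flatten [seq if i.+1 == n.+1 then [:: x] else [::] | i <- iota 0 n.+1] = [:: x].
Proof.
rewrite -addn1 iotaD map_cat flatten_cat /= addn1 eqxx.
rewrite (_ : flatten _ = [::]) // (_ : map _ _ = [seq [::] | i <- iota 0 n]).
  by elim: (iota 0 n).
apply/eq_in_map => i; rewrite mem_iota /= => lt_i.
by rewrite eqSS ltn_eqF.
Qed.

Lemma trunk_out_steps : flatten [seq trunk_out B i | i <- iota 0 (nt B)] =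
  flatten (map step_out stpre) ++ flatten (map step_out stpost).
Proof.
have outS i : trunk_out B i.+1 = if size stpre <= i < size stpre + nbr then [::]
    else step_out (nth (Fk true 0) st i) by [].
rewrite -[nt B]/(size st).+1 /= (iotaDl 1 0) -map_comp (eq_map (g := fun i => trunk_out B i.+1)) //.
move: outS; rewrite /trunk_steps; move: stpre stpost => l1 l2 outS.
rewrite !size_cat size_nseq iotaD iotaD map_cat map_cat flatten_cat flatten_cat add0n; congr cat.
  rewrite -[RHS](flatten_map_nth step_out (Fk true 0)); congr flatten; apply/eq_in_map => i.
  by rewrite mem_iota /= => lt_i; rewrite outS nth_cat lt_i ifF //; lia.
rewrite [X in X ++ _](_ : _ = [::]) /=; last first.
  rewrite (_ : map _ _ = [seq [::] | i <- iota (size l1) nbr]); first by elim: (iota _ _).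
  by apply/eq_in_map => i; rewrite mem_iota outS => ->.
rewrite -[RHS](flatten_map_nth step_out (Fk true 0)); congr flatten.
rewrite -{1}[size l1 + nbr]addn0 iotaDl -map_comp; apply/eq_in_map => i.
rewrite mem_iota /= => lt_i; rewrite outS ifF; last by lia.
by rewrite catA nth_cat size_cat size_nseq ifF ?addKn //; lia.
Qed.

Lemma trunk_ends_out : 0 < K -> run_weight 1 st = 1 ->
  perm_eq (flatten [seq trunk_ends B true i | i <- iota 0 (nt B)])
    (1 :: flatten (map step_out stpre) ++ flatten (map step_out stpost)).
Proof.
move=> K0 w1; apply: perm_trans (perm_flatten_cat (trunk_out B)
  (fun i => if i.+1 == nt B then [:: main_weight B i] else [::]) _) _.
have main i : i.+1 == nt B -> main_weight B i = 1.
  move=> /eqP e1; have e2 : size st = i by case: e1.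
  have i0 : 0 < i by rewrite -e2 !size_cat size_nseq; lia.
  by rewrite /main_weight -(@WS B i i0) -e2 bp_weight ?take_size.
rewrite trunk_out_steps perm_catC -cat1s.
rewrite [X in X ++ _](_ : _ = [:: 1]) // -[RHS](flatten_iota_last 1 (size st)); congr flatten.
by apply/eq_in_map => i _; case: ifP => // /main ->.
Qed.

Definition tail_ends (d : bool) (x : tail_t) : seq nat :=
  if x.1.1 == d then if x.2 == 0 then [:: x.1.2] else [:: 1; 1] else [::].

Lemma string_ends_tails d : flatten [seq string_ends B d i | i <- iota 0 (nl B)] =
  flatten (map (tail_ends d) tails).
Proof.
rewrite -[nl B](size_tails e lae outs K1 K2 L0 q r).
exact: (flatten_map_nth (tail_ends d) (true, 2, 0) tails).
Qed.

Lemma count_zigzag (a : pred nat) d :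
  count a (flatten (map (tail_ends d) (mkseq (zigzag_tail L0 q r) L0))) =
  (if d then L0./2 else uphalf L0) * 2 * a 1.
Proof.
(* The induction runs over the number of tails; the [L0] inside [zigzag_tail], which fixes their
   lengths, stays put. *)
rewrite /mkseq; elim: {2 3 4}L0 => [|k IH]; first by case: d; rewrite mul0n.
rewrite -addn1 iotaD !map_cat flatten_cat count_cat {}IH add0n /= cats0.
rewrite [tail_ends d _]/tail_ends /zigzag_tail; case ok: (odd k); case: d => /=; rewrite ?addn0 /=.
all: try by case: (a 1); lia.
rewrite [X in if X then _ else _](_ : _ = false); last by case: (k./2 < L0./2).
have -> : uphalf (k + 1) = (uphalf k).+1 by lia.
by rewrite mulSn mulnDl /=; move: (uphalf k * 2 * a 1) => X; lia.
Qed.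

Lemma count_string_in (a : pred nat) : count a (flatten (map (tail_ends false) tails)) =
  count a lae + (K2 + uphalf L0) * 2 * a 1.
Proof.
rewrite /string_tails /string_pre map_cat flatten_cat count_cat count_zigzag /=.
rewrite !map_cat !flatten_cat !count_cat !count_flatten_nseq /= -!map_comp.
rewrite (@count_flatten_const _ _ _ _ 0) // (@count_flatten_mul _ _ _ _ id 1) ?map_id; last by move=> x /=; lia.
by case: (a 1); lia.
Qed.

Lemma count_string_out (a : pred nat) : count a (flatten (map (tail_ends true) tails)) =
  a e + count a outs + (K1 + L0./2) * 2 * a 1.
Proof.
rewrite /string_tails /string_pre map_cat flatten_cat count_cat count_zigzag /=.
rewrite !map_cat !flatten_cat !count_cat !count_flatten_nseq /= -!map_comp.
rewrite (@count_flatten_mul _ _ _ _ id 1) ?map_id; last by move=> x /=; lia.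
rewrite (@count_flatten_const _ _ _ _ 0) //.
by case: (a 1); lia.
Qed.

Lemma count_trunk_in (a : pred nat) : count a (flatten (map step_in st)) =
  2 * count a Ex + count a Ox + (K.*2 + size Oy + nbr + Rf) * a 1.
Proof.
rewrite /trunk_steps /trunk_pre /trunk_post !map_cat !flatten_cat !count_cat !count_flatten_nseq /= -!map_comp.
rewrite (@count_flatten_mul _ _ _ _ id 2); last by move=> x /=; lia.
rewrite (@count_flatten_mul _ _ _ _ id 1); last by move=> x /=; lia.
rewrite (@count_flatten_const _ _ _ _ 0) // (@count_flatten_const _ _ _ _ (a 1)); last by move=> x /=; lia.
by rewrite !map_id; case: (a 1); lia.
Qed.

Lemma count_trunk_out (a : pred nat) :
  count a (flatten (map step_out stpre)) + count a (flatten (map step_out stpost)) =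
  2 * count a Ey + count a Oy + (size Ox + Rf + J.*2) * a 1.
Proof.
rewrite /trunk_pre /trunk_post !map_cat !flatten_cat !count_cat !count_flatten_nseq /= -!map_comp.
rewrite (@count_flatten_const _ _ _ _ 0 Ex) // (@count_flatten_const _ _ _ _ (a 1) Ox); last by move=> x /=; lia.
rewrite (@count_flatten_mul _ _ _ _ id 2); last by move=> x /=; lia.
rewrite (@count_flatten_mul _ _ _ _ id 1); last by move=> x /=; lia.
by rewrite !map_id; case: (a 1); lia.
Qed.

End FamilyEnds.

Lemma count_branches (a : pred nat) d n : 
  count a (flatten [seq branch_ends d | j <- iota 0 n]) = n * (if d then 3 else 2) * a 1.
Proof.
rewrite (@count_flatten_const _ _ _ _ (count a (branch_ends d))) // size_iota.
by case: d => /=; case: (a 1); lia.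
Qed.

Section FamilyCount.
Variables (R : realType) (o e : nat) (Ex Ox Ey Oy lae outs : seq nat).
Variables (K J Rf nbr K1 K2 L0 q r : nat).
Hypothesis o3 : 3 <= o.
Hypothesis odd_o : odd o.
Hypothesis even_e : ~~ odd e.
Hypothesis le_e : 2 * o <= e.
Hypothesis laeP : all (fun x => (0 < x) && ~~ odd x) lae.
Hypothesis outsP : all (fun x => (0 < x) && ~~ odd x) outs.
Hypothesis ExP : all (leq 1) Ex.
Hypothesis EyP : all (leq 1) Ey.
Hypothesis OxP : all odd Ox.
Hypothesis OyP : all odd Oy.
Hypothesis K_gt : (sumn Ey).*2 + sumn Oy < K.
Hypothesis J_eq : K.*2 + (sumn Ex).*2 + sumn Ox + size Oy = J.*2 + size Ox + (sumn Ey).*2 + sumn Oy.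
Hypothesis K1_ge : sumn lae <= K1.
Hypothesis K2_eq : 2 * o + sumn lae + K2.*2 = e + K1.*2 + sumn outs.
Hypothesis L0_ge2 : 2 <= L0.
Hypothesis r_lt : r < L0./2.

Notation B := (bp o e Ex Ox Ey Oy lae outs K J Rf nbr K1 K2 L0 q r).
Notation pre := (string_pre e lae outs K1 K2).
Notation st := (trunk_steps Ex Ox Ey Oy K J Rf nbr).
Notation tails := (string_tails e lae outs K1 K2 L0 q r).

(** Every branch accounts for three ones on each side: incoming, the end taken in by its trunk pair
    and the two merged ends; outgoing, the three ends of its splitting pair. The last summand is the
    final end of the string, incoming exactly when [L0] is even. *)
Definition in_ones := K.*2 + size Oy + 3 * nbr + Rf + (K2 + uphalf L0) * 2 + ~~ odd L0.
Definition out_ones := 1 + size Ox + 3 * nbr + Rf + J.*2 + (K1 + L0./2) * 2 + odd L0.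

Let bok : blueprint_ok B.
Proof.
have [t1 t2] := family_trunk Rf nbr ExP EyP OxP OyP K_gt J_eq.
have [s1 s2] := family_string le_e K1_ge K2_eq.
by apply: bp_is_ok => //; clear -K_gt; lia.
Qed.

Lemma last_end_ones d : last_end B d = nseq (if d then odd L0 else ~~ odd L0) 1.
Proof.
have fz := @bp_flow_zz o e Ex Ox Ey Oy lae outs K J Rf nbr K1 K2 L0 q r.
rewrite /last_end -[nl B]/(size pre + L0) fz //; last by have [] := family_string le_e K1_ge K2_eq.
by case: (odd L0); case: d.
Qed.

Lemma family_in : perm_eq (end_weights (ctree bok) false)
  ([:: o; o] ++ lae ++ Ex ++ Ex ++ Ox ++ nseq in_ones 1).
Proof.
apply: perm_trans (blueprint_end_weights bok false) _; apply/seq.permP => a.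
rewrite last_end_ones trunk_ends_in string_ends_tails.
have := count_string_in e lae outs K1 K2 L0 q r a; move: (flatten (map _ tails)) => T cT.
rewrite !count_cat !count_nseq count_branches {}cT.
rewrite -[count a (o :: flatten _)]/(a o + count a (flatten (map step_in st))) count_trunk_in /in_ones /=.
by clear; case: (a 1); case: (odd L0) => /=; lia.
Qed.

Lemma family_out : perm_eq (end_weights (ctree bok) true)
  (e :: outs ++ Ey ++ Ey ++ Oy ++ nseq out_ones 1).
Proof.
have w1 : run_weight 1 st = 1 by have [] := family_trunk Rf nbr ExP EyP OxP OyP K_gt J_eq.
apply: perm_trans (blueprint_end_weights bok true) _; apply/seq.permP => a.
have /seq.permP/(_ a) te := trunk_ends_out o e lae outs K1 K2 L0 q r (ltac:(lia) : 0 < K) w1.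
rewrite last_end_ones string_ends_tails.
have := count_string_out e lae outs K1 K2 L0 q r a; move: (flatten (map _ tails)) => T cT.
move: te; move: (flatten [seq trunk_ends _ _ _ | _ <- _]) => T1 te.
rewrite !count_cat {}te !count_nseq count_branches {}cT.
rewrite -[count a (1 :: _)]/(a 1 + count a _) count_cat count_trunk_out -[e :: _]cat1s.
rewrite !count_cat count_nseq /out_ones.
by clear; case: (a 1); case: (odd L0) => /=; lia.
Qed.

Lemma family_npairs : npairs B =
  1 + K + size Ex + size Ox + size Ey + size Oy + 3 * nbr + Rf + J.
Proof.
rewrite /npairs size_pairs -[nt B]/(size st).+1 -[nb B]/nbr.
by rewrite /trunk_steps /trunk_pre /trunk_post !size_cat !size_map !size_nseq; lia.
Qed.

Lemma zigzag_size : sumn [seq x.2.+1 | x <- mkseq (zigzag_tail L0 q r) L0] =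
  2 * L0 + 2 * (q * L0./2 + r).
Proof.
(* [minn (uphalf k) r] counts the even indices below [k] whose tail carries one of the [r] extra
   cycles. For odd [L0] the last lower vertex has no partner and carries no cycle, so it is added
   separately. *)
have H k : k <= (L0./2).*2 -> sumn [seq x.2.+1 | x <- mkseq (zigzag_tail L0 q r) k] =
    2 * k + 2 * (q * uphalf k + minn (uphalf k) r).
  elim: k => [|k IH] lt_k; first by rewrite /= !muln0 min0n.
  rewrite mkseqS map_rcons -cats1 sumn_cat IH 1?ltnW // /= /zigzag_tail.
  case ok: (odd k) => /=.
    have uE : uphalf k = k./2.+1 by clear -ok; lia.
    by rewrite uE; clear; lia.
  have -> : uphalf k = k./2 by clear -ok; lia.
  by have -> : k./2 < L0./2 by [clear -lt_k ok; lia]; clear; case: ltnP => h /=; lia.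
have [odL|] := boolP (odd L0) => [|evL]; last first.
  have E : L0 = (L0./2).*2 by lia.
  rewrite {2}E H // -E; have -> : uphalf L0 = L0./2 by lia.
  by rewrite (minn_idPr (ltnW r_lt)).
have E : L0 = (L0./2).*2.+1 by lia.
rewrite {2}E mkseqS map_rcons -cats1 sumn_cat H // uphalf_double (minn_idPr (ltnW r_lt)).
by rewrite /zigzag_tail odd_double doubleK ltnn /=; lia.
Qed.

Lemma family_nstring : nstring B =
  1 + K1.*2 + size outs + size lae + K2.*2 + 2 * L0 + 2 * (q * L0./2 + r).
Proof.
have -> : nstring B = sumn [seq x.2.+1 | x <- tails].
  rewrite /nstring size_allpairs_dep; congr sumn.
  have -> : tails = mkseq (nth (true, 2, 0) tails) (size tails) by rewrite mkseq_nth.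
  rewrite -[nl B](size_tails e lae outs K1 K2 L0 q r) -map_comp; apply: eq_map => i /=.
  by rewrite size_iota.
rewrite /string_tails map_cat sumn_cat zigzag_size /string_pre /= !map_cat !sumn_cat.
rewrite !map_nseq -!map_comp !sumn_nseq.
have s1 (l : seq nat) : sumn [seq 1 | _ <- l] = size l by elim: l => //= x l ->.
by rewrite (eq_map (g := fun=> 1)) // (@eq_map _ _ _ (fun=> 1) _ lae) // !s1 /=; lia.
Qed.

(** The layer at height [nt] consists of the merging pairs, one per branch. *)
Lemma family_pair_layers : nbr`! <= #|layer_perms (code_ht (pair_ht B) (s := pairs B))|.
Proof.
have -> : nbr`! = \prod_(x <- [:: (nt B, nbr)]) (x.2)`! by rewrite big_cons big_nil muln1.
apply: prod_fact_layers => // x; rewrite inE => /eqP -> /=.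
apply: (leq_layer (f := fun j => inr (j, false))) => [j lt_j|i j _ _ [//]].
by rewrite mem_pairs_inr /= addn0.
Qed.

(** The heights from 3 to [M] are each reached by all [n0] downward tails, their spine vertices
    included, and the heights 1 and 2 only by the [r] tails with an extra cycle. The two top layers
    are the upper spine vertices and the upward forks. This gives [q.*2 + 2 + 2] layers of size
    [n0]. *)
Lemma family_string_layers : (L0./2)`! ^ (q.*2 + 4) * r`! ^ 2 <=
  #|layer_perms (code_ht (string_ht B) (s := snodes B))|.
Proof.
pose n0 := L0./2; pose M := q.*2 + 4.
pose hs := (1, r) :: (2, r) :: [seq (h, n0) | h <- iota 3 (q.*2 + 2)]
  ++ [:: (M + size pre + 2, n0); (M + size pre + 3, n0)].
have -> : n0`! ^ (q.*2 + 4) * r`! ^ 2 = \prod_(x <- hs) (x.2)`!.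
  rewrite !big_cons big_cat !big_cons big_nil big_map /= big_const_seq count_predT size_iota.
  rewrite iter_muln_1 muln1 mulnA mulnC -!mulnn; congr (_ * _).
  by rewrite !expnD; lia.
have Pn0 : 0 < size pre by [].
have ht0 i : i < n0 -> (size pre + i.*2 < nl B) /\ tail_at e lae outs K1 K2 L0 q r (size pre + i.*2) =
    (false, 2, (q + (i < r)).*2.+1).
  move=> lt_i; have lt2 : i.*2 < L0 by rewrite /n0 in lt_i; lia.
  by rewrite tail_at_zz // /zigzag_tail odd_double doubleK lt_i -[nl B]/(size pre + L0) ltn_add2l.
have ht1 i : i < n0 -> (size pre + i.*2.+1 < nl B) /\ tail_at e lae outs K1 K2 L0 q r (size pre + i.*2.+1) =
    (true, 2, 1).
  move=> lt_i; have lt2 : i.*2.+1 < L0 by rewrite /n0 in lt_i; lia.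
  by rewrite tail_at_zz // /zigzag_tail oddS odd_double -[nl B]/(size pre + L0) ltn_add2l.
have down h c : 0 < h <= M -> c <= n0 -> (forall i, i < c -> M - h <= (q + (i < r)).*2.+1) ->
    c <= #|[set v : seq_sub (snodes B) | code_ht (string_ht B) v == h]%SET|.
  move=> hM cn hc; apply: (leq_layer (f := fun i => (size pre + i.*2, M - h))).
    move=> i lt_i; have [lt_n tE] := ht0 i (leq_trans lt_i cn).
    rewrite mem_snodes lt_n -[tl B _]/((tail_at e lae outs K1 K2 L0 q r (size pre + i.*2)).2) tE hc //.
    split=> //; rewrite /string_ht -[sht B]/(string_height e lae outs K1 K2 L0 q r) /= /string_height.
    case E: (M - h) => [|j]; last by rewrite tE /=; lia.
    by clear -E Pn0 hM; case E2: (size pre + i.*2) => [|k]; [lia|]; rewrite ifF ?ifF; lia.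
  by clear; move=> i j _ _ [] ?; lia.
have up (b : bool) : n0 <= #|[set v : seq_sub (snodes B) | code_ht (string_ht B) v == M + size pre + 2 + b :> nat]%SET|.
  apply: (leq_layer (f := fun i => (size pre + i.*2.+1, b : nat))).
    move=> i lt_i; have [lt_n tE] := ht1 i lt_i.
    rewrite mem_snodes lt_n -[tl B _]/((tail_at e lae outs K1 K2 L0 q r (size pre + i.*2.+1)).2) tE leq_b1.
    split=> //; rewrite /string_ht -[sht B]/(string_height e lae outs K1 K2 L0 q r) /= /string_height.
    case: b; first by rewrite tE /=; lia.
    rewrite addn0; clear -Pn0; by case E2: (size pre + i.*2.+1) => [|k]; [lia|]; rewrite ifF ?ifT //; lia.
  by clear; move=> i j _ _ [] ?; lia.
apply: prod_fact_layers.
  rewrite /hs /= map_cat -map_comp (eq_map (g := id)) // map_id.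
  rewrite !inE !mem_cat !mem_iota !inE cat_uniq iota_uniq /= !inE !mem_iota.
  by rewrite /M; clear; lia.
move=> x; rewrite /hs !inE mem_cat !inE => /or4P[/eqP->|/eqP->|/mapP[h + ->]|/orP[]/eqP->] /=.
- by apply: down => [||i lt_i]; rewrite /M ?lt_i; clear -r_lt; lia.
- by apply: down => [||i lt_i]; rewrite /M ?lt_i; clear -r_lt; lia.
- by rewrite mem_iota => hh; apply: down => [||i lt_i]; rewrite /M; clear -hh; lia.
- by have := up false; rewrite addn0.
- by have := up true; rewrite -addnA.
Qed.

Theorem family_count (w : nat -> R) (la mu : seq nat) (g s t : nat) :
  {homo w : i j / i < j >-> (i < j)%R} ->
  perm_eq ([:: o; o] ++ lae ++ Ex ++ Ex ++ Ox ++ nseq in_ones 1) la ->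
  perm_eq (e :: outs ++ Ey ++ Ey ++ Oy ++ nseq out_ones 1) mu ->
  g = q * L0./2 + r ->
  s = 1 + K + size Ex + size Ox + size Ey + size Oy + 3 * nbr + Rf + J ->
  t = 1 + K1.*2 + size outs + size lae + K2.*2 + 2 * L0 + 2 * g ->
  nbr`! * ((L0./2)`! ^ (q.*2 + 4) * r`! ^ 2) <= proper_zigzag_number w g la mu s t.
Proof.
move=> wm pla pmu gE sE tE.
have := leq_layer_perms_zigzag wm (perm_trans family_in pla) (perm_trans family_out pmu).
move=> /(_ g); rewrite family_npairs family_nstring -gE -sE -tE => H.
apply: leq_trans (H _).
  exact: leq_mul family_pair_layers family_string_layers.
(* What remains is [genus_ok], an identity in the parameters that reflects trivalence. *)
rewrite -(perm_size pla) -(perm_size pmu) -[e :: _]cat1s !size_cat !size_nseq /in_ones /out_ones sE tE.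
by clear; case oL: (odd L0) => /=; lia.
Qed.

End FamilyCount.

(** * Decomposing the two partitions *)

(** Take each distinct entry with half of its multiplicity. *)
Lemma perm_double (l : seq nat) : {in l, forall x, ~~ odd (count_mem x l)} ->
  exists2 l2, perm_eq l (l2 ++ l2) & {subset l2 <= l}.
Proof.
move=> ev; exists (flatten [seq nseq (count_mem x l)./2 x | x <- undup l]); last first.
  move=> y /flatten_mapP[x]; rewrite mem_undup => xl /nseqP[-> _]; exact: xl.
rewrite perm_sym; apply: perm_trans (perm_count_undup l); apply/seq.permP => a.
rewrite count_cat !count_flatten -!map_comp !sumnE !big_map -big_split /=.
rewrite !big_seq; apply: eq_bigr => x; rewrite mem_undup => xl.
by rewrite !count_nseq -mulnDr addnn even_halfK // ev.
Qed.

Lemma perm_even_odd (l : seq nat) : is_partition l ->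
  (forall x, ~~ odd x -> ~~ odd (count_mem x l)) ->
  exists E O, [/\ perm_eq l (E ++ E ++ O), all (leq 1) E & all odd O].
Proof.
move=> l0 ev; pose s := [seq x <- l | ~~ odd x].
have [|E pE sE] := @perm_double s.
  move=> x; rewrite mem_filter => /andP[ex _]; rewrite count_filter.
  rewrite (eq_count (a2 := pred1 x)) ?ev // => y /=.
  by case: eqP => // ->.
exists E, [seq x <- l | odd x]; split.
- apply: (@perm_trans _ (s ++ [seq x <- l | odd x])); last by rewrite catA perm_cat2r.
  by rewrite perm_sym perm_catC perm_filterC.
- apply/allP => x /sE; rewrite mem_filter lt0n => /andP[_ xl].
  by apply: contra l0 => /eqP <-.
- exact: filter_all.
Qed.

Lemma perm_remove_entries (nu l : seq nat) :
  (forall x, count_mem x nu <= count_mem x l) -> perm_eq l (nu ++ remove_entries nu l).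
Proof.
elim: nu => [|k nu IH] h //=.
have {}IH : perm_eq l (nu ++ remove_entries nu l).
  by apply: IH => x; apply: leq_trans (h x); rewrite leq_addl.
have kR : k \in remove_entries nu l.
  have := h k; rewrite (seq.permP IH) count_cat /= eqxx add1n -addn1 leq_add2l.
  by rewrite -has_count has_pred1.
apply: perm_trans IH _; rewrite -cat_cons perm_sym -[_ :: _]cat1s -catA perm_catCA perm_cat2l cat1s.
by rewrite perm_sym perm_to_rem.
Qed.

Lemma count_even_part x (l : seq nat) :
  count_mem x (even_part l) = ~~ odd x && odd (count_mem x l).
Proof.
rewrite count_uniq_mem ?filter_uniq ?undup_uniq // mem_filter mem_undup.
case: (boolP (x \in l)) => [_|nx]; rewrite ?andbT // andbF.
by rewrite (count_memPn nx) andbF.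
Qed.

Lemma even_partP (l : seq nat) : is_partition l ->
  all (fun x => (0 < x) && ~~ odd x) (even_part l).
Proof.
move=> l0; apply/allP => x; rewrite mem_filter mem_undup => /andP[/andP[-> _] xl].
by rewrite andbT lt0n; apply: contra l0 => /eqP <-.
Qed.

Lemma decompose_la (la : seq nat) (o : nat)
    (la' := remove_entries (even_part la ++ [:: o; o]) la) :
  is_partition la -> odd o -> 2 <= count_mem o la -> exists Ex Ox,
  [/\ perm_eq ([:: o; o] ++ even_part la ++ Ex ++ Ex ++ Ox) la, all (leq 1) Ex, all odd Ox &
      size la' = (size Ex).*2 + size Ox].
Proof.
move=> hla ho ho2.
have pla : perm_eq la ((even_part la ++ [:: o; o]) ++ la').
  apply: perm_remove_entries => x; rewrite count_cat count_even_part /= addn0 addnn.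
  have [<-|ne] := eqVneq o x; first by rewrite ho.
  by rewrite addn0; case: (odd x) => //=; case: (count_mem x la) => // n; apply: leq_trans (leq_b1 _) _.
have la0 : is_partition la'.
  by apply: contra hla => h; rewrite (perm_mem pla) mem_cat h orbT.
have [|Ex [Ox [pE E1 O1]]] := perm_even_odd la0.
  move=> x ex; have /seq.permP/(_ (pred1 x)) := pla; rewrite !count_cat count_even_part ex /=.
  have -> : (o == x) = false by apply: contraNF ex => /eqP <-.
  by lia.
exists Ex, Ox; split=> //; last by rewrite (perm_size pE) !size_cat addnA addnn.
rewrite perm_sym; apply: perm_trans pla _; rewrite -!catA perm_catCA perm_cat2l perm_cat2l.
exact: pE.
Qed.

(** One copy of [e] must be set aside for the end at [v_2]. If [e] has odd multiplicity it comes
    from [even_part mu]. Otherwise a pair [e, e] of equal entries is broken: one copy goes to [v_2],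
    the other joins [outs] as a single even end, and [d] records this. *)
Lemma decompose_mu (mu : seq nat) (e : nat) (mu' := remove_entries (even_part mu) mu) :
  is_partition mu -> ~~ odd e -> e \in mu -> exists outs Ey Oy (d : bool),
  [/\ perm_eq (e :: outs ++ Ey ++ Ey ++ Oy) mu,
      [/\ all (fun x => (0 < x) && ~~ odd x) outs, all (leq 1) Ey & all odd Oy],
      size mu' = (size Ey).*2 + size Oy + d.*2 &
      size (even_part mu) + d.*2 = 1 + size outs].
Proof.
move=> hmu he hemu.
have pmu : perm_eq mu (even_part mu ++ mu').
  apply: perm_remove_entries => x; rewrite count_even_part.
  by case: (odd x) => //=; case: (count_mem x mu) => // n; apply: leq_trans (leq_b1 _) _.
have mu0 : is_partition mu'.
  by apply: contra hmu => h; rewrite (perm_mem pmu) mem_cat h orbT.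
have [|Ey [Oy [pE E1 O1]]] := perm_even_odd mu0.
  move=> x ex; have /seq.permP/(_ (pred1 x)) := pmu; rewrite !count_cat count_even_part ex /=.
  by lia.
have evP := even_partP hmu.
have e_gt0 : 0 < e by rewrite lt0n; apply: contra hmu => /eqP <-.
have [ein|eout] := boolP (e \in even_part mu).
  have pe := perm_to_rem ein.
  exists (rem e (even_part mu)), Ey, Oy, false; split.
  - rewrite -cat_cons; apply: perm_trans (_ : perm_eq _ (even_part mu ++ mu')) _.
      by rewrite perm_sym; apply: perm_cat.
    by rewrite perm_sym.
  - by split=> //; apply/allP => x /mem_rem; apply: (allP evP).
  - by rewrite (perm_size pE) !size_cat addn0 addnA addnn.
  - by rewrite (perm_size pe) addn0.
have eEy : e \in Ey.
  have : e \in mu' by move: hemu; rewrite (perm_mem pmu) mem_cat (negbTE eout).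
  rewrite (perm_mem pE) !mem_cat => /or3P[] // /(allP O1); by rewrite (negbTE he).
have pe := perm_to_rem eEy.
exists (e :: even_part mu), (rem e Ey), Oy, true; split.
- rewrite perm_sym; apply: perm_trans pmu _; apply/seq.permP => a.
  rewrite count_cat (seq.permP pE) !count_cat (seq.permP pe) /= !count_cat /=; clear; lia.
- split=> //; first by rewrite /= e_gt0 he.
  by apply/allP => x /mem_rem; apply: (allP E1).
- by rewrite (perm_size pE) !size_cat (perm_size pe) /=; clear; lia.
- by rewrite /=; clear; lia.
Qed.

Lemma odd_sumn (l : seq nat) : all odd l -> size l <= sumn l /\ odd (sumn l) = odd (size l).
Proof.
elim: l => //= x l IH /andP[ox /IH[le_l oe]]; rewrite oddD ox oe; split=> //.
by have := odd_gt0 ox; lia.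
Qed.

Lemma even_sumn (l : seq nat) : all (fun x => (0 < x) && ~~ odd x) l -> ~~ odd (sumn l).
Proof. by elim: l => //= x l IH /andP[/andP[_ ex] /IH el]; rewrite oddD (negbTE ex). Qed.

Lemma double_sub x y : y <= x -> odd x = odd y -> exists k, x = k.*2 + y.
Proof. by move=> le_yx e; exists (x - y)./2; lia. Qed.

(** The constant [C] is chosen before the points [w], as these may vary with [g], [h] and [m] in the
    limit. *)
Theorem leq_z_num (la mu : seq nat) (o e : nat) :
  is_partition la -> is_partition mu -> sumn la = sumn mu ->
  odd o -> o <> 1 -> 2 <= count_mem o la -> ~~ odd e -> 2 * o <= e -> e \in mu ->
  exists C : nat, forall (R : realType) (w : nat -> R) (g h m : nat),
    {homo w : i j / i < j >-> (i < j)%R} -> C <= h -> C <= m ->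
  exists nbr n0, [/\ h <= 3 * nbr + C, m <= n0 + C, 0 < n0 &
    nbr`! * (n0`! ^ ((g %/ n0).*2 + 4) * (g %% n0)`! ^ 2) <= z_num w la mu o g h m].
Proof.
move=> hla hmu hsum ho ho1 ho2 he heo hemu.
have [Ex [Ox [pla ExP OxP sla]]] := decompose_la hla ho ho2.
have [outs [Ey [Oy [d [pmu [outsP EyP OyP] smu s_mue]]]]] := decompose_mu hmu he hemu.
have laeP := even_partP hla.
have [leOx oOx] := odd_sumn OxP; have [leOy oOy] := odd_sumn OyP.
have ev_lae := even_sumn laeP; have ev_outs := even_sumn outsP.
have sum_la := perm_sumn pla; rewrite !sumn_cat /= in sum_la.
have sum_mu := perm_sumn pmu; rewrite /= !sumn_cat /= in sum_mu.
pose K := ((sumn Ey).*2 + sumn Oy).+1; pose K1 := sumn (even_part la).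
have KE : K = ((sumn Ey).*2 + sumn Oy).+1 by [].
have K1E : K1 = sumn (even_part la) by [].
clearbody K K1.
(* The trunk has to return to weight 1. The drop required is even since a sum of odd entries has the
   parity of their number; [K2] is obtained in the same way, all entries on the string being
   even. *)
have [||J J_eq] := @double_sub (K.*2 + (sumn Ex).*2 + sumn Ox + size Oy)
  (size Ox + (sumn Ey).*2 + sumn Oy).
- by rewrite KE; clear -leOx; lia.
- by rewrite !oddD !odd_double oOx oOy; case: (odd _); case: (odd _).
have [||K2 K2_eq] := @double_sub (e + K1.*2 + sumn outs) (2 * o + sumn (even_part la)).
- by rewrite K1E; clear -heo; lia.
- by rewrite mul2n !oddD !odd_double (negbTE he) (negbTE ev_lae) (negbTE ev_outs).
have bal : sumn (even_part la) + 2 * o + 2 * sumn Ex + sumn Ox = e + sumn outs + 2 * sumn Ey + sumn Oy.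
  by clear -sum_la sum_mu hsum; lia.
have [||k kE] := @double_sub (size Ox + size Oy) 0 => //.
  have := congr1 odd bal; rewrite !mul2n !oddD !odd_double (negbTE he) (negbTE ev_lae).
  by rewrite (negbTE ev_outs) oOx oOy /= => ->; rewrite addbb.
pose c := c_num la mu o; have cE : c_num la mu o = c by [].
clearbody c.
(* [C] dominates the differences between [h] and [3 nbr] and between [m] and [n0]; the 10 is
   generous slack for the small additive constants. *)
pose C := 10 + K + size Ex + size Ox + size Ey + size Oy + J + K1 + K2.
exists C => R w g h m wm le_h le_m.
have dE : d <= 1 by exact: leq_b1.
(* [L0] is forced by the prescribed number [t_num] of single points, and [Rt], the number of neutral
   and branch pairs, by [s_num]. Division of [Rt] by 3 then gives [nbr] and [Rf]. *)
have [L0 L0E] : exists L0, L0 + (1 + d + K1 + K2) = 2 * m + c.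
  by exists (2 * m + c - (1 + d + K1 + K2)); clear -le_m dE; lia.
have [Rt RtE] : exists Rt, Rt + (1 + K + size Ox + size Oy + J) = k + d + c + h.
  exists (k + d + c + h - (1 + K + size Ox + size Oy + J)).
  by clear -le_h; lia.
have [N NE] : exists N, N + 1 = 2 * c + h + 2 * m.
  by exists (2 * c + h + 2 * m - 1); clear -le_h; lia.
have L0_half := odd_double_half L0; have oL0 : odd L0 <= 1 by exact: leq_b1.
have uL0 : uphalf L0 = odd L0 + L0./2 by exact: uphalf_half.
have Rt_div := divn_eq Rt 3; have Rt_mod : Rt %% 3 < 3 by rewrite ltn_mod.
have n0_gt0 : 0 < L0./2 by clear -L0E L0_half oL0 le_m dE; lia.
have r_lt : g %% L0./2 < L0./2 by rewrite ltn_mod.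
have L0_ge2 : 2 <= L0 by clear -n0_gt0 L0_half; lia.
have o3 : 3 <= o by move: ho ho1; clear; case: o => [|[|[|]]].
exists (Rt %/ 3), L0./2; split=> //.
- by clear -RtE Rt_div Rt_mod; lia.
- by clear -L0E L0_half oL0 dE; lia.
rewrite /z_num cE (_ : _ - 1 = N); last by clear -NE; lia.
apply: (@family_count R o e Ex Ox Ey Oy (even_part la) outs K J (Rt %% 3) (Rt %/ 3) K1 K2 L0
  (g %/ L0./2) (g %% L0./2)) => //.
- by rewrite KE.
- by rewrite J_eq !addnA.
- by rewrite K1E.
- by rewrite K2_eq addnC.
- apply: perm_trans (_ : perm_eq _ (([:: o; o] ++ even_part la ++ Ex ++ Ex ++ Ox) ++ nseq N 1)) _.
    rewrite (_ : in_ones _ _ _ _ _ _ = N); first by rewrite -!catA.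
    rewrite /in_ones.
    (* With both lengths fixed, the number of ones comes out as prescribed: [J_eq], [K2_eq] and the
       equality of the two sums cancel all auxiliary parameters. *)
    clear -RtE Rt_div L0E L0_half uL0 NE J_eq K2_eq kE bal; case: (odd L0) L0_half uL0 => /=; lia.
  by rewrite perm_cat2r.
- apply: perm_trans (_ : perm_eq _ ((e :: outs ++ Ey ++ Ey ++ Oy) ++ nseq N 1)) _.
    rewrite (_ : out_ones _ _ _ _ _ _ = N); first by rewrite cat_cons -!catA.
    rewrite /out_ones.
    clear -RtE Rt_div L0E L0_half NE J_eq K2_eq kE bal; case: (odd L0) L0_half => /=; lia.
  by rewrite perm_cat2r.
- exact: divn_eq.
- rewrite /s_num cE sla smu (_ : _.*2 + _ + _ = (size Ex + size Ey + k + d).*2); last by clear -kE; lia.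
  by rewrite doubleK; clear -RtE Rt_div kE; lia.
- rewrite /t_num cE.
  by clear -L0E s_mue le_m; lia.
Qed.

Local Open Scope ring_scope.

Theorem theorem1p3 (R : realType) (la mu : seq nat) (o e : nat)
  (w : nat -> nat -> nat -> nat -> R)
  (hla : is_partition la) (hmu : is_partition mu)
  (hsum : sumn la = sumn mu)
  (ho : odd o) (ho1 : o <> 1%N) (ho2 : (2 <= count_mem o la)%N)
  (he : ~~ odd e) (heo : (2 * o <= e)%N) (hemu : e \in mu)
  (hw : forall g h m i j : nat, (i < j)%N -> w g h m i < w g h m j) :
  forall eps : R, 0 < eps ->
  exists N : nat, forall g h m : nat,
    (N <= g)%N -> (N <= h)%N -> (N <= m)%N ->
    1 - eps <=
      ln (z_num (w g h m) la mu o g h m)%:R /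
      (h%:R / 3 * ln h%:R + 2 * g%:R * ln m%:R + 4 * m%:R * ln m%:R).
Proof.
move=> eps eps0; have [C CP] := leq_z_num hla hmu hsum ho ho1 ho2 he heo hemu.
apply: (@liminf_bound R eps C (fun g h m => z_num (w g h m) la mu o g h m)) => // g h m.
exact: CP (hw g h m).
Qed.
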